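(* Let $x\in\Omega$ be an arbitrary point and let $\sigma$ be a needle with tip at $x$. Let $\xi=\{v_n\}$ be an arbitrary needle sequence for $(x,\sigma)$. Then, for any point $z\in\sigma(]0,1[)$ and any open ball $B$ centred at $z$, $$\lim_{n\to\infty}\int_{B\cap\Omega}|\nabla v_n(y)|^2\,dy=\infty.$$
   Context: $m\in\{2,3\}$, $\Omega\subset\mathbb{R}^m$ is a bounded domain with Lipschitz boundary, $k\ge 0$ is fixed, and $0$ is not a Dirichlet eigenvalue of $\Delta+k^2$ in $\Omega$. Functions are complex valued. $G_k$ denotes the standard fundamental solution of the Helmholtz equation $\Delta u+k^2u=0$ in $\mathbb{R}^m$: $G_k(y)=\frac{e^{ik|y|}}{4\pi|y|}$ if $m=3$; $G_k(y)=\frac{i}{4}H^{(1)}_0(k|y|)$ if $m=2$, $k>0$; $G_0(y)=\frac{1}{2\pi}\log\frac{1}{|y|}$ if $m=2$, $k=0$. Needle: given $x\in\Omega$, a needle with tip at $x$ is a (continuous) piecewise linear curve $\sigma:[0,1]\to\overline\Omega$ that is injective and satisfies $\sigma(0)\in\partial\Omega$, $\sigma(1)=x$ and $\sigma(t)\in\Omega$ for all $t\in\,]0,1[$. Needle sequence: a sequence $\xi=\{v_n\}$ of $H^1(\Omega)$ solutions of $\Delta v_n+k^2v_n=0$ in $\Omega$ is a needle sequence for $(x,\sigma)$ if for each compact set $K\subset\mathbb{R}^m$ with $K\subset\Omega\setminus\sigma([0,1])$, $$\lim_{n\to\infty}\bigl(\|v_n(\cdot)-G_k(\cdot-x)\|_{L^2(K)}+\|\nabla\{v_n(\cdot)-G_k(\cdot-x)\}\|_{L^2(K)}\bigr)=0.$$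 *)

(* Defs.v *)
From HB Require Import structures.
From mathcomp Require Import all_boot all_order all_algebra complex.
From mathcomp Require Import all_classical all_reals all_analysis.

Set Implicit Arguments.
Unset Strict Implicit.
Unset Printing Implicit Defensive.

Import Order.TTheory GRing.Theory Num.Theory.
Import numFieldNormedType.Exports.

Local Open Scope classical_set_scope.
Local Open Scope ring_scope.
Local Open Scope complex_scope.

(* R^m is 'rV[R]_m with the library topology.  The matrix norm of the library is
   the sup norm, so Euclidean lengths and balls are defined separately.  *)

Section rV_measurable.
Variables (R : realType) (n : nat).

Definition rV_coord (i : 'I_n) (v : 'rV[R]_n) : measurableTypeR R := v 0 i.

(* The product sigma-algebra of the Borel sigma-algebra of R, which is the Borel
   sigma-algebra of R^n.  *)
Let rV_set0 : g_sigma_preimage rV_coord set0.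
Proof. exact: sigma_algebra0. Qed.

Let rV_setC A : g_sigma_preimage rV_coord A -> g_sigma_preimage rV_coord (~` A).
Proof. exact: sigma_algebraC. Qed.

Let rV_bigcup (F : _^nat) : (forall i, g_sigma_preimage rV_coord (F i)) ->
  g_sigma_preimage rV_coord (\bigcup_i (F i)).
Proof. exact: sigma_algebra_bigcup. Qed.

HB.instance Definition _ := @isMeasurable.Build default_measure_display
  'rV[R]_n (g_sigma_preimage rV_coord) rV_set0 rV_setC rV_bigcup.

Lemma measurable_rV_coord (i : 'I_n) : measurable_fun setT (rV_coord i).
Proof.
move=> _ Y mY; rewrite setTI; apply: sub_sigma_algebra => /=.
rewrite -bigcup_seq/=; exists i => /=; first by rewrite mem_index_enum.
by exists Y => //; rewrite setTI.
Qed.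

Lemma measurable_fun_rVP d (T : measurableType d) (f : T -> 'rV[R]_n) :
  (forall i, measurable_fun setT (rV_coord i \o f)) -> measurable_fun setT f.
Proof.
move=> mf _ A mA; rewrite setTI.
have : preimage_set_system setT f (g_sigma_preimage rV_coord) (f @^-1` A).
  by exists A => //; rewrite setTI.
rewrite -g_sigma_preimage_comp.
apply: smallest_sub => /=; first exact: sigma_algebra_measurable.
rewrite -bigcup_seq => B [i _ [C mC <-]]; exact: mf.
Qed.

End rV_measurable.

Section lebesgue_rV.
Variable R : realType.

Definition rV_cons n (p : measurableTypeR R * 'rV[R]_n) : 'rV[R]_n.+1 :=
  \row_j (if unlift ord0 j is Some i then p.2 0 i else p.1).

Lemma rV_cons0 n p : rV_coord ord0 (@rV_cons n p) = p.1.
Proof. by rewrite /rV_coord mxE unlift_none. Qed.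

Lemma rV_consS n p (i : 'I_n) :
  rV_coord (lift ord0 i) (@rV_cons n p) = rV_coord i p.2.
Proof. by rewrite /rV_coord mxE liftK. Qed.

Lemma measurable_rV_cons n : measurable_fun setT (@rV_cons n).
Proof.
apply: measurable_fun_rVP => i; case: (unliftP ord0 i) => [j|] ->.
  rewrite (_ : _ \o _ = rV_coord j \o snd); last first.
    by apply/funext => p /=; rewrite rV_consS.
  apply: measurableT_comp => //; exact: measurable_rV_coord.
by rewrite (_ : _ \o _ = fst)//; apply/funext => p /=; rewrite rV_cons0.
Qed.

Definition rV_tail n (v : 'rV[R]_n.+1) : 'rV[R]_n := \row_i v 0 (lift ord0 i).

Lemma rV_consK n p : rV_tail (@rV_cons n p) = p.2.
Proof. by apply/rowP => i; rewrite mxE; exact: rV_consS. Qed.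

Lemma measurable_rV_tail n : measurable_fun setT (@rV_tail n).
Proof.
apply: measurable_fun_rVP => i.
rewrite (_ : _ \o _ = rV_coord (lift ord0 i)); first exact: measurable_rV_coord.
by apply/funext => v; rewrite /= /rV_coord mxE.
Qed.

Section step.
(* One more coordinate: the image of lebesgue_measure \x mu.  *)
Variables (n : nat) (mu : {sigma_finite_measure set 'rV[R]_n -> \bar R}).

Definition lebesgue_rV_step : set 'rV[R]_n.+1 -> \bar R :=
  pushforward (lebesgue_measure \x mu)%E (@rV_cons n).

Let m : {measure set 'rV[R]_n.+1 -> \bar R} :=
  measure_function_pushforward__canonical__measure_function_Measure
    (lebesgue_measure \x mu)%E (@measurable_rV_cons n).

Let step0 : lebesgue_rV_step set0 = 0%E. Proof. exact: (measure0 m). Qed.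
Let step_ge0 A : (0 <= lebesgue_rV_step A)%E. Proof. exact: (measure_ge0 m). Qed.
Let step_additive : semi_sigma_additive lebesgue_rV_step.
Proof. exact: (@measure_semi_sigma_additive _ _ _ m). Qed.

HB.instance Definition _ := isMeasure.Build _ _ _ lebesgue_rV_step
  step0 step_ge0 step_additive.

Let step_sigma_finite : sigma_finite setT lebesgue_rV_step.
Proof.
have /sigma_finiteP[F [TF ndF Foo]] := sigma_finiteT (@lebesgue_measure R).
have /sigma_finiteP[G [TG ndG Goo]] := sigma_finiteT mu.
exists (fun i => [set v | F i (rV_coord ord0 v)] `&` [set v | G i (rV_tail v)]).
  apply/seteqP; split=> // v _.
  have [i _ Fi] : (\bigcup_i F i) (rV_coord ord0 v) by rewrite -TF.
  have [j _ Gj] : (\bigcup_i G i) (rV_tail v) by rewrite -TG.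
  exists (maxn i j) => //; split.
    by have /subsetPset := ndF _ _ (leq_maxl i j); apply.
  by have /subsetPset := ndG _ _ (leq_maxr i j); apply.
move=> i; have [mF Fi] := Foo i; have [mG Gi] := Goo i; split.
  apply: measurableI.
    by rewrite -[X in measurable X]setTI; exact: measurable_rV_coord.
  by rewrite -[X in measurable X]setTI; exact: measurable_rV_tail.
rewrite /lebesgue_rV_step /pushforward.
rewrite [X in (_ X < _)%E](_ : _ = F i `*` G i); last first.
  by apply/seteqP; split => p; rewrite /= rV_cons0 rV_consK.
by rewrite product_measure1E// lte_mul_pinfty// ge0_fin_numE.
Qed.

HB.instance Definition _ := Measure_isSigmaFinite.Build _ _ _ lebesgue_rV_step
  step_sigma_finite.

End step.

Fixpoint lebesgue_rV n : {sigma_finite_measure set 'rV[R]_n -> \bar R} :=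
  if n is n'.+1 then lebesgue_rV_step (lebesgue_rV n') else dirac (0 : 'rV[R]_0).

Lemma lebesgue_rV_box n (A : 'I_n -> set (measurableTypeR R)) :
  (forall i, measurable (A i)) ->
  lebesgue_rV n [set v | forall i, A i (v 0 i)] =
  (\prod_(i < n) lebesgue_measure (A i))%E.
Proof.
elim: n A => [|n IH] A mA; first by rewrite big_ord0 /= diracE mem_set // => -[].
have mbox : measurable [set v : 'rV[R]_n | forall i, A (lift ord0 i) (v 0 i)].
  rewrite (_ : [set _ | _] = \bigcap_(i in [set: 'I_n]) (rV_coord i @^-1` A (lift ord0 i))).
    apply: fin_bigcap_measurable => // i _; rewrite -[X in measurable X]setTI.
    exact: measurable_rV_coord.
  by apply/seteqP; split => v; [move=> h i _; exact: h|move=> h i; exact: h].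
rewrite big_ord_recl -IH// -product_measure1E//= /lebesgue_rV_step /pushforward.
congr (_ _); apply/seteqP; split => -[a v] /=.
  move=> h; split; first by have := h ord0; rewrite -/(rV_coord _ _) rV_cons0.
  by move=> i; have := h (lift ord0 i); rewrite -/(rV_coord _ _) rV_consS.
move=> [Aa Av] i; rewrite -/(rV_coord _ _); case: (unliftP ord0 i) => [j|] ->.
  by rewrite rV_consS; exact: Av.
by rewrite rV_cons0.
Qed.

End lebesgue_rV.

Section euclidean.
Variables (R : realType) (m : nat).
Implicit Types y z : 'rV[R]_m.

Definition dot y z : R := \sum_j y 0 j * z 0 j.

Definition enorm y : R := Num.sqrt (dot y y).

Definition eball z (r : R) : set 'rV[R]_m := [set y | enorm (y - z) < r].

Definition boundary (A : set 'rV[R]_m) := closure A `\` interior A.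

(* Near each boundary point, Omega is the strict epigraph of a Lipschitz function
   over a hyperplane e^\perp: y - <y, e> e is the projection of y on e^\perp, and
   gamma only matters there.  *)
Definition lipschitz_boundary (Omega : set 'rV[R]_m) :=
  forall p, boundary Omega p ->
  exists (r : R) (e : 'rV[R]_m) (gamma : 'rV[R]_m -> R) (L : R),
    [/\ 0 < r, enorm e = 1, L.-lipschitz gamma &
      forall y, eball p r y ->
        (Omega y <-> gamma (y - dot y e *: e) < dot y e)].

Definition bounded_lipschitz_domain (Omega : set 'rV[R]_m) :=
  [/\ open Omega, connected Omega, bounded_set Omega &
      lipschitz_boundary Omega].

Definition piecewise_linear (sigma : R -> 'rV[R]_m) :=
  exists (N : nat) (t : nat -> R),
    [/\ t 0%N = 0, t N = 1, forall i, (i < N)%N -> t i < t i.+1 &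
      forall i, (i < N)%N -> exists a b : 'rV[R]_m,
        forall s, s \in `[t i, t i.+1] -> sigma s = a + s *: b].

Definition needle (Omega : set 'rV[R]_m) (x : 'rV[R]_m)
    (sigma : R -> 'rV[R]_m) :=
  [/\ {within `[0, 1], continuous sigma},
      piecewise_linear sigma,
      {in `[0, 1] &, injective sigma} &
      [/\ boundary Omega (sigma 0), sigma 1 = x,
          forall t, t \in `[0, 1] -> closure Omega (sigma t) &
          forall t, t \in `]0, 1[ -> Omega (sigma t)]].

End euclidean.

Section sobolev.
Variables (R : realType) (m : nat).
Implicit Types (Omega A : set 'rV[R]_m) (f u phi : 'rV[R]_m -> R[i]).
Implicit Types (g : 'I_m -> 'rV[R]_m -> R[i]).

Local Notation leb := (lebesgue_rV R m).

Definition partial (j : 'I_m) f : 'rV[R]_m -> R[i] := fun y =>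
  ('D_(delta_mx 0 j) (fun w => complex.Re (f w)) y) +i*
  ('D_(delta_mx 0 j) (fun w => complex.Im (f w)) y).

Definition smooth f := forall (s : seq 'I_m) y,
  differentiable (fun w => complex.Re (foldr partial f s w)) y /\
  differentiable (fun w => complex.Im (foldr partial f s w)) y.

Definition test_function Omega phi := smooth phi /\
  exists K, [/\ compact K, K `<=` Omega & forall y, ~ K y -> phi y = 0].

Definition cintegral A f : R[i] :=
  (\int[leb]_(y in A) complex.Re (f y)) +i*
  (\int[leb]_(y in A) complex.Im (f y)).

Definition cabs f : 'rV[R]_m -> R := fun y => ComplexField.Normc.normc (f y).

Definition gabs g : 'rV[R]_m -> R :=
  fun y => Num.sqrt (\sum_j cabs (g j) y ^+ 2).

Definition L2norm A (h : 'rV[R]_m -> R) : \bar R :=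
  ('N[leb]_2%:E [EFin \o (h \_ A)])%E.

Definition L2 Omega u :=
  [/\ measurable_fun Omega (fun y => complex.Re (u y)),
      measurable_fun Omega (fun y => complex.Im (u y)) &
      (L2norm Omega (cabs u) < +oo)%E].

Definition weak_gradient Omega u g := forall j phi, test_function Omega phi ->
  cintegral Omega (fun y => u y * partial j phi y) =
  - cintegral Omega (fun y => g j y * phi y).

Definition L2_gradient Omega u g :=
  (forall j, L2 Omega (g j)) /\ weak_gradient Omega u g.

Definition H1 Omega u := L2 Omega u /\ exists g, L2_gradient Omega u g.

(* A representative of the weak gradient, which is unique almost everywhere in
   Omega; 0 when u has no weak gradient in L^2(Omega).  *)
Definition grad Omega u : 'I_m -> 'rV[R]_m -> R[i] :=
  xget (fun _ _ => 0) [set g | L2_gradient Omega u g].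

(* H^1_0(Omega), the closure in H^1(Omega) of the test functions.  *)
Definition H10 Omega u := H1 Omega u /\
  forall eps : R, 0 < eps -> exists2 phi, test_function Omega phi &
    (L2norm Omega (cabs (fun y => u y - phi y)%R) +
     L2norm Omega (gabs (fun j y => grad Omega u j y - partial j phi y)%R)
       < eps%:E)%E.

(* The weak form of (Laplacian + k^2) u = 0 in Omega, for u in H^1(Omega).  *)
Definition weak_helmholtz Omega (k : R) u := forall phi, test_function Omega phi ->
  cintegral Omega (fun y => \sum_j grad Omega u j y * partial j phi y) =
  (k ^+ 2)%:C * cintegral Omega (fun y => u y * phi y).

Definition H1_solution Omega k u := H1 Omega u /\ weak_helmholtz Omega k u.

Definition zero_dirichlet_eigenvalue Omega k := exists u,
  [/\ H10 Omega u, weak_helmholtz Omega k u &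
      ~ {ae leb, forall y, Omega y -> u y = 0}].

End sobolev.

Section fundamental_solution.
Variable R : realType.
Implicit Types t k : R.

Definition euler_gamma : R := limn (fun n => series harmonic n - ln n%:R).

Definition bessel_J0 t : R :=
  limn (series (fun j => (-1) ^+ j * (t / 2) ^+ (2 * j) / (j`!)%:R ^+ 2)).

(* The expansion of Y_0 at 0; series harmonic j is the harmonic number H_j.  *)
Definition bessel_Y0 t : R :=
  2 / pi * ((ln (t / 2) + euler_gamma) * bessel_J0 t
    - limn (series (fun j => (-1) ^+ j * series harmonic j *
                             (t / 2) ^+ (2 * j) / (j`!)%:R ^+ 2))).

Definition hankel1_0 t : R[i] := bessel_J0 t +i* bessel_Y0 t.

(* Meant for m = 2 and m = 3 only, and y != 0.  *)
Definition helmholtz_G (m : nat) k (y : 'rV[R]_m) : R[i] :=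
  if m == 3%N then
    (cos (k * enorm y) +i* sin (k * enorm y)) / (4 * pi * enorm y)%:C
  else if k == 0 then ((2 * pi)^-1 * ln (enorm y)^-1)%:C
  else 'i%C / 4 * hankel1_0 (k * enorm y).

End fundamental_solution.

(* Every compact K below avoids x = sigma 1, where G_k(. - x) is singular, so its
   gradient on K is the classical one.  *)
Definition needle_sequence (R : realType) (m : nat) (Omega : set 'rV[R]_m) (k : R)
    (x : 'rV[R]_m) (sigma : R -> 'rV[R]_m) (v : nat -> 'rV[R]_m -> R[i]) :=
  (forall n, H1_solution Omega k (v n)) /\
  forall K : set 'rV[R]_m, compact K -> K `<=` Omega `\` sigma @` `[0, 1] ->
    (L2norm K (cabs (fun y => v n y - helmholtz_G k (y - x))%R) +
     L2norm K (gabs (fun j y => grad Omega (v n) j y -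
                                partial j (fun w => helmholtz_G k (w - x)) y)%R))%E
      @[n --> \oo] --> 0%E.

(* Main.v *)
Require Import Defs.
From mathcomp Require Import all_boot all_order all_algebra complex.
From mathcomp Require Import all_classical all_reals all_analysis.
From mathcomp Require Import measurable_realfun ring lra.

(* Suppose that the energy of [v n] in [B] stays below [M] for some large [n].
   The needle is straight near some point of [B], so there are a test function
   [chi], equal to 1 near [x], and a direction [b] such that near the needle
   [grad chi] vanishes outside [B] and is parallel to [b].  For a unit vector [f]
   orthogonal to [b], [w y = cos (k (y - x).f)] is a Helmholtz solution with
   [grad w . grad chi = 0] near the needle.  The weak equation tested with
   [chi w] and [chi d_j w] gives
     int (w grad (v n) - (v n) grad w) . grad chi = 0.
   With [G_k(. - x)] instead of [v n] the integral is independent of [chi], since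
   [w grad G_k - G_k grad w] has no divergence off [x], and it is nonzero: for a
   radial [chi] supported close to [x] the integrand has a sign.  But the two
   integrals are close: away from the needle by the convergence of [v n], and near
   the needle because [grad (v n)] is bounded in L^2(B) and a tube around a segment
   has small measure.  Real parts suffice. *)

Set Implicit Arguments.
Unset Strict Implicit.
Unset Printing Implicit Defensive.

Import Order.TTheory GRing.Theory Num.Theory.
Import numFieldNormedType.Exports.

Local Open Scope classical_set_scope.
Local Open Scope ring_scope.

(** * Smooth functions and cutoffs *)

(** A bound on the energy gives no bound on the values of [v n] near the needle, so a term in which
    [v n] itself multiplies a derivative of [chi] there could not be controlled. This dictates the
    plane wave: its gradient is parallel to [f], hence orthogonal to [grad chi] near the needle, and
    only [grad (v n)] survives there. For [k = 0] the wave is the constant 1. Dimension at least 2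
    enters twice: in the existence of [f], and in a segment being a null set. The tube must not
    depend on [n]. The function [chi], the limit integral [J] and then, from [M], the tube are fixed
    first; the convergence of [v n] is used only afterwards, on the compact set left outside the
    tube. Products are split by [|a b| <= s a ^ 2 + b ^ 2 / (4 s)]: the squares are integrated
    against the energy or the convergence, the remainder against the measure of the region. Real
    parts suffice because the multipliers [chi w] and [chi d_j w] and the number [k ^ 2] are real,
    and the singularity of [G_k] lies in its real part. All that depends on the dimension is
    gathered in [radial_solution]. *)

Section chain.
Variable R : realType.

Lemma derive_line (V : normedModType R) (f : V -> R) (y v : V) :
  'D_v f y = (fun t : R => f (t *: v + y))^`()%classic 0.
Proof.
rewrite derive1E /derive.
set g1 := fun h => h^-1 *: _; set g2 := fun h => h^-1 *: _.
suff -> : g1 = g2 by [].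
by rewrite funeqE /g1 /g2 => h /=; rewrite addr0 scale0r add0r [_%:A]mulr1.
Qed.

(** Of [f] only a derivative along [v] is given, so the chain rule is applied to its restriction to
    the line through [y], where it is the rule for one real variable. *)
Lemma is_derive_comp1 (V : normedModType R) (f : V -> R) (h : R -> R)
    (y v : V) (df dh : R) :
  is_derive y v f df -> is_derive (f y) 1 h dh ->
  is_derive y v (h \o f) (dh * df).
Proof.
move=> [fd <-] [hd <-].
have fd1 : derivable (fun t : R => f (t *: v + y)) 0 1.
  exact: (iffLR (derivable1P f y v)) fd.
have hd1 : derivable h (f (0 *: v + y)) 1.
  rewrite scale0r add0r; exact: hd.
have d : derivable (h \o (fun t : R => f (t *: v + y))) 0 1.
  apply: (iffRL (derivable1_diffP _ _)); apply: differentiable_comp.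
    exact: (iffLR (derivable1_diffP _ _) fd1).
  exact: (iffLR (derivable1_diffP _ _) hd1).
apply: DeriveDef; first exact: (iffRL (derivable1P (h \o f) y v)) d.
rewrite derive_line (derive_line f) (derive1_comp fd1 hd1).
by rewrite scale0r add0r derive1E.
Qed.

(* Functions of this form are closed under differentiation, which makes
   [exp (- 1 / t)] smooth at 0. *)
Definition flat (p : {poly R}) (t : R) : R :=
  if 0 < t then p.[t^-1] * expR (- t^-1) else 0.

(** A single term of the exponential series already gives [u ^ n <= n! exp u]. *)
Lemma exprn_expR_bounded n (u : R) : 0 <= u -> u ^+ n * expR (- u) <= n`!%:R.
Proof.
move=> u0; rewrite expRN ler_pdivrMr ?expR_gt0//.
case: n => [|n].
  by rewrite expr0 fact0 mul1r; apply: le_trans (expR_ge1Dx _); rewrite lerDl.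
have := expR_ge1Dxn n u0; rewrite -ler_pdivrMl ?ltr0n ?fact_gt0// mulrC => h.
by apply: le_trans h; rewrite lerDr.
Qed.

Lemma horner_expR_bounded (p : {poly R}) :
  exists2 C, 0 <= C & forall u, 0 <= u -> `|p.[u] * expR (- u)| <= C.
Proof.
exists (\sum_(i < size p) `|p`_i| * i`!%:R).
  by apply: sumr_ge0 => i _; rewrite mulr_ge0.
move=> u u0; rewrite horner_coef mulr_suml; apply: le_trans (ler_norm_sum _ _ _) _.
apply: ler_sum => i _; rewrite -mulrA normrM ler_wpM2l//.
rewrite ger0_norm; first exact: exprn_expR_bounded.
by rewrite mulr_ge0 ?exprn_ge0 ?expR_ge0.
Qed.

Lemma flat_le0 p t : t <= 0 -> flat p t = 0.
Proof. by rewrite /flat leNgt => /negbTE ->. Qed.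

Lemma flat_gt0 p t : 0 < t -> flat p t = p.[t^-1] * expR (- t^-1).
Proof. by rewrite /flat => ->. Qed.

(** For [t > 0] the chain rule gives [t ^ (-2) (p - p')(1 / t) exp (- 1 / t)], and the factor
    [t ^ (-2)] becomes ['X ^+ 2]. *)
Lemma is_derive_flat (p : {poly R}) (t : R) :
  is_derive t (1 : R) (flat p) (flat ('X ^+ 2 * (p - p^`())) t).
Proof.
case: (ltgtP t 0) => [t0|t0|->].
- rewrite flat_le0 ?ltW//; apply: (@near_eq_is_derive R R R (cst 0)).
  + by near=> s; rewrite flat_le0// ltW//; near: s; exact: lt_nbhsl.
- rewrite flat_gt0//.
  apply: (@near_eq_is_derive R R R (fun s : R => p.[s^-1] * expR (- s^-1))).
  + by near=> s; rewrite flat_gt0//; near: s; exact: (cvgr_gt t cvg_id).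
  have d1 : is_derive t 1 (fun s : R => s^-1) (- t ^- 2).
    have tn0 : t != 0 by rewrite gt_eqF.
    apply: DeriveDef; first exact: derivableV.
    by rewrite deriveV// derive_id scaler1.
  have d2 : is_derive t 1 (fun s : R => p.[s^-1]) (p^`().[t^-1] * - t ^- 2).
    exact: (@is_derive_comp1 _ (fun s : R => s^-1) (horner p)).
  have d3 : is_derive t 1 (fun s : R => expR (- s^-1)) (expR (- t^-1) * t ^- 2).
    apply: (@is_derive_comp1 _ (fun s : R => - s^-1) expR).
    by rewrite -[t ^- 2]opprK; exact: is_deriveN.
  apply: is_derive_eq.
  rewrite !hornerE /= /GRing.scale /=; field; first by rewrite gt_eqF.
- rewrite flat_le0//.
  (* For [h > 0] the quotient [flat p h / h] equals [h] times the value of ['X^2 * p] at [1 / h]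
     times [exp (- 1 / h)], hence is at most [C h] in absolute value. *)
  have [C C0 HC] := horner_expR_bounded ('X^2 * p).
  have H : h^-1 *: ((flat p \o shift 0) (h *: (1 : R)) - flat p 0) @[h --> 0^'] --> (0 : R).
    apply/cvgr0Pnorm_le => e e0.
    near=> h; rewrite /= addr0 [flat p 0]flat_le0// subr0 /GRing.scale /= mulr1.
    case: (leP h 0) => h0; first by rewrite flat_le0// mulr0 normr0 ltW.
    rewrite flat_gt0//.
    have := HC h^-1; rewrite invr_ge0 ltW// => /(_ isT).
    rewrite hornerM hornerXn -mulrA normrM => H.
    rewrite normrM.
    have -> : `|h^-1| = h * `|h^-1 ^+ 2|.
      rewrite !ger0_norm ?exprn_ge0 ?invr_ge0 ?ltW// expr2 mulrA divff ?mul1r// gt_eqF//.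
    rewrite -mulrA (mulrC p.[_]) -normrM.
    have : h <= e / (C + 1).
      near: h; apply: nbhs_dnbhs; apply: lt_le_nbhsl; by rewrite divr_gt0// ltr_wpDl.
    rewrite ler_pdivlMr ?ltr_wpDl// => he.
    apply: le_trans he; apply: ler_wpM2l; first exact: ltW.
    rewrite normrM (mulrC _ p.[_]) normrM in H *.
    by apply: le_trans H _; rewrite lerDl.
  by apply: DeriveDef; [apply/cvg_ex; exists 0|exact: cvg_lim H].
Unshelve. all: by end_near. Qed.

End chain.

Section elementary.
Variables (R : realType) (n : nat).
Implicit Types f g : 'rV[R]_n -> R.

(* Closed under partial derivatives, hence contained in [smooth]. *)
Inductive elementary : ('rV[R]_n -> R) -> Prop :=
| el_cst c : elementary (fun=> c)
| el_coord j : elementary (fun y => y 0 j)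
| el_add f g : elementary f -> elementary g -> elementary (fun y => f y + g y)
| el_mul f g : elementary f -> elementary g -> elementary (fun y => f y * g y)
| el_inv f : (forall y, f y != 0) -> elementary f -> elementary (fun y => (f y)^-1)
| el_sin f : elementary f -> elementary (fun y => sin (f y))
| el_cos f : elementary f -> elementary (fun y => cos (f y))
| el_flat p f : elementary f -> elementary (fun y => flat p (f y)).

Lemma el_opp f : elementary f -> elementary (fun y => - f y).
Proof.
move=> ef; rewrite (_ : (fun _ => _) = fun y => (-1) * f y).
  exact: el_mul (el_cst _) ef.
by apply/funext => y; rewrite mulN1r.
Qed.

Lemma el_sub f g : elementary f -> elementary g -> elementary (fun y => f y - g y).
Proof. by move=> ef eg; apply: el_add => //; exact: el_opp. Qed.

Lemma el_sum (I : Type) (s : seq I) (F : I -> 'rV[R]_n -> R) :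
  (forall i, elementary (F i)) -> elementary (fun y => \sum_(i <- s) F i y).
Proof.
move=> eF; elim: s => [|i s IH].
  rewrite (_ : (fun _ => _) = fun=> 0); first exact: el_cst.
  by apply/funext => y; rewrite big_nil.
rewrite (_ : (fun _ => _) = fun y => F i y + \sum_(i <- s) F i y).
  exact: el_add.
by apply/funext => y; rewrite big_cons.
Qed.

Lemma el_prod (I : Type) (s : seq I) (F : I -> 'rV[R]_n -> R) :
  (forall i, elementary (F i)) -> elementary (fun y => \prod_(i <- s) F i y).
Proof.
move=> eF; elim: s => [|i s IH].
  rewrite (_ : (fun _ => _) = fun=> 1); first exact: el_cst.
  by apply/funext => y; rewrite big_nil.
rewrite (_ : (fun _ => _) = fun y => F i y * \prod_(i <- s) F i y).
  exact: el_mul.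
by apply/funext => y; rewrite big_cons.
Qed.

Lemma el_differentiable f : elementary f -> forall y, differentiable f y.
Proof.
elim=> {f}.
- by move=> c y; exact: differentiable_cst.
- by move=> j y; exact: differentiable_coord.
- by move=> f g _ df _ dg y; exact: differentiableD.
- by move=> f g _ df _ dg y; exact: differentiableM.
- by move=> f f0 _ df y; apply: differentiableV.
- move=> f _ df y; apply: (@differentiable_comp _ _ _ _ f (@sin R)) => //.
  exact/derivable1_diffP.
- move=> f _ df y; apply: (@differentiable_comp _ _ _ _ f (@cos R)) => //.
  exact/derivable1_diffP.
- move=> p f _ df y; apply: (@differentiable_comp _ _ _ _ f (flat p)) => //.
  by apply/derivable1_diffP; case: (is_derive_flat p (f y)).
Qed.

Lemma el_continuous f : elementary f -> continuous f.
Proof. by move=> ef y; apply/differentiable_continuous/el_differentiable. Qed.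

Lemma el_is_derive f (y v : 'rV[R]_n) : elementary f -> is_derive y v f ('D_v f y).
Proof.
by move=> ef; apply/derivableP/diff_derivable; exact: el_differentiable.
Qed.

Lemma el_derive f (v : 'rV[R]_n) : elementary f -> elementary (fun y => 'D_v f y).
Proof.
move=> ef.
(* The value ['D_v f] alone is too weak for the induction, which also needs derivability of the
   parts; an explicit derivative carries both. *)
suff [f' [ef' Hf']] : exists f', elementary f' /\ forall y, is_derive y v f (f' y).
  rewrite (_ : (fun _ => _) = f')//; apply/funext => y.
  exact: (@derive_val _ _ _ _ _ _ _ (Hf' y)).
elim: ef => {f}.
- move=> c; exists (fun=> 0); split; first exact: el_cst.
  by move=> y; exact: is_derive_cst.
- move=> j; exists (fun=> v 0 j); split; first exact: el_cst.
  move=> y; apply: DeriveDef.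
    exact/diff_derivable/differentiable_coord.
  rewrite derive_line derive1E.
  rewrite (_ : (fun t : R => (t *: v + y) 0 j) = id * cst (v 0 j) + cst (y 0 j)); last first.
    by apply/funext => t; rewrite !mxE.
  rewrite derive_val.
  by rewrite scaler0 add0r addr0 /GRing.scale /= mulr1.
- move=> f g _ [f' [ef' Hf]] _ [g' [eg' Hg]]; exists (fun y => f' y + g' y).
  by split=> [|y]; [exact: el_add|exact: is_deriveD].
- move=> f g ef [f' [ef' Hf]] eg [g' [eg' Hg]].
  exists (fun y => f y * g' y + g y * f' y).
  by split=> [|y]; [by apply: el_add; exact: el_mul|exact: is_deriveM].
- move=> f f0 ef [f' [ef' Hf]]; exists (fun y => - ((f y)^-1 * (f y)^-1 * f' y)).
  split=> [|y].
    by apply/el_opp/el_mul => //; apply: el_mul; exact: el_inv.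
  have [df dfE] := Hf y.
  apply: DeriveDef; first exact: derivableV.
  by rewrite deriveV// dfE /GRing.scale /= mulNr -invfM expr2.
- move=> f ef [f' [ef' Hf]]; exists (fun y => cos (f y) * f' y).
  split=> [|y]; first by apply: el_mul => //; exact: el_cos.
  exact: (@is_derive_comp1 _ _ f (@sin R)).
- move=> f ef [f' [ef' Hf]]; exists (fun y => - sin (f y) * f' y).
  split=> [|y]; first by apply: el_mul => //; apply/el_opp/el_sin.
  exact: (@is_derive_comp1 _ _ f (@cos R)).
- move=> p f ef [f' [ef' Hf]].
  exists (fun y => flat ('X ^+ 2 * (p - p^`())) (f y) * f' y).
  split=> [|y]; first by apply: el_mul => //; apply/el_flat.
  by apply: (@is_derive_comp1 _ _ f (flat p)) => //; exact: is_derive_flat.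
Qed.

Lemma partial_real f j :
  partial j (fun y => (f y)%:C%C) = fun y => ('D_(delta_mx 0 j) f y)%:C%C.
Proof.
by apply/funext => y; rewrite /partial /=; congr (_ +i* _)%C; exact: derive_cst.
Qed.

Lemma el_smooth f : elementary f -> smooth (fun y => (f y)%:C%C).
Proof.
move=> ef s y.
have [g [eg ->]] : exists g, elementary g /\
    foldr (@partial R n) (fun y => (f y)%:C%C) s = fun y => (g y)%:C%C.
  elim: s => [|j s [g [eg IH]]]; first by exists f.
  exists (fun y => 'D_(delta_mx 0 j) g y); split; first exact: el_derive.
  by rewrite /= IH partial_real.
by split; [exact: el_differentiable|exact: differentiable_cst].
Qed.

End elementary.

(** * Squared Euclidean distance and the topology of the sup norm *)

Section norms.
Variables (R : realType) (n : nat).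
Implicit Types (y p : 'rV[R]_n) (e : R).

Lemma coord_le_norm y i : `|y 0 i| <= `|y|.
Proof.
have /mapP[j Hj ->] : `|y 0 i| \in [seq `|y x.1 x.2| | x : 'I_1 * 'I_n].
  by apply/mapP; exists (ord0, i) => //=; rewrite mem_enum.
by rewrite [leRHS]/Num.norm /= mx_normrE; apply/bigmax_geP; right => /=; exists j.
Qed.

Lemma rV_norm_lt y e : 0 < e -> (forall i, `|y 0 i| < e) -> `|y| < e.
Proof.
move=> e0 ye; rewrite [ltLHS]/Num.norm /= mx_normrE; apply/bigmax_ltP; split => //.
by move=> -[i j] _ /=; rewrite ord1.
Qed.

Lemma coord_sqr_le_dot y i : y 0 i ^+ 2 <= dot y y.
Proof.
rewrite /dot (bigD1 i)//= -expr2 lerDl; apply: sumr_ge0 => j _.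
by rewrite -expr2 sqr_ge0.
Qed.

Lemma dot_ge0 y : 0 <= dot y y.
Proof. by apply: sumr_ge0 => j _; rewrite -expr2 sqr_ge0. Qed.

Lemma dot_eq0 y : (dot y y == 0) = (y == 0).
Proof.
apply/eqP/eqP => [y0|->]; last first.
  by rewrite /dot big1// => i _; rewrite mxE mul0r.
apply/rowP => i; rewrite mxE; apply/eqP; rewrite -sqrf_eq0 eq_le sqr_ge0 andbT.
by rewrite -y0 coord_sqr_le_dot.
Qed.

Lemma dot_gt0 y : y != 0 -> 0 < dot y y.
Proof. by move=> y0; rewrite lt_def dot_ge0 dot_eq0 y0. Qed.

Lemma enorm_ge0 y : 0 <= enorm y. Proof. exact: sqrtr_ge0. Qed.

Lemma sqr_enorm y : enorm y ^+ 2 = dot y y.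
Proof. by rewrite sqr_sqrtr// dot_ge0. Qed.

Lemma dot_lt_norm y e : 0 < e -> dot y y < e ^+ 2 -> `|y| < e.
Proof.
move=> e0 ye; apply: rV_norm_lt => // i.
rewrite -ltr_sqr ?nnegrE ?normr_ge0 ?ltW// real_normK ?num_real//.
exact: le_lt_trans (coord_sqr_le_dot _ _) ye.
Qed.

(** Neighbourhoods are measured by the squared Euclidean distance because it is a polynomial in the
    coordinates, hence [elementary], and can be composed with cutoffs. *)
Lemma nbhs_dotP p (A : set 'rV[R]_n) :
  nbhs p A -> exists2 e, 0 < e & forall y, dot (y - p) (y - p) < e -> A y.
Proof.
move=> /nbhs_ballP[e /= e0 eA]; exists (e ^+ 2); first by rewrite exprn_gt0.
move=> y /(dot_lt_norm e0) ye; apply: eA.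
by rewrite -ball_normE /ball_/= distrC.
Qed.

Lemma el_dot p : elementary (fun y => dot (y - p) (y - p)).
Proof.
apply: el_sum => i.
rewrite (_ : (fun _ => _) = fun y : 'rV[R]_n => (y 0 i - p 0 i) * (y 0 i - p 0 i)).
  by apply: el_mul; apply: el_sub; [exact: el_coord|exact: el_cst| |exact: el_cst];
    exact: el_coord.
by apply/funext => y; rewrite !mxE.
Qed.

Lemma closed_elementary_le (f : 'rV[R]_n -> R) c :
  elementary f -> closed [set y | f y <= c].
Proof.
move=> ef; apply: (@closed_comp _ _ f [set x | x <= c]); last exact: closed_le.
by move=> x _; exact: el_continuous.
Qed.

Lemma open_elementary_lt (f : 'rV[R]_n -> R) c :
  elementary f -> open [set y | f y < c].
Proof.
move=> ef; apply: (@open_comp _ _ f [set x | x < c]); last exact: open_lt.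
by move=> x _; exact: el_continuous.
Qed.

Lemma compact_dot_le p c : compact [set y | dot (y - p) (y - p) <= c].
Proof.
apply: bounded_closed_compact; last exact/closed_elementary_le/el_dot.
exists (`|p| + (1 + `|c|)); split; first exact: num_real.
move=> M hM y /= yc; apply: le_trans (ltW hM).
rewrite -[y in leLHS](subrK p) addrC; apply: le_trans (ler_normD _ _) _.
rewrite lerD2l ltW//; apply: dot_lt_norm; first by rewrite ltr_pwDl.
apply: le_lt_trans yc _; rewrite sqrrD expr1n mul1r.
have := ler_norm c; have := normr_ge0 c; have := sqr_ge0 `|c|; lra.
Qed.

End norms.

(** * A smooth transition from 0 to 1 *)

Section step.
Variable R : realType.
Implicit Type t : R.

Lemma flat1_ge0 t : 0 <= flat 1 t.
Proof.
by rewrite /flat; case: ifP => // _; rewrite hornerC mul1r expR_ge0.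
Qed.

Lemma flat1_gt0 t : 0 < t -> 0 < flat 1 t.
Proof. by move=> t0; rewrite flat_gt0// hornerC mul1r expR_gt0. Qed.

Definition step_den t : R := flat 1 t + flat 1 (1 - t).

Lemma step_den_gt0 t : 0 < step_den t.
Proof.
case: (leP t 0) => t0; last by rewrite ltr_pwDl ?flat1_gt0 ?flat1_ge0.
by rewrite ltr_wpDl ?flat1_gt0 ?flat1_ge0// subr_gt0 (le_lt_trans t0).
Qed.

Definition smooth_step t : R := flat 1 t / step_den t.

Lemma smooth_step0 t : t <= 0 -> smooth_step t = 0.
Proof. by move=> t0; rewrite /smooth_step flat_le0// mul0r. Qed.

Lemma smooth_step1 t : 1 <= t -> smooth_step t = 1.
Proof.
move=> t1; have := step_den_gt0 t; rewrite /smooth_step /step_den.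
rewrite (@flat_le0 _ _ (1 - t)) ?subr_le0// addr0 => /lt0r_neq0 h.
by rewrite divff.
Qed.

(** The quotient rule for [smooth_step] after cancellation, [flat 'X^2] being the derivative of
    [flat 1]. In this form strict positivity on []0, 1[] is visible. *)
Definition dstep t : R :=
  (flat ('X^2) t * flat 1 (1 - t) + flat 1 t * flat ('X^2) (1 - t)) /
  step_den t ^+ 2.

Lemma flatX2_ge0 t : 0 <= flat ('X^2) t.
Proof.
rewrite /flat; case: ifP => // t0; rewrite hornerXn.
by rewrite mulr_ge0 ?expR_ge0// sqr_ge0.
Qed.

Lemma flatX2_gt0 t : 0 < t -> 0 < flat ('X^2) t.
Proof.
by move=> t0; rewrite flat_gt0// hornerXn mulr_gt0 ?expR_gt0// exprn_gt0 ?invr_gt0.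
Qed.

Lemma dstep_gt0 t : 0 < t < 1 -> 0 < dstep t.
Proof.
move=> /andP[t0 t1]; rewrite /dstep divr_gt0 ?exprn_gt0 ?step_den_gt0//.
rewrite ltr_pwDl// ?mulr_ge0 ?flat1_ge0 ?flatX2_ge0//.
by rewrite mulr_gt0 ?flat1_gt0 ?flatX2_gt0 ?subr_gt0.
Qed.

Lemma is_derive_smooth_step t : is_derive t (1 : R) smooth_step (dstep t).
Proof.
have H (s : R) : is_derive s (1 : R) (flat (1 : {poly R})) (flat 'X^2 s).
  have := is_derive_flat 1 s; rewrite (_ : 'X^2 * _ = 'X^2)//.
  by rewrite derivC subr0 mulr1.
have H1 : is_derive t 1 (fun s : R => flat 1 (1 - s)) (flat 'X^2 (1 - t) * (0 - 1)).
  apply: (@is_derive_comp1 _ _ (fun s : R => 1 - s) (flat 1)).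
have [dd ddE] : is_derive t 1 step_den (flat 'X^2 t + flat 'X^2 (1 - t) * (0 - 1)).
  exact: is_deriveD.
have dn0 : step_den t != 0 by rewrite gt_eqF// step_den_gt0.
have H2 : is_derive t 1 (fun s => (step_den s)^-1)
    (- (step_den t) ^- 2 * (flat 'X^2 t + flat 'X^2 (1 - t) * (0 - 1))).
  apply: DeriveDef; first exact: derivableV.
  by rewrite deriveV// ddE.
have -> : dstep t = flat 1 t *: (- (step_den t) ^- 2 *
      (flat 'X^2 t + flat 'X^2 (1 - t) * (0 - 1))) + (step_den t)^-1 *: flat 'X^2 t.
  rewrite /dstep /GRing.scale /=; move: dn0; rewrite /step_den => dn0.
  by field.
exact: is_deriveM.
Qed.

Lemma el_step n (f : 'rV[R]_n -> R) :
  elementary f -> elementary (fun y => smooth_step (f y)).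
Proof.
move=> ef; apply: el_mul; first exact: el_flat.
apply: el_inv; first by move=> y; rewrite gt_eqF// step_den_gt0.
by apply: el_add; apply: el_flat => //; apply: el_sub => //; exact: el_cst.
Qed.

End step.

Section urysohn.
Variables (R : realType) (n : nat).

(** Finitely many balls cover [K], each with a bump [b1 p]. The function [1 - prod (1 - b1 p)] is 1
    as soon as one bump is 1, and 0 where all of them vanish, so overlaps call for no
    normalisation. *)
Lemma elementary_urysohn (K U : set 'rV[R]_n) : compact K -> open U -> K `<=` U ->
  exists b : 'rV[R]_n -> R, [/\ elementary b,
    forall y, K y -> \forall y' \near y, b y' = 1 &
    exists K', [/\ compact K', K' `<=` U & forall y, ~ K' y -> b y = 0]].
Proof.
move=> cK oU KU.
pose q (p y : 'rV[R]_n) := dot (y - p) (y - p).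
have /choice[e He] : forall p, exists e : R, 0 < e /\
    (K p -> forall y, q p y <= e * 2 -> U y).
  move=> p; have [Kp|nKp] := pselect (K p); last by exists 1.
  have [e e0 eU] := nbhs_dotP (open_nbhs_nbhs (conj oU (KU _ Kp))).
  (* A third leaves room for the doubled ball, outside which the bump will vanish. *)
  exists (e / 3); split; first by rewrite divr_gt0.
  by move=> _ y ye; apply: eU; apply: le_lt_trans ye _; lra.
have [D DK Dcov] : finite_subset_cover K (fun p => [set y | q p y < e p]) K.
  move: cK; rewrite compact_cover; apply.
    by move=> p _; exact/open_elementary_lt/el_dot.
  move=> p Kp; exists p => //=.
  by rewrite /q subrr (eqP (_ : dot 0 0 == 0)) ?dot_eq0//; have [] := He p.
(* [b1 p] is 1 where [q p <= e p] and 0 where [q p >= 2 * e p]. *)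
pose b1 p y := smooth_step (2 - q p y / e p).
exists (fun y => 1 - \prod_(p <- finmap.enum_fset D) (1 - b1 p y)); split.
- apply: el_sub; first exact: el_cst.
  apply: el_prod => p; apply: el_sub; first exact: el_cst.
  apply: el_step; apply: el_sub; first exact: el_cst.
  by apply: el_mul; [exact: el_dot|exact: el_cst].
- move=> y /Dcov[p /= pD] qy.
  have : \forall y' \near y, q p y' < e p.
    by apply: open_nbhs_nbhs; split => //; exact/open_elementary_lt/el_dot.
  apply: filterS => y' qy'; rewrite (big_rem p)//= [b1 p y']smooth_step1.
    by rewrite subrr mul0r subr0.
  by rewrite lerBrDr -lerBrDl ler_pdivrMr ?(He p).1//; lra.
- exists (\big[setU/set0]_(p <- finmap.enum_fset D) [set y | q p y <= e p * 2]); split.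
  + by apply: bigsetU_compact => p _; exact: compact_dot_le.
  + move=> y; rewrite -bigcup_seq => -[p /= pD].
    by apply: (He p).2; have := DK _ pD; rewrite inE.
  + move=> y; rewrite -bigcup_seq => nKy; rewrite big_seq big1 ?subrr// => p pD.
    rewrite [b1 p y]smooth_step0 ?subr0//.
    rewrite subr_le0 ler_pdivlMr ?(He p).1// mulrC leNgt; apply/negP => h.
    by apply: nKy; exists p => //=; rewrite ltW.
Qed.

End urysohn.

(** * Lebesgue measure on R^m *)

Section measure_rV.
Variables (R : realType) (n : nat).
Local Notation leb := (lebesgue_rV R n).

Lemma measurable_rV_box (A : 'I_n -> set (measurableTypeR R)) :
  (forall i, measurable (A i)) -> measurable [set v : 'rV[R]_n | forall i, A i (v 0 i)].
Proof.
move=> mA.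
rewrite (_ : [set _ | _] = \bigcap_(i in [set: 'I_n]) (@rV_coord R n i @^-1` A i)).
  apply: fin_bigcap_measurable => // i _; rewrite -[X in measurable X]setTI.
  exact: measurable_rV_coord.
by apply/seteqP; split => v; [move=> h i _; exact: h|move=> h i; exact: h].
Qed.

(** For [e > 0] this is the open ball of the sup norm, written as a box so that its measure is a
    product of lengths. *)
Definition cube (c : 'rV[R]_n) (e : R) : set 'rV[R]_n :=
  [set v | forall i, `]c 0 i - e, c 0 i + e[%classic (v 0 i)].

Lemma measurable_cube c e : measurable (cube c e).
Proof.
exact: (@measurable_rV_box (fun i => `]c 0 i - e, c 0 i + e[%classic)).
Qed.

Lemma cubeP c e v : cube c e v <-> forall i, `|v 0 i - c 0 i| < e.
Proof.
split=> h i; have := h i; rewrite /= in_itv /= ltr_distl//.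
Qed.

Lemma lebesgue_cube c e : 0 <= e -> leb (cube c e) = ((e *+ 2) ^+ n)%:E.
Proof.
move=> e0; rewrite [leb]lock.
rewrite (_ : locked leb _ = \prod_(i < n) (e *+ 2)%:E)%E; last first.
  rewrite -lock (@lebesgue_rV_box R n (fun i => `]c 0 i - e, c 0 i + e[%classic))//.
  apply: eq_bigr => i _; rewrite lebesgue_measure_itv/= lte_fin.
  case: ltP => [_|h]; first by rewrite -EFinB; congr EFin; rewrite mulr2n; ring.
  suff -> : e = 0 by rewrite mul0rn.
  by apply: le_anti; rewrite e0 andbT; lra.
elim: (n) => [|k IH]; first by rewrite big_ord0 expr0.
by rewrite big_ord_recl IH exprS EFinM.
Qed.

Lemma nbhs_cube (v : 'rV[R]_n) (A : set 'rV[R]_n) :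
  nbhs v A -> exists2 e, 0 < e & cube v e `<=` A.
Proof.
move=> /nbhs_ballP[e /= e0 eA]; exists e => // w /cubeP vw; apply: eA.
rewrite -ball_normE /ball_/= distrC; apply: rV_norm_lt => // i.
by rewrite !mxE.
Qed.

(** The sigma-algebra is generated by the coordinates, so an open set is exhibited as a countable
    union of cubes with rational centres and radii [1 / (k + 1)]. *)
Lemma open_measurable_rV (U : set 'rV[R]_n) : open U -> measurable U.
Proof.
move=> oU.
pose F (p : 'rV[rat]_n * nat) : set 'rV[R]_n :=
  let B := cube (map_mx ratr p.1) (p.2.+1%:R^-1) in
  if `[< B `<=` U >] then B else set0.
rewrite (_ : U = \bigcup_p F p).
  apply: countable_bigcupT_measurable => // p; rewrite /F.
  by case: ifP => // _; exact: measurable_cube.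
apply/seteqP; split => [v Uv|v [p _]]; last first.
  by rewrite /F; case: asboolP => // h; exact: h.
have [e e0 eU] := nbhs_cube (open_nbhs_nbhs (conj oU Uv)).
(* Half of [e], because the rational centre may be as far from [v] as the radius of the cube. *)
have [k ke] : exists k : nat, k.+1%:R^-1 < e / 2.
  have e20 : 0 < e / 2 by rewrite divr_gt0.
  exists (Num.truncn (e / 2)^-1).
  rewrite -[ltRHS]invrK ltf_pV2 ?posrE ?invr_gt0//.
  exact: truncnS_gt.
have /choice[q Hq] : forall i, exists q : rat, `|v 0 i - ratr q| < k.+1%:R^-1.
  move=> i; have : v 0 i - k.+1%:R^-1 < v 0 i by rewrite ltrBlDr ltrDl invr_gt0.
  move=> /rat_in_itvoo[q]; rewrite in_itv/= => /andP[q1 q2]; exists q.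
  by rewrite gtr0_norm ?subr_gt0// ltrBlDr -ltrBlDl.
exists (\row_i q i, k) => //; rewrite /F /=.
have h : cube (map_mx ratr (\row_i q i)) k.+1%:R^-1 `<=` U.
  move=> w /cubeP w1; apply: eU; apply/cubeP => i.
  have := w1 i; have := Hq i; rewrite !mxE => h1 h2.
  rewrite (_ : _ - _ = (w 0 i - ratr (q i)) - (v 0 i - ratr (q i))); last by ring.
  apply: le_lt_trans (ler_normB _ _) _; apply: lt_trans (ltrD h2 h1) _.
  by move: ke; rewrite ltr_pdivlMr// mulr_natr mulr2n.
rewrite asboolT//; apply/cubeP => i; rewrite !mxE; exact: Hq.
Qed.

Lemma closed_measurable_rV (A : set 'rV[R]_n) : closed A -> measurable A.
Proof.
move=> cA; rewrite -[A]setCK; apply: measurableC; apply: open_measurable_rV; exact: closed_openC.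
Qed.

Lemma compact_measurable_rV (A : set 'rV[R]_n) : compact A -> measurable A.
Proof.
move=> cA; apply: closed_measurable_rV; apply: compact_closed => //.
Qed.

Lemma continuous_in_measurable_rV (D : set 'rV[R]_n) (f : 'rV[R]_n -> R) :
  open D -> (forall y, D y -> {for y, continuous f}) -> measurable_fun D f.
Proof.
move=> oD cf; apply: (measurability _ (RGenOpens.measurableE R)).
move=> _ [_ [a [b ->] <-]]; apply: open_measurable_rV.
rewrite openE => y [Dy fy]; rewrite /interior.
apply: filterI; first exact: open_nbhs_nbhs.
apply: cf => //; apply: open_nbhs_nbhs; split => //; exact: interval_open.
Qed.

Lemma continuous_measurable_rV (f : 'rV[R]_n -> R) :
  continuous f -> measurable_fun setT f.
Proof.
by move=> cf; apply: continuous_in_measurable_rV => [|y _]; [exact: openT|exact: cf].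
Qed.

Lemma bounded_lebesgue_lty (A : set 'rV[R]_n) : measurable A -> bounded_set A ->
  (leb A < +oo)%E.
Proof.
move=> mA [M [_ hM]].
have M1 : M < `|M| + 1 by have := ler_norm M; lra.
have h : A `<=` cube 0 (`|M| + 2).
  move=> v /(hM _ M1) /= vM; apply/cubeP => i; rewrite mxE subr0.
  by apply: le_lt_trans (coord_le_norm v i) _; lra.
have : (leb A <= leb (cube 0 (`|M| + 2)))%E.
  by apply: le_measure; rewrite ?inE//; exact: measurable_cube.
move=> /le_lt_trans; apply; rewrite lebesgue_cube ?ltry//.
Qed.

Lemma compact_lebesgue_lty (A : set 'rV[R]_n) : compact A -> (leb A < +oo)%E.
Proof.
move=> cA; apply: bounded_lebesgue_lty; first exact: compact_measurable_rV.
exact: compact_bounded.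
Qed.

Lemma open_lebesgue_gt0 (U : set 'rV[R]_n) : open U -> U !=set0 -> (0 < leb U)%E.
Proof.
move=> oU [v Uv]; have [e e0 eU] := nbhs_cube (open_nbhs_nbhs (conj oU Uv)).
have : (leb (cube v e) <= leb U)%E.
  by apply: le_measure; rewrite ?inE//; [exact: measurable_cube|exact: open_measurable_rV].
by apply: lt_le_trans; rewrite lebesgue_cube ?ltW// lte_fin exprn_gt0// pmulrn_lgt0.
Qed.

End measure_rV.

(** * Segments are null sets in dimension at least 2 *)

Section segment.
Variables (R : realType) (n : nat).

(** [N + 2] cubes of half-side [C / (N + 1)] cover the segment. Their total volume is of order
    [N ^ (- n - 1)], since the dimension is [n + 2], and tends to 0. *)
Lemma lebesgue_segment0 (a b : 'rV[R]_n.+2) (A : set 'rV[R]_n.+2) :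
  measurable A -> (forall v, A v -> exists2 s, 0 <= s <= 1 & v = a + s *: b) ->
  lebesgue_rV R n.+2 A = 0%E.
Proof.
move=> mA hA; pose C := `|b| + 1.
have C0 : 0 < C by rewrite ltr_wpDl.
have key (N : nat) : (lebesgue_rV R n.+2 A <= (2 * (C *+ 2) ^+ n.+2 / N.+1%:R)%:E)%E.
  pose B (i : nat) := cube (a + (i%:R / N.+1%:R) *: b) (C / N.+1%:R).
  (* The index of the cube is the integer part of [s * (N + 1)], which reaches [N + 1] at [s = 1]:
     hence [N + 2] cubes. The [+ 1] in [C] makes the containment strict. *)
  have AB : A `<=` \big[setU/set0]_(i < N.+2) B i.
    move=> v /hA[s /andP[s0 s1] ->]; rewrite -bigcup_mkord.
    exists (Num.truncn (s * N.+1%:R)) => /=.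
      rewrite ltnS -(@ler_nat R); apply: le_trans (_ : s * N.+1%:R <= _).
        by rewrite truncn_le// mulr_ge0.
      by rewrite ler_piMl.
    apply/cubeP => i; rewrite !mxE /=.
    rewrite (_ : _ - _ = (s - (Num.truncn (s * N.+1%:R))%:R / N.+1%:R) * b 0 i); last by ring.
    rewrite normrM mulrC /C mulrDl ltr_pwDr ?mul1r ?invr_gt0//.
    apply: ler_pM => //; first exact: coord_le_norm.
    have N0 : 0 < N.+1%:R :> R by [].
    have sN0 : 0 <= s * N.+1%:R by rewrite mulr_ge0.
    rewrite -(ler_pM2r N0) mulVf ?gt_eqF// -[X in _ * X <= _](gtr0_norm N0) -normrM.
    rewrite mulrBl divfK ?gt_eqF//.
    have := truncn_le (s * N.+1%:R); rewrite sN0.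
    have := truncnS_gt (s * N.+1%:R); rewrite -natr1 => h1 h2.
    by rewrite ler_norml; apply/andP; split; lra.
  have mB i : measurable (B i) by exact: measurable_cube.
  have hh : (lebesgue_rV R n.+2 A <= \sum_(i < N.+2) lebesgue_rV R n.+2 (B i))%E.
    by apply: content_subadditive.
  apply: le_trans hh _.
  have CN : 0 <= C / N.+1%:R by rewrite divr_ge0// ltW.
  rewrite (eq_bigr (fun=> ((C / N.+1%:R *+ 2) ^+ n.+2)%:E)); last first.
    by move=> i _; rewrite lebesgue_cube.
  rewrite sumEFin lee_fin sumr_const card_ord -mulrnAl exprMn.
  have N0 : 0 < N.+1%:R :> R by [].
  rewrite -mulrnAr (mulrC 2) -[leRHS]mulrA ler_wpM2l ?exprn_ge0 ?mulrn_wge0 ?(ltW C0)//.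
  have h1 : N.+1%:R^-1 ^+ n <= 1 :> R.
    by rewrite exprn_ile1// ?invr_ge0// invf_le1// ler1n.
  have qb : N.+1%:R^-1 * N.+1%:R = 1 :> R by rewrite mulVf ?gt_eqF.
  rewrite 2!exprS -(mulr_natr _ N.+2) ler_pdivlMr//; move: h1 qb.
  set q := N.+1%:R^-1; set b1 := N.+1%:R; set b2 := N.+2%:R => h1 qb.
  rewrite (_ : _ * b2 * b1 = q ^+ n * (q * b2) * (q * b1)); last by ring.
  rewrite qb mulr1.
  rewrite -[leRHS]mul1r; apply: ler_pM => //; rewrite ?exprn_ge0 ?invr_ge0 ?mulr_ge0//.
    by rewrite /q invr_ge0.
  rewrite /q /b2 ler_pdivrMl// -natrM ler_nat.
  by rewrite muln2 -addnn addSn addnS !ltnS leq_addl.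
apply/eqP; rewrite eq_le measure_ge0 andbT; apply/lee_addgt0Pr => e e0.
rewrite add0e; set D := 2 * (C *+ 2) ^+ n.+2 in key.
have D0 : 0 < D by rewrite mulr_gt0// exprn_gt0// pmulrn_lgt0.
apply: le_trans (key (Num.truncn (D / e))) _; rewrite lee_fin ler_pdivrMr//.
by rewrite mulrC -ler_pdivrMr// ltW// truncnS_gt.
Qed.

End segment.

Section mono.
Context d (T : measurableType d) (R : realType) (mu : {measure set T -> \bar R}).

(** The integral is a supremum over simple functions below the integrand, and those below [f] are
    below [g]. This form applies to [cabs] and [gabs], whose measurability is never established. *)
Lemma ge0_integral_mono (D : set T) (f g : T -> \bar R) :
  (forall x, D x -> (0 <= f x)%E) -> (forall x, D x -> (f x <= g x)%E) ->
  (\int[mu]_(x in D) f x <= \int[mu]_(x in D) g x)%E.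
Proof.
move=> f0 fg; have g0 x : D x -> (0 <= g x)%E by move=> Dx; exact: le_trans (f0 _ Dx) (fg _ Dx).
rewrite !ge0_integralE//; apply: le_ereal_sup => _ [h /= hf] <-.
exists h => //= x; apply: le_trans (hf x) _.
by rewrite /patch; case: ifPn => // /set_mem; exact: fg.
Qed.

End mono.

(** * The integral of a partial derivative of a compactly supported function *)

Section compact_support.
Variables (R : realType).

(** Stated coordinate by coordinate, the condition passes to the slices of [f] along [rV_cons]. *)
Definition box_supported n (M : R) (f : 'rV[R]_n -> R) :=
  forall y : 'rV[R]_n, (exists i, M < `|y 0 i|) -> f y = 0.

Lemma box_supported_integrable n M (f : 'rV[R]_n -> R) :
  continuous f -> box_supported M f ->
  (lebesgue_rV R n).-integrable setT (EFin \o f).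
Proof.
move=> cf fM; pose K := [set v : 'rV[R]_n | forall i, `[- M, M]%classic (v ord0 i)].
have cK : compact K.
  apply: (@rV_compact _ _ (fun=> `[(- M), M]%classic)).
  by move=> _; apply: segment_compact.
have mK : measurable K by exact: compact_measurable_rV.
have E : EFin \o f = (EFin \o f) \_ K.
  apply/funext => y; rewrite /patch; case: ifPn => //= /negP nKy.
  rewrite fM//; apply: contrapT => h; apply: nKy; apply/mem_set => i.
  rewrite /= in_itv /= -ler_norml leNgt; apply/negP => hi; apply: h.
  by exists i.
rewrite E; apply/(integrable_mkcond (D := K) (EFin \o f)) => //.
apply: measurable_bounded_integrable => //.
- exact: compact_lebesgue_lty.
- by apply: measurable_funTS; exact: continuous_measurable_rV.
- have : compact (f @` K).
    by apply: continuous_compact => //; exact: continuous_subspaceT.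
  move=> /compact_bounded[M2 [M2r hM2]]; exists M2; split=> // c Mc y Ky.
  by apply: (hM2 c Mc); exists y.
Qed.

Lemma is_derive_near0 (V : normedModType R) (f : V -> R) (y v : V) (df : R) :
  (\forall x \near y, f x = 0) -> is_derive y v f df -> df = 0.
Proof.
move=> f0 [_ <-]; rewrite (@near_eq_derive _ _ _ _ (cst 0)) ?derive_cst//.
Qed.

(** A directional derivative only sees the restriction to a line; this transports it between a space
    and its slices. *)
Lemma is_derive_line (V W : normedModType R) (f : V -> R) (g : W -> R)
    (y v : V) (w u : W) (df : R) :
  (forall t : R, g (t *: u + w) = f (t *: v + y)) ->
  is_derive y v f df -> is_derive w u g df.
Proof.
move=> gf [fd <-].
have E : (fun t : R => g (t *: u + w)) = (fun t : R => f (t *: v + y)).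
  exact/funext.
apply: DeriveDef; last by rewrite !derive_line E.
apply: (iffRL (derivable1P g w u)); rewrite E.
exact: (iffLR (derivable1P f y v)).
Qed.

(** The fundamental theorem of calculus on an interval whose ends lie outside the support. *)
Lemma integral_derive_supported (f f' : R -> R) (M : R) :
  continuous f' -> (forall x : R, is_derive x (1 : R) f (f' x)) ->
  (forall x, M < `|x| -> f x = 0) ->
  (\int[lebesgue_measure]_x (f' x)%:E = 0)%E.
Proof.
move=> cf' Df fM; pose a := `|M| + 1.
have Ma : M < a by rewrite /a; have := ler_norm M; lra.
have a0 : 0 < a by rewrite ltr_wpDl.
have f'0 x : a < `|x| -> f' x = 0.
  move=> ax; apply: (is_derive_near0 _ (Df x)).
  have : \forall y \near x, a < `|y|.
    by apply: (@cvgr_norm_gt R R R (nbhs x) _ id x) => //; exact: cvg_id.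
  by apply: filterS => y ay; rewrite fM//; exact: lt_trans ay.
have E : (fun x => (f' x)%:E) = (EFin \o f') \_ `[(- a), a].
  apply/funext => x; rewrite /patch; case: ifPn => //= /negP h.
  rewrite f'0// ltNge; apply/negP => h'; apply: h; apply/mem_set.
  by rewrite /= in_itv/= -ler_norml.
rewrite E -integral_mkcond.
rewrite (@continuous_FTC2 _ f' f)//; last 3 first.
- exact: continuous_subspaceT.
- have cf x : {for x, continuous f}.
    apply/differentiable_continuous/derivable1_diffP.
    by case: (Df x).
  split=> [x _|/=|/=]; first by case: (Df x).
    by apply: cvg_at_right_filter; exact: cf.
  by apply: cvg_at_left_filter; exact: cf.
- by move=> x _; rewrite derive1E; case: (Df x).
- by rewrite !fM ?subee// ?normrN gtr0_norm.
by lra.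
Qed.

Lemma rV_cons_line0 n (a t : R) (v : 'rV[R]_n) :
  rV_cons (t *: (1 : R) + a, v) = t *: delta_mx 0 ord0 + rV_cons (a, v).
Proof.
apply/rowP => i; rewrite !mxE.
by case: (unliftP ord0 i) => [j|] -> /=; rewrite ?eqxx /= ?mulr0 ?add0r.
Qed.

Lemma rV_cons_lineS n (a t : R) (v : 'rV[R]_n) j :
  rV_cons (a, t *: delta_mx 0 j + v) =
  t *: delta_mx 0 (lift ord0 j) + rV_cons (a, v).
Proof.
apply/rowP => i; rewrite !mxE.
case: (unliftP ord0 i) => [j'|] -> /=; rewrite ?mxE ?eqxx /=.
  by rewrite (inj_eq lift_inj).
by rewrite mulr0 add0r.
Qed.

Lemma continuous_rV_cons n (f : 'rV[R]_n.+1 -> R) : continuous f ->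
  (forall a, continuous (fun v : 'rV[R]_n => f (rV_cons (a, v)))) /\
  (forall v, continuous (fun a : R => f (rV_cons (a, v)))).
Proof.
move=> cf; split=> [a v A /(cf _)/nbhs_cube[e e0 eA]|v a A /(cf _)/nbhs_cube[e e0 eA]].
  apply/nbhs_ballP; exists e => // w; rewrite -ball_normE /ball_/= => vw.
  apply: eA; apply/cubeP => i; rewrite !mxE.
  case: (unliftP ord0 i) => [j _|_] /=; rewrite ?subrr ?normr0//.
  apply: le_lt_trans vw.
  by have := coord_le_norm (v - w) j; rewrite !mxE distrC.
apply/nbhs_ballP; exists e => // b; rewrite /ball/= => ab.
apply: eA; apply/cubeP => i; rewrite !mxE.
by case: (unliftP ord0 i) => [j _|_] /=; rewrite ?subrr ?normr0// distrC.
Qed.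

(** Fubini, in the order that puts the differentiated variable inside: the first coordinate is
    treated by the fundamental theorem of calculus, the others by induction on the dimension. *)
Lemma integral_partial_supported n (f f' : 'rV[R]_n -> R) M j :
  continuous f' -> (forall y, is_derive y (delta_mx 0 j) f (f' y)) ->
  box_supported M f ->
  (\int[lebesgue_rV R n]_y (f' y)%:E = 0)%E.
Proof.
elim: n f f' j => [|n IH] f f' j; first by case: j.
move=> cf' Df fM.
(* Beyond [M + 1] the function [f] vanishes on the whole unit ball around the point, hence so does
   its derivative at the point. *)
have f'M : box_supported (M + 1) f'.
  move=> y [i hi]; apply: (is_derive_near0 _ (Df y)).
  apply/nbhs_ballP; exists 1 => //= w; rewrite -ball_normE /ball_/= => yw.
  apply: fM; exists i.
  have := coord_le_norm (y - w) i; rewrite !mxE => h.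
  have := lerB_dist (y 0 i) (w 0 i); lra.
have intf' := box_supported_integrable cf' f'M.
have mf' := measurable_int _ intf'.
have mc := @measurable_rV_cons R n.
have mfc : measurable_fun setT
    (fun p : measurableTypeR R * 'rV[R]_n => (f' (rV_cons p))%:E).
  apply/measurable_EFinP; apply: (measurableT_comp _ mc).
  exact: continuous_measurable_rV.
have intc : (lebesgue_measure \x lebesgue_rV R n)%E.-integrable setT
    (fun p : measurableTypeR R * 'rV[R]_n => (f' (rV_cons p))%:E).
  apply/integrableP; split => //.
  have /integrableP[_] := intf'; apply: le_lt_trans.
  rewrite /= /lebesgue_rV_step.
  rewrite (ge0_integral_pushforward mc)//; last first.
    by apply: (@measurableT_comp _ _ _ _ _ _ abse _ (EFin \o f')).
rewrite /= /lebesgue_rV_step (integral_pushforward mc)//.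
rewrite preimage_setT.
have [c1 c2] := continuous_rV_cons cf'.
case: (unliftP ord0 j) => [j'|] jE; subst j.
- rewrite -integral12_prod_meas1//.
  apply: integral0_eq => a _.
  apply: (IH (fun v => f (rV_cons (a, v))) (fun v => f' (rV_cons (a, v))) j').
  + exact: c1.
  + move=> v; apply: is_derive_line (Df (rV_cons (a, v))) => t.
    by rewrite rV_cons_lineS.
  + move=> v [i hi]; apply: fM; exists (lift ord0 i).
    by rewrite mxE liftK.
- rewrite -integral21_prod_meas1//.
  apply: integral0_eq => v _.
  apply: (@integral_derive_supported (fun a => f (rV_cons (a, v)))
    (fun a => f' (rV_cons (a, v))) M).
  + exact: c2.
  + move=> a; apply: is_derive_line (Df (rV_cons (a, v))) => t.
    by rewrite rV_cons_line0.
  + move=> a ha; apply: fM; exists ord0.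
    by rewrite mxE unlift_none.
Qed.

End compact_support.

(** * Radial solutions of the Helmholtz equation *)

Section entire.
Variable R : realType.
Implicit Types (c d : R^nat) (s : R).

(** Domination by the coefficients of [M exp] gives convergence everywhere, and termwise
    differentiation preserves it with the same [M]. *)
Definition entire_coeff c := exists M, forall i, `|c i| <= M / i`!%:R.

Definition psum c s : R := limn (pseries c s).

Lemma entire_cvg c s : entire_coeff c -> cvgn (pseries c s).
Proof.
move=> [M cM]; apply: normed_cvg.
apply: (@series_le_cvg _ _ (fun i => M * exp_coeff `|s| i)).
- by move=> i /=.
- move=> i; apply: mulr_ge0; last by rewrite exp_coeff_ge0.
  by have := cM 0%N; rewrite divr1; exact: le_trans.
- move=> i /=; rewrite normrM normrX /exp_coeff /=.
  by rewrite mulrA mulrAC ler_wpM2r ?exprn_ge0//; have := cM i; rewrite mulrC mulrA.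
- by apply: is_cvg_seriesZ; exact: is_cvg_series_exp_coeff.
Qed.

Lemma entire_diffs c : entire_coeff c -> entire_coeff (pseries_diffs c).
Proof.
move=> [M cM]; exists M => i; rewrite /pseries_diffs normrM ger0_norm//.
have := cM i.+1; rewrite factS natrM invfM.
rewrite -(ler_pM2l (_ : 0 < i.+1%:R))// => /le_trans; apply.
by rewrite mulrCA mulVKf.
Qed.

Lemma is_derive_psum c s : entire_coeff c ->
  is_derive s 1 (psum c) (psum (pseries_diffs c) s).
Proof.
move=> ec; have ed := entire_diffs ec; have edd := entire_diffs ed.
apply: (@pseries_snd_diffs _ c (`|s| + 1)); [exact: entire_cvg..|].
by rewrite [ltRHS]ger0_norm ?addr_ge0// ltrDl.
Qed.

Lemma psum0 c : psum c 0 = c 0%N.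
Proof.
apply: lim_near_cst => //; near=> n.
rewrite /pseries /series /= -[n]prednK; last by near: n; exact: nbhs_infty_gt.
rewrite big_nat_recl// expr0 mulr1 big1 ?addr0// => i _.
by rewrite exprS mul0r mulr0.
Unshelve. all: by end_near. Qed.

(* The operator [s d^2 + d + 1] acts on the coefficients of a power series as
   [c_i |-> (i + 1)^2 c_(i+1) + c_i]. *)
Lemma psum_bessel c d s : entire_coeff c -> entire_coeff d ->
  (forall i, i.+1%:R ^+ 2 * c i.+1 + c i = d i) ->
  s * psum (pseries_diffs (pseries_diffs c)) s + psum (pseries_diffs c) s
    + psum c s = psum d s.
Proof.
move=> ec ed cd; have e1 := entire_diffs ec; have e2 := entire_diffs e1.
pose D := pseries_diffs c.
have h2 : series (fun i => i%:R * D i * s ^+ i) @ \oo -->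
    s * psum (pseries_diffs D) s.
  have := @pseries_diffs_equiv _ D s (entire_cvg (s := s) e2).
  move=> h; have {}h := cvgM (cvg_cst s) h.
  rewrite (_ : series _ = (fun n => s * series (fun i => i%:R * D i * s ^+ i.-1) n)).
    exact: h.
  apply/funext => n; rewrite /series /= mulr_sumr; apply: eq_bigr => i _.
  by case: i => [|i]; rewrite ?mul0r ?mulr0//= exprS; ring.
have h1 : series (fun i => D i * s ^+ i) @ \oo --> psum D s by exact: entire_cvg.
have h0 : series (fun i => c i * s ^+ i) @ \oo --> psum c s by exact: entire_cvg.
apply: esym; rewrite [LHS]/psum; apply: cvg_lim => //.
(* As [D i = (i + 1) * c (i + 1)], the sum [i * D i + D i] is the term [(i + 1) ^ 2 * c (i + 1)] of
   the hypothesis. *)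
rewrite (_ : pseries d s = series (fun i => i%:R * D i * s ^+ i) +
  series (fun i => D i * s ^+ i) + series (fun i => c i * s ^+ i)).
  exact: cvgD (cvgD h2 h1) h0.
apply/funext => n; rewrite /pseries /series /= !fctE -!big_split/=.
by apply: eq_bigr => i _; rewrite -cd /D /pseries_diffs; ring.
Qed.

End entire.

Section lambda_derive.
Variables (R : realType) (V : normedModType R).
Implicit Types (f g : V -> R) (x v : V).

Lemma is_derive_funD f g x v df dg : is_derive x v f df -> is_derive x v g dg ->
  is_derive x v (fun y => f y + g y) (df + dg).
Proof. exact: is_deriveD. Qed.

Lemma is_derive_funN f x v df : is_derive x v f df ->
  is_derive x v (fun y => - f y) (- df).
Proof. exact: is_deriveN. Qed.

Lemma is_derive_funB f g x v df dg : is_derive x v f df -> is_derive x v g dg ->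
  is_derive x v (fun y => f y - g y) (df - dg).
Proof. exact: is_deriveB. Qed.

Lemma is_derive_funM f g x v df dg : is_derive x v f df -> is_derive x v g dg ->
  is_derive x v (fun y => f y * g y) (f x * dg + g x * df).
Proof. exact: is_deriveM. Qed.

Lemma is_derive_funV f x v df : f x != 0 -> is_derive x v f df ->
  is_derive x v (fun y => (f y)^-1) (- ((f x) ^- 2 * df)).
Proof.
move=> f0 [fd fE]; apply: DeriveDef; first exact: derivableV.
by rewrite deriveV// fE /GRing.scale /= mulNr.
Qed.

Lemma is_derive_funC c x v : is_derive x v (fun=> c : R) 0.
Proof. exact: is_derive_cst. Qed.

End lambda_derive.

Section radial.
Variable R : realType.

(** For [u y = F (|y| ^ 2)] the Laplacian is [4 q F'' + 2 m F'] at [q = |y| ^ 2], so the third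
    clause is the Helmholtz equation off 0. The variable [q] is preferred to [|y|] because it is a
    polynomial in [y]. The last clause is all that is kept of the singularity. *)
Definition radial_solution (m : nat) (k : R) (F F1 F2 : R -> R) :=
  [/\ forall q : R, 0 < q -> is_derive q (1 : R) F (F1 q),
      forall q : R, 0 < q -> is_derive q (1 : R) F1 (F2 q),
      forall q, 0 < q -> 4 * q * F2 q + 2 * m%:R * F1 q + k ^+ 2 * F q = 0 &
      forall C, exists2 q0, 0 < q0 & forall q, 0 < q < q0 -> C * `|F q| < - F1 q].

(** With [y = sqrt x], [x |ln x| = 2 y ^ 2 ln (1 / y) < 2 y], by [ln t < t]. *)
Lemma mulr_ln_near0 (e : R) : 0 < e ->
  exists2 d, 0 < d & forall x, 0 < x < d -> x * `|ln x| < e.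
Proof.
move=> e0; exists (Num.min 1 ((e / 2) ^+ 2)).
  by rewrite lt_min ltr01 exprn_gt0// divr_gt0.
move=> x; rewrite lt_min => /and3P[x0 x1 xe].
pose y := Num.sqrt x; have y0 : 0 < y by rewrite sqrtr_gt0.
have xE : x = y ^+ 2 by rewrite sqr_sqrtr// ltW.
have ye : y < e / 2 by rewrite -(@ltr_pXn2r _ 2)// ?nnegrE ?ltW ?divr_gt0// -xE.
rewrite ler0_norm ?ln_le0 ?ltW// xE lnXn// -mulNrn -lnV ?posrE//.
have := ln_sublinear (_ : 0 < y^-1); rewrite invr_gt0 => /(_ y0) h.
have : y ^+ 2 * (ln y^-1 *+ 2) < y ^+ 2 * (y^-1 *+ 2).
  by rewrite ltr_pM2l ?exprn_gt0// ltrMn2r.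
move=> /lt_trans; apply.
rewrite (_ : _ * _ = y * 2); first by rewrite -ltr_pdivlMr.
by rewrite -mulr_natr; field; rewrite gt_eqF.
Qed.

(** The function is the real part of [exp (i k r) / (4 pi r)] for [r = sqrt q]; its derivatives come
    from [dr / dq = 1 / (2 r)]. *)
Lemma radial_solution3 (k : R) : 0 <= k ->
  let rho : R -> R := @Num.sqrt R in
  radial_solution 3 k (fun q => cos (k * rho q) / (4 * pi * rho q))
    (fun q => - (k * rho q * sin (k * rho q) + cos (k * rho q)) /
              (8 * pi * rho q ^+ 3))
    (fun q => (3 * k * rho q * sin (k * rho q) + 3 * cos (k * rho q)
               - k ^+ 2 * rho q ^+ 2 * cos (k * rho q)) / (16 * pi * rho q ^+ 5)).
Proof.
move=> k0 rho; have := pi_gt0 R; move: (@pi R) => p p0.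
have pi0 : p != 0 by rewrite gt_eqF.
have drho (q : R) : 0 < q -> is_derive q (1 : R) rho (2 * rho q)^-1.
  exact: is_derive1_sqrt.
have dk (q : R) : 0 < q -> is_derive q (1 : R) (fun q : R => k * rho q) (k * (2 * rho q)^-1).
  move=> q0; apply: is_derive_eq (is_derive_funM (is_derive_funC k q 1) (drho q q0)) _.
  by rewrite mulr0 addr0.
have dc (q : R) : 0 < q -> is_derive q (1 : R) (fun q : R => cos (k * rho q))
    (- sin (k * rho q) * (k * (2 * rho q)^-1)).
  by move=> q0; apply: (@is_derive_comp1 _ _ (fun q => k * rho q) (@cos R)); exact: dk.
have ds (q : R) : 0 < q -> is_derive q (1 : R) (fun q : R => sin (k * rho q))
    (cos (k * rho q) * (k * (2 * rho q)^-1)).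
  by move=> q0; apply: (@is_derive_comp1 _ _ (fun q => k * rho q) (@sin R)); exact: dk.
have rn0 (q : R) : 0 < q -> rho q != 0 by move=> q0; rewrite gt_eqF// sqrtr_gt0.
split.
- move=> q q0.
  have dd : is_derive q (1 : R) (fun q : R => 4 * p * rho q) (4 * p * (2 * rho q)^-1 + rho q * 0).
    exact: is_derive_funM (is_derive_funC _ q 1) (drho q q0).
  have := is_derive_funM (dc q q0) (is_derive_funV _ dd).
  rewrite !mulf_neq0 ?pi0 ?rn0// => /(_ isT) h; apply: is_derive_eq h _.
  by field; rewrite pi0 rn0.
- move=> q q0.
  have d3 : is_derive q (1 : R) (fun q : R => rho q ^+ 3) (3 * rho q ^+ 2 * (2 * rho q)^-1).
    rewrite (_ : (fun _ => _) = fun q => rho q * (rho q * rho q)); last first.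
      by apply/funext => s; rewrite !exprS expr0 mulr1.
    have := is_derive_funM (drho q q0) (is_derive_funM (drho q q0) (drho q q0)).
    by move=> h; apply: is_derive_eq h _; ring.
  have dd := is_derive_funM (is_derive_funC (8 * p) q 1) d3.
  have dn := is_derive_funN (is_derive_funD
    (is_derive_funM (dk q q0) (ds q q0)) (dc q q0)).
  have := is_derive_funM dn (is_derive_funV _ dd).
  rewrite !mulf_neq0 ?expf_neq0 ?pi0 ?rn0// => /(_ isT) h; apply: is_derive_eq h _.
  by field; rewrite pi0 rn0.
- move=> q q0; rewrite -[q in 4 * q](sqr_sqrtr (ltW q0)) -/(rho q).
  by field; rewrite pi0 rn0.
- move=> C.
  (* Multiplied by [8 pi r ^ 3], the required inequality follows from [D r > 0], which holds near 0
     because [D 0 = 1]. *)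
  pose D r : R := k * r * sin (k * r) + cos (k * r) - 2 * `|C| * r ^+ 2.
  have cD : continuous D.
    move=> r; apply: cvgB; [apply: cvgD|].
    + apply: cvgM; first exact: cvgM (cvg_cst _) cvg_id.
      apply: continuous_comp; last exact: continuous_sin.
      exact: cvgM (cvg_cst _) cvg_id.
    + apply: continuous_comp; last exact: continuous_cos.
      exact: cvgM (cvg_cst _) cvg_id.
    + by apply: cvgM (cvg_cst _) _; exact: exprn_continuous.
  have D0 : 0 < D 0.
    by rewrite /D !mulr0 mul0r cos0 add0r expr0n mulr0 subr0.
  have /nbhs_ballP[e /= e0 eD] : \forall r \near 0, 0 < D r.
    exact: (cvgr_gt _ (cD 0) _ D0).
  exists (e ^+ 2); first by rewrite exprn_gt0.
  move=> q /andP[q0 qe].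
  have r0 : 0 < rho q by rewrite sqrtr_gt0.
  have : 0 < D (rho q).
    apply: eD; rewrite /ball/= sub0r normrN gtr0_norm//.
    by rewrite -(@ltr_pXn2r _ 2)// ?nnegrE ?ltW// sqr_sqrtr// ltW.
  rewrite /D subr_gt0 => h.
  rewrite mulNr opprK normrM normfV [`|_ * rho q|]gtr0_norm ?mulr_gt0//.
  rewrite ltr_pdivlMr ?mulr_gt0 ?exprn_gt0//.
  apply: le_lt_trans h.
  have : `|cos (k * rho q)| <= 1 by rewrite ler_norml cos_geN1 cos_le1.
  move: (`|cos (k * rho q)|) (normr_ge0 (cos (k * rho q))) => c c0 c1.
  rewrite [leLHS](_ : _ = 2 * (C * c) * rho q ^+ 2); last first.
    by field; rewrite pi0 rn0.
  rewrite ler_wpM2r ?sqr_ge0// ler_wpM2l//.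
  apply: le_trans (_ : `|C| * c <= _); first by rewrite ler_wpM2r// ler_norm.
  by rewrite ler_piMr.
Qed.

(** Here [- ln q / (4 pi)] is [log (1 / |y|) / (2 pi)], and the last clause amounts to
    [C q |ln q| < 1]. *)
Lemma radial_solution2_0 :
  radial_solution 2 0 (fun q => - ln q / (4 * pi)) (fun q => - (4 * pi * q)^-1)
    (fun q => (4 * pi * q ^+ 2)^-1).
Proof.
have := pi_gt0 R; move: (@pi R) => p p0.
have pi0 : p != 0 by rewrite gt_eqF.
split.
- move=> q q0.
  have := is_derive_funM (is_derive_funN (is_derive1_ln q0)) (is_derive_funC (4 * p)^-1 q 1).
  by move=> h; apply: is_derive_eq h _; field; rewrite pi0 gt_eqF.
- move=> q q0.
  have nz : 4 * p * q != 0 by rewrite !mulf_neq0// gt_eqF.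
  have := is_derive_funN (is_derive_funV nz
    (is_derive_funM (is_derive_funC (4 * p) q 1) (is_derive_id q 1))).
  by move=> h; apply: is_derive_eq h _; field; rewrite pi0 gt_eqF.
- by move=> q q0; field; rewrite pi0 gt_eqF.
- move=> C.
  have C0 : 0 < `|C| + 1 by rewrite ltr_wpDl.
  have Ci : 0 < (`|C| + 1)^-1 by rewrite invr_gt0.
  have [d d0 hd] := mulr_ln_near0 Ci; exists d => // q qd.
  have /andP[q0 _] := qd; have := hd _ qd.
  rewrite opprK mulNr normrN normrM [`|(4 * p)^-1|]gtr0_norm ?invr_gt0 ?mulr_gt0//.
  rewrite -[ltRHS]mul1r ltr_pdivlMr// => h.
  rewrite -[ltRHS]mul1r ltr_pdivlMr ?mulr_gt0//.
  apply: le_lt_trans h.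
  move: (`|ln q|) (normr_ge0 (ln q)) => c c0.
  rewrite [leLHS](_ : _ = q * c * C); last by field; rewrite pi0.
  apply: ler_wpM2l; first by rewrite mulr_ge0// ltW.
  by have := ler_norm C; lra.
Qed.

(** * The function [Y_0] in the variable [s = (t / 2) ^ 2] *)

Section bessel.
Variables (g : R).

Definition J0_coeff (i : nat) : R := (-1) ^+ i / i`!%:R ^+ 2.
Definition S0_coeff (i : nat) : R := (-1) ^+ i * series harmonic i / i`!%:R ^+ 2.

Lemma entire_J0 : entire_coeff J0_coeff.
Proof.
exists 1 => i; rewrite normrM normrX normrN1 expr1n !mul1r.
rewrite ger0_norm ?invr_ge0 ?exprn_ge0// lef_pV2 ?posrE ?exprn_gt0 ?ltr0n ?fact_gt0//.
by rewrite expr2 ler_peMr ?ler0n// ler1n fact_gt0.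
Qed.

Lemma entire_S0 : entire_coeff S0_coeff.
Proof.
exists 1 => i; rewrite /S0_coeff !normrM normrX normrN1 expr1n !mul1r.
have f0 : 0 < i`!%:R :> R by rewrite ltr0n fact_gt0.
rewrite [`|_^-1|]ger0_norm ?invr_ge0 ?exprn_ge0 ?(ltW f0)// ler_pdivrMr ?exprn_gt0//.
rewrite expr2 mulKf ?gt_eqF// ger0_norm; last first.
  by apply: sumr_ge0 => j _; exact: harmonic_ge0.
apply: (@le_trans _ _ i%:R); last first.
  by rewrite ler_nat; case: (i) => // j; rewrite factS leq_pmulr// fact_gt0.
rewrite /series /= -[leRHS]mul1r mulr_natr -[in leRHS](subn0 i) -sumr_const_nat.
by apply: ler_sum => j _; rewrite /harmonic /= invf_le1 ?ler1n.
Qed.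

Let A := psum J0_coeff.
Let A1 := psum (pseries_diffs J0_coeff).
Let A2 := psum (pseries_diffs (pseries_diffs J0_coeff)).
Let B := psum S0_coeff.
Let B1 := psum (pseries_diffs S0_coeff).
Let B2 := psum (pseries_diffs (pseries_diffs S0_coeff)).

Let A_ode s : s * A2 s + A1 s + A s = 0.
Proof.
rewrite (@psum_bessel _ _ (fun=> 0)).
- rewrite /psum (_ : pseries _ _ = fun=> 0); first exact: lim_cst.
  by apply/funext => n; rewrite /pseries /series /= big1// => i _; rewrite mul0r.
- exact: entire_J0.
- by exists 0 => i; rewrite /= normr0 mul0r.
- move=> i; rewrite /J0_coeff factS natrM [(-1) ^+ _]exprS.
  have : i`!%:R != 0 :> R by rewrite pnatr_eq0 -lt0n fact_gt0.
  have : i.+1%:R != 0 :> R by rewrite pnatr_eq0.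
  move: ((-1) ^+ i) (i`!%:R) (i.+1%:R) => e f j j0 f0.
  by field; rewrite j0 f0.
Qed.

(** The step of the harmonic numbers, [1 / (i + 1)], leaves the source term [A1]. The derivatives of
    the logarithm in [G] leave the same term, and the two cancel in [G_ode]. *)
Let B_ode s : s * B2 s + B1 s + B s = A1 s.
Proof.
apply: psum_bessel; first exact: entire_S0.
  exact/entire_diffs/entire_J0.
move=> i; rewrite /S0_coeff /pseries_diffs /J0_coeff factS natrM [(-1) ^+ _]exprS.
rewrite /series /= big_nat_recr//= /harmonic /=.
have : i`!%:R != 0 :> R by rewrite pnatr_eq0 -lt0n fact_gt0.
have : i.+1%:R != 0 :> R by rewrite pnatr_eq0.
move: (\sum_(0 <= _ < i) _) ((-1) ^+ i) (i`!%:R) (i.+1%:R) => h e f j j0 f0.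
by field; rewrite j0 f0.
Qed.

Let dA (s : R) : is_derive s (1 : R) A (A1 s).
Proof. exact/is_derive_psum/entire_J0. Qed.
Let dA1 (s : R) : is_derive s (1 : R) A1 (A2 s).
Proof. exact/is_derive_psum/entire_diffs/entire_J0. Qed.
Let dB (s : R) : is_derive s (1 : R) B (B1 s).
Proof. exact/is_derive_psum/entire_S0. Qed.
Let dB1 (s : R) : is_derive s (1 : R) B1 (B2 s).
Proof. exact/is_derive_psum/entire_diffs/entire_S0. Qed.

(** Up to the factor [2 / pi] this is [Y_0], as [ln (t / 2) = ln s / 2]. Euler's constant can stay a
    parameter [g], since adding a multiple of [A] preserves the equation. *)
Let G s := (ln s / 2 + g) * A s - B s.
Let G1 s := A s / (2 * s) + (ln s / 2 + g) * A1 s - B1 s.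
Let G2 s := A1 s / s - A s / (2 * s ^+ 2) + (ln s / 2 + g) * A2 s - B2 s.

Let dG (s : R) : 0 < s -> is_derive s (1 : R) G (G1 s).
Proof.
move=> s0.
have := is_derive_funB (is_derive_funM (is_derive_funD (is_derive_funM
  (is_derive1_ln s0) (is_derive_funC 2^-1 s 1)) (is_derive_funC g s 1)) (dA s)) (dB s).
by move=> h; apply: is_derive_eq h _; rewrite /G1; field; rewrite gt_eqF.
Qed.

Let dG1 (s : R) : 0 < s -> is_derive s (1 : R) G1 (G2 s).
Proof.
move=> s0; have nz : 2 * s != 0 by rewrite mulf_neq0// gt_eqF.
have h1 := is_derive_funM (dA s) (is_derive_funV nz
  (is_derive_funM (is_derive_funC 2 s 1) (is_derive_id s 1))).
have h2 := is_derive_funM (is_derive_funD (is_derive_funM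
  (is_derive1_ln s0) (is_derive_funC 2^-1 s 1)) (is_derive_funC g s 1)) (dA1 s).
have := is_derive_funB (is_derive_funD h1 h2) (dB1 s).
by move=> h; apply: is_derive_eq h _; rewrite /G2; field; rewrite gt_eqF.
Qed.

Let G_ode s : 0 < s -> s * G2 s + G1 s + G s = 0.
Proof.
move=> s0; have -> : s * G2 s + G1 s + G s = A1 s +
    (ln s / 2 + g) * (s * A2 s + A1 s + A s) - (s * B2 s + B1 s + B s).
  by rewrite /G /G1 /G2; field; rewrite gt_eqF.
by rewrite A_ode B_ode mulr0 addr0 subrr.
Qed.

Let psum_continuous (f f1 : R -> R) (s : R) : is_derive s (1 : R) f (f1 s) ->
  f x @[x --> s] --> f s.
Proof. by move=> [d _]; apply/differentiable_continuous/derivable1_diffP. Qed.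

(** Both sides are multiplied by [s]: then [s * G1 s] tends to [A 0 / 2 = 1 / 2], while [s * G s]
    tends to 0, because [s ln s] does. *)
Let G_dominated (kappa C : R) : 0 < kappa ->
  exists2 d, 0 < d & forall s, 0 < s < d -> C * `|G s| < kappa * G1 s.
Proof.
move=> kappa0.
have L0 : s * ln s @[s --> 0^'+] --> (0 : R).
  apply/cvgr0Pnorm_lt => e e0; have [d d0 hd] := mulr_ln_near0 e0.
  near=> s; have s0 : 0 < s by [].
  rewrite normrM gtr0_norm//; apply: hd; rewrite s0 /=.
  by near: s; apply: nbhs_right_lt.
have cid : s @[s --> 0^'+] --> (0 : R) by apply: cvg_at_right_filter; exact: cvg_id.
have cA : A s @[s --> 0^'+] --> (1 : R).
  have <- : A 0 = 1 by rewrite /A psum0 /J0_coeff fact0 expr0 expr1n divr1.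
  by apply: cvg_at_right_filter; exact: psum_continuous (dA _).
have cA1 : A1 s @[s --> 0^'+] --> A1 0.
  by apply: cvg_at_right_filter; exact: psum_continuous (dA1 _).
have cB : B s @[s --> 0^'+] --> B 0.
  by apply: cvg_at_right_filter; exact: psum_continuous (dB _).
have cB1 : B1 s @[s --> 0^'+] --> B1 0.
  by apply: cvg_at_right_filter; exact: psum_continuous (dB1 _).
have cM : s * ln s / 2 + g * s @[s --> 0^'+] --> 0 / 2 + g * 0.
  by apply: cvgD; apply: cvgM => //; exact: cvg_cst.
rewrite mul0r mulr0 addr0 in cM.
pose P s := A s / 2 + (s * ln s / 2 + g * s) * A1 s - s * B1 s.
pose Q s := (s * ln s / 2 + g * s) * A s - s * B s.
have cP : P s @[s --> 0^'+] --> 1 / 2 + 0 * A1 0 - 0 * B1 0.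
  by apply: cvgB; [apply: cvgD|]; apply: cvgM => //; exact: cvg_cst.
have cQ : Q s @[s --> 0^'+] --> 0 * 1 - 0 * B 0.
  by apply: cvgB; apply: cvgM.
have cPQ : kappa * P s - C * `|Q s| @[s --> 0^'+] -->
    kappa * (1 / 2 + 0 * A1 0 - 0 * B1 0) - C * `|0 * 1 - 0 * B 0|.
  apply: cvgB; apply: cvgM; [exact: cvg_cst|exact: cP|exact: cvg_cst|].
  exact: cvg_norm.
have /nbhs_ballP[d /= d0 hd] : \forall s \near 0^'+, 0 < kappa * P s - C * `|Q s|.
  apply: (cvgr_gt _ cPQ); rewrite !mul0r subrr normr0 mulr0 !subr0 addr0.
  by rewrite mulr_gt0.
exists d => // s /andP[s0 sd].
have := hd s; rewrite /ball/= sub0r normrN gtr0_norm// => /(_ sd s0).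
have -> : P s = s * G1 s by rewrite /P /G1; field; rewrite gt_eqF.
have -> : Q s = s * G s by rewrite /Q /G; field.
rewrite normrM gtr0_norm// mulrCA (mulrCA C) -mulrBr pmulr_rgt0//.
by rewrite subr_gt0.
Unshelve. all: by end_near. Qed.

(** The argument [kappa * q] is [(k |y| / 2) ^ 2]. The factor arises from
    [Re (i / 4 * (J_0 + i Y_0)) = - Y_0 / 4], where [Y_0] is [2 / pi] times [G]. *)
Lemma radial_solution2 (k : R) : 0 < k ->
  let kappa := k ^+ 2 / 4 in
  radial_solution 2 k (fun q => - (2 * pi)^-1 * G (kappa * q))
    (fun q => - (2 * pi)^-1 * (kappa * G1 (kappa * q)))
    (fun q => - (2 * pi)^-1 * (kappa ^+ 2 * G2 (kappa * q))).
Proof.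
move=> k0 kappa; have kappa0 : 0 < kappa by rewrite divr_gt0// exprn_gt0.
have dk (q : R) : is_derive q (1 : R) (fun q => kappa * q) kappa.
  have := is_derive_funM (is_derive_funC kappa q 1) (is_derive_id q 1).
  by move=> h; apply: is_derive_eq h _; rewrite mulr1 mulr0 addr0.
have c0 : 0 < (2 * pi)^-1 :> R by rewrite invr_gt0 mulr_gt0// pi_gt0.
move: (2 * pi)^-1 c0 => c c0.
split.
- move=> q q0; have kq : 0 < kappa * q by rewrite mulr_gt0.
  have h1 : is_derive q (1 : R) (fun q => G (kappa * q)) (G1 (kappa * q) * kappa).
    exact: (@is_derive_comp1 _ _ (fun q => kappa * q) G _ _ _ _ (dk q) (dG kq)).
  have := is_derive_funM (is_derive_funC (- c) q 1) h1.
  by move=> h; apply: is_derive_eq h _; ring.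
- move=> q q0; have kq : 0 < kappa * q by rewrite mulr_gt0.
  have h1 : is_derive q (1 : R) (fun q => G1 (kappa * q)) (G2 (kappa * q) * kappa).
    exact: (@is_derive_comp1 _ _ (fun q => kappa * q) G1 _ _ _ _ (dk q) (dG1 kq)).
  have := is_derive_funM (is_derive_funC (- c) q 1)
    (is_derive_funM (is_derive_funC kappa q 1) h1).
  by move=> h; apply: is_derive_eq h _; ring.
- move=> q q0; have kq : 0 < kappa * q by rewrite mulr_gt0.
  have -> : k ^+ 2 = 4 * kappa by rewrite /kappa; field.
  rewrite [LHS](_ : _ = - c * (4 * kappa) *
    (kappa * q * G2 (kappa * q) + G1 (kappa * q) + G (kappa * q))); last by ring.
  by rewrite G_ode// mulr0.
- move=> C; have [d d0 hd] := G_dominated C kappa0.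
  exists (d / kappa); first by rewrite divr_gt0.
  move=> q /andP[q0 qd]; rewrite !mulNr opprK normrN normrM gtr0_norm//.
  rewrite mulrCA ltr_pM2l//; apply: hd.
  by rewrite mulr_gt0//= mulrC -ltr_pdivlMr.
Qed.

End bessel.

(* [s = (t / 2) ^ 2] turns [bessel_J0] and the sum in [bessel_Y0] into the power
   series with coefficients [J0_coeff] and [S0_coeff]. *)
Lemma bessel_Y0E (t : R) : 0 < t ->
  bessel_Y0 t = 2 / pi * ((ln ((t / 2) ^+ 2) / 2 + euler_gamma R) *
    psum J0_coeff ((t / 2) ^+ 2) - psum S0_coeff ((t / 2) ^+ 2)).
Proof.
move=> t0; have t20 : 0 < t / 2 by rewrite divr_gt0.
rewrite /bessel_Y0 /bessel_J0 lnXn// -(mulr_natr (ln _) 2) mulfK//.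
have -> : psum J0_coeff ((t / 2) ^+ 2) =
    limn (series (fun j => (-1) ^+ j * (t / 2) ^+ (2 * j) / (j`!)%:R ^+ 2)).
  rewrite /psum /pseries; congr (limn (series _)); apply/funext => i.
  by rewrite /= /J0_coeff -exprM; ring.
have -> // : psum S0_coeff ((t / 2) ^+ 2) = limn (series (fun j =>
    (-1) ^+ j * series harmonic j * (t / 2) ^+ (2 * j) / (j`!)%:R ^+ 2)).
rewrite /psum /pseries; congr (limn (series _)); apply/funext => i.
by rewrite /= /S0_coeff -exprM; ring.
Qed.

Lemma radial_helmholtz_G (m : nat) (k : R) : m = 2%N \/ m = 3%N -> 0 <= k ->
  exists F F1 F2, radial_solution m k F F1 F2 /\
    forall y : 'rV[R]_m, y != 0 -> complex.Re (helmholtz_G k y) = F (dot y y).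
Proof.
move=> [->|->] k0; last first.
  exists (fun q => cos (k * Num.sqrt q) / (4 * pi * Num.sqrt q)).
  eexists; eexists; split; first exact: radial_solution3.
  move=> y y0; rewrite /helmholtz_G /= -/(enorm y).
  have : 4 * pi * enorm y != 0.
    by rewrite !mulf_neq0// gt_eqF// ?pi_gt0// sqrtr_gt0 dot_gt0.
  move: (4 * pi * enorm y) => c c0.
  by rewrite expr0n addr0 mul0r oppr0 mulr0 subr0; field.
move: k0; rewrite le_eqVlt => /predU1P[<-|k0].
  exists (fun q => - ln q / (4 * pi)); eexists; eexists.
  split; first exact: radial_solution2_0.
  move=> y y0; rewrite /helmholtz_G /= eqxx /= -sqr_enorm.
  have y1 : 0 < enorm y by rewrite sqrtr_gt0 dot_gt0.
  rewrite lnV ?posrE// lnXn// -(mulr_natr (ln _) 2).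
  have := pi_gt0 R; move: (@pi R) => p p0.
  by field; rewrite gt_eqF.
exists (fun q => - (2 * pi)^-1 * ((ln (k ^+ 2 / 4 * q) / 2 + euler_gamma R) *
    psum J0_coeff (k ^+ 2 / 4 * q) - psum S0_coeff (k ^+ 2 / 4 * q))).
eexists; eexists; split; first exact: radial_solution2.
move=> y y0; rewrite /helmholtz_G /= gt_eqF//.
have y1 : 0 < enorm y by rewrite sqrtr_gt0 dot_gt0.
have -> : k ^+ 2 / 4 * dot y y = (k * enorm y / 2) ^+ 2.
  by rewrite -sqr_enorm; field.
have -> : complex.Re ('i%C / 4 * hankel1_0 (k * enorm y)) = - bessel_Y0 (k * enorm y) / 4.
  have i4 : 'i%C / 4 = (0 +i* 4^-1)%C :> R[i].
    have n4 : (4%:R : R[i]) != 0 by rewrite pnatr_eq0.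
    apply: (mulIf n4); rewrite divfK// -(rmorph_nat (real_complex R) 4).
    by apply/eqP; rewrite eq_complex /=; apply/andP; split; apply/eqP; field.
  by rewrite i4 /hankel1_0 /=; ring.
rewrite bessel_Y0E ?mulr_gt0//.
have := pi_gt0 R; move: (@pi R) => p p0.
by field; rewrite gt_eqF.
Qed.

End radial.

(** * The cutoff along the needle *)

Section cutoff.
Variables (R : realType) (m : nat).
Implicit Types (Omega B : set 'rV[R]_m) (sigma : R -> 'rV[R]_m).

Lemma near_cst_derive0 (f : 'rV[R]_m -> R) c (p : 'rV[R]_m) : (\forall y \near p, f y = c) ->
  \forall y \near p, forall v : 'rV[R]_m, 'D_v f y = 0.
Proof.
move=> h; have := @nbhs_interior _ p _ h; apply: filterS => y fy v.
by rewrite (@near_eq_derive _ _ _ _ (cst c))// derive_cst.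
Qed.

Lemma el_dotl (a b : 'rV[R]_m) : elementary (fun y => dot (y - a) b).
Proof.
apply: el_sum => i; apply: el_mul; last exact: el_cst.
rewrite (_ : (fun _ => _) = fun y : 'rV[R]_m => y 0 i - a 0 i).
  by apply: el_sub; [exact: el_coord|exact: el_cst].
by apply/funext => w; rewrite !mxE.
Qed.

Lemma is_derive_dotl (a b : 'rV[R]_m) y j :
  is_derive y (delta_mx 0 j) (fun y => dot (y - a) b) (b 0 j).
Proof.
have h := el_is_derive y (delta_mx 0 j) (el_dotl a b).
rewrite (_ : b 0 j = 'D_(delta_mx 0 j) (fun y => dot (y - a) b) y)//.
rewrite derive_line derive1E.
rewrite (_ : (fun t : R => _) = id * cst (b 0 j) + cst (dot (y - a) b)); last first.
  apply/funext => t; rewrite /dot !fctE /=.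
  rewrite (bigD1 j)//= [in RHS](bigD1 j)//= !mxE !eqxx /= mulr1 addrA; congr (_ + _).
    by ring.
  apply: eq_bigr => i ij; rewrite !mxE (negbTE ij) andbF mulr0 add0r//.
by rewrite derive_val scaler0 add0r addr0 /GRing.scale /= mulr1.
Qed.

Lemma open_boundary (Omega : set 'rV[R]_m) p : open Omega -> boundary Omega p -> ~ Omega p.
Proof. by move=> oO [_ nip] Op; apply: nip; exact: open_nbhs_nbhs. Qed.

(** The interval starts at [t0] and extends to its right, so it stays in one affine piece even if
    [t0] is a break point. *)
Lemma needle_linear_piece sigma B t0 : {within `[0, 1], continuous sigma} ->
  piecewise_linear sigma -> t0 \in `]0, 1[ -> open B -> B (sigma t0) ->
  exists al be a b, [/\ 0 < al, al < be, be < 1 &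
    forall s, al <= s <= be -> sigma s = a + s *: b /\ B (sigma s)].
Proof.
move=> cs [N [t [t_0 t_N _ lin]]]; rewrite in_itv/= => /andP[t00 t01] oB Bt0.
have [i [iN it0 t0i]] : exists i, [/\ (i < N)%N, t i <= t0 & t0 < t i.+1].
  have exN : exists i, t0 < t i by exists N; rewrite t_N.
  (* The first index with [t0 < t j] is not 0, because [t 0 = 0]; its predecessor starts the
     piece. *)
  have [j tj mini] := ex_minnP exN; case: j tj mini => [|i] ti mini.
    by move: ti; rewrite t_0 ltNge ltW.
  exists i; split => //; first by apply: mini; rewrite t_N.
  by rewrite leNgt; apply/negP => /mini; rewrite ltnn.
have [a [b ab]] := lin _ iN.
have /subspace_continuousP/(_ t0) := cs.
rewrite /= in_itv/= !ltW// => /(_ isT).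
have oBn : nbhs (sigma t0) B by apply: open_nbhs_nbhs.
move=> /(_ _ oBn)/nbhs_ballP[e /= e0 eB].
pose d := Num.min e (Num.min (t i.+1 - t0) (1 - t0)) / 2.
have [d0 de dt d1] : [/\ 0 < d, d < e, d < t i.+1 - t0 & d < 1 - t0].
  have m0 : 0 < Num.min e (Num.min (t i.+1 - t0) (1 - t0)).
    by rewrite !lt_min e0 !subr_gt0 t0i.
  have dm : d < Num.min e (Num.min (t i.+1 - t0) (1 - t0)).
    by rewrite ltr_pdivrMr// ltr_pMr// ltr1n.
  by move: dm; rewrite !lt_min => /and3P[]; split => //; rewrite divr_gt0.
exists t0, (t0 + d), a, b; split => //; first by rewrite ltrDl.
  by rewrite -ltrBrDl.
move=> s /andP[s1 s2]; split.
  by apply: ab; rewrite in_itv/=; apply/andP; split; [exact: le_trans s1|lra].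
apply: eB; last by rewrite /= in_itv/=; apply/andP; split; lra.
by rewrite /ball/= ltr_norml; apply/andP; split; lra.
Qed.

(** Along the needle [chi] passes from 0 to 1 within a straight piece inside [B], as a function of
    the coordinate along [b] alone; this makes its gradient parallel to [b]. Injectivity keeps the
    other arcs of the needle at a positive distance, so that two Urysohn functions can confine the
    ramp. The last clause serves to show that [grad chi] lives on a segment of the needle. *)
Lemma needle_cutoff Omega B sigma t0 : open Omega -> open B ->
  {within `[0, 1], continuous sigma} -> piecewise_linear sigma ->
  {in `[0, 1] &, injective sigma} -> ~ Omega (sigma 0) ->
  (forall t, 0 < t <= 1 -> Omega (sigma t)) ->
  t0 \in `]0, 1[ -> B (sigma t0) ->
  exists (chi : 'rV[R]_m -> R) (a b : 'rV[R]_m), [/\ b != 0, elementary chi,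
   (exists K, [/\ compact K, K `<=` Omega & forall y, ~ K y -> chi y = 0]),
   (\forall y \near sigma 1, chi y = 1) &
   (forall t, 0 <= t <= 1 ->
      (\forall y \near sigma t, (forall v, 'D_v chi y = 0) \/
        (B y /\ exists c, forall j, 'D_(delta_mx 0 j) chi y = c * b 0 j)) /\
      ((exists v, 'D_v chi (sigma t) != 0) -> sigma t = a + t *: b))].
Proof.
move=> oO oB cs pl inj nO0 Os t0I Bt0.
have [al [be [a [b [al0 albe be1 lin]]]]] := needle_linear_piece cs pl t0I oB Bt0.
have al1 : al \in `[0, 1] by rewrite in_itv/=; apply/andP; split; lra.
have be1' : be \in `[0, 1] by rewrite in_itv/=; apply/andP; split; lra.
have bn0 : b != 0.
  apply/eqP => b0; have [|s1 _] := lin al; first by rewrite lexx ltW.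
  have [|s2 _] := lin be; first by rewrite lexx ltW.
  by have := inj _ _ al1 be1'; rewrite s1 s2 b0 !scaler0 => /(_ erefl) E; lra.
have bb0 : 0 < dot b b by exact: dot_gt0.
have csub c d : 0 <= c -> d <= 1 -> compact (sigma @` `[c, d]).
  move=> c0 d1; apply: continuous_compact; last exact: segment_compact.
  by apply: continuous_subspaceW cs => s /=; rewrite !in_itv/= => /andP[]; lra.
have clsub c d : 0 <= c -> d <= 1 -> closed (sigma @` `[c, d]).
  by move=> c0 d1; apply: compact_closed; [exact: norm_hausdorff|exact: csub].
(* Five equal parts: [chi] is 0 near the needle up to [al + de], equals the ramp up to
   [al + 4 * de], and is 1 from there on. *)
pose de := (be - al) / 5.
have de0 : 0 < de by rewrite divr_gt0// subr_gt0.
have beE : be = al + 5 * de by rewrite /de; field.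
have H1 : sigma @` `[be, 1] `<=` Omega `\` sigma @` `[0, al + 4 * de].
  move=> y [t /=]; rewrite in_itv/= => /andP[t1 t2] <-; split.
    by apply: Os; lra.
  move=> [s /=]; rewrite in_itv/= => /andP[s1 s2] E.
  suff : s = t by lra.
  by apply: inj E; rewrite in_itv/=; apply/andP; split; lra.
have H2 : sigma @` `[al + de, be] `<=` Omega `\` sigma @` `[0, al].
  move=> y [t /=]; rewrite in_itv/= => /andP[t1 t2] <-; split.
    by apply: Os; lra.
  move=> [s /=]; rewrite in_itv/= => /andP[s1 s2] E.
  suff : s = t by lra.
  by apply: inj E; rewrite in_itv/=; apply/andP; split; lra.
have oD c d : 0 <= c -> d <= 1 -> open (Omega `\` sigma @` `[c, d]).
  by move=> c0 d1; rewrite setDE; apply: openI => //; apply: closed_openC; exact: clsub.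
have [b1 [eb1 b1_1 [K1 [cK1 K1O b1_0]]]] : exists b1 : 'rV[R]_m -> R, [/\ elementary b1,
    forall y, (sigma @` `[be, 1]) y -> \forall y' \near y, b1 y' = 1 &
    exists K', [/\ compact K', K' `<=` Omega `\` sigma @` `[0, al + 4 * de] &
      forall y, ~ K' y -> b1 y = 0]].
  by apply: elementary_urysohn => //; [apply: csub; lra|apply: oD; lra].
have [b2 [eb2 b2_1 [K2 [cK2 K2O b2_0]]]] : exists b2 : 'rV[R]_m -> R, [/\ elementary b2,
    forall y, (sigma @` `[al + de, be]) y -> \forall y' \near y, b2 y' = 1 &
    exists K', [/\ compact K', K' `<=` Omega `\` sigma @` `[0, al] &
      forall y, ~ K' y -> b2 y = 0]].
  by apply: elementary_urysohn => //; [apply: csub; lra|apply: oD; lra].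
have near0 (f : 'rV[R]_m -> R) K p : compact K -> ~ K p ->
    (forall y, ~ K y -> f y = 0) -> \forall y \near p, f y = 0.
  move=> cK nKp fK; have : nbhs p (~` K).
    apply: open_nbhs_nbhs; split => //; apply: closed_openC.
    by apply: compact_closed => //; exact: norm_hausdorff.
  by apply: filterS => y; exact: fK.
(* The coordinate along [b], normalised so that [l (sigma s) = s] on the straight piece. *)
pose l (y : 'rV[R]_m) := dot (y - a) b / dot b b.
have el : elementary l by apply: el_mul; [exact: el_dotl|exact: el_cst].
have lE s : al <= s <= be -> l (sigma s) = s.
  move=> sI; have [-> _] := lin _ sI; rewrite /l addrC addKr.
  rewrite [dot _ _](_ : _ = s * dot b b) ?mulfK ?gt_eqF//.
  by rewrite /dot mulr_sumr; apply: eq_bigr => i _; rewrite !mxE mulrA.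
(* The ramp rises where [l] runs from [al + 2 * de] to [al + 3 * de], one part away from both ends
   of the zone where [chi] equals it. *)
pose u y := (l y - (al + 2 * de)) / de.
have eu : elementary u.
  by apply: el_mul; [apply: el_sub => //; exact: el_cst|exact: el_cst].
pose h y := smooth_step (u y).
have eh : elementary h by exact: el_step.
have cl p : l y @[y --> p] --> l p by exact: el_continuous.
have h0 s : al <= s <= al + de -> \forall y \near sigma s, h y = 0.
  move=> sI; have ls : l (sigma s) < al + 2 * de by rewrite lE; lra.
  have : \forall y \near sigma s, l y < al + 2 * de.
    by apply: (cvgr_lt _ (cl (sigma s))).
  apply: filterS => y ly.
  by rewrite /h smooth_step0// /u ler_pdivrMr// mul0r subr_le0 ltW.
have h1 s : al + 4 * de <= s <= be -> \forall y \near sigma s, h y = 1.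
  move=> sI; have ls : al + 3 * de < l (sigma s) by rewrite lE; lra.
  have : \forall y \near sigma s, al + 3 * de < l y.
    by apply: (cvgr_gt _ (cl (sigma s))).
  apply: filterS => y ly.
  by rewrite /h smooth_step1// /u ler_pdivlMr// mul1r; lra.
(* This combination is 1 wherever [b1] or [b2 * h] is 1, so nothing need be known of [b1] on the arc
   from [al + 4 * de] to [be]. *)
pose chi y := b1 y + (1 - b1 y) * (b2 y * h y).
have echi : elementary chi.
  apply: el_add => //; apply: el_mul; last exact: el_mul.
  by apply: el_sub => //; exact: el_cst.
have b1near s : 0 <= s <= al + 4 * de -> \forall y \near sigma s, b1 y = 0.
  move=> sI; apply: near0 cK1 _ b1_0 => /K1O[_]; apply; exists s => //=.
have chi1 s : al + 4 * de <= s <= 1 -> \forall y \near sigma s, chi y = 1.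
  move=> sI; case: (leP s be) => sbe.
    have : \forall y \near sigma s, b2 y = 1.
      by apply: b2_1; exists s => //=; rewrite in_itv/=; apply/andP; split; lra.
    have : \forall y \near sigma s, h y = 1 by apply: h1; lra.
    by apply: filterS2 => y hy b2y; rewrite /chi hy b2y mulr1 mulr1 subrKC.
  have : \forall y \near sigma s, b1 y = 1.
    by apply: b1_1; exists s => //=; rewrite in_itv/=; apply/andP; split; lra.
  by apply: filterS => y b1y; rewrite /chi b1y subrr mul0r addr0.
have chi0 s : 0 <= s <= al + de -> \forall y \near sigma s, chi y = 0.
  move=> sI; have b10 : \forall y \near sigma s, b1 y = 0 by apply: b1near; lra.
  case: (leP s al) => sal.
    have : \forall y \near sigma s, b2 y = 0.
      apply: near0 cK2 _ b2_0 => /K2O[_]; apply; exists s => //=.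
      by rewrite in_itv/=; apply/andP; split; lra.
    apply: filterS2 b10 => y b1y b2y.
    by rewrite /chi b1y b2y mul0r mulr0 addr0.
  have : \forall y \near sigma s, h y = 0 by apply: h0; lra.
  apply: filterS2 b10 => y b1y hy.
  by rewrite /chi b1y hy !mulr0 addr0.
have chih s : al + de <= s <= al + 4 * de -> \forall y \near sigma s, chi y = h y.
  move=> sI; have b10 : \forall y \near sigma s, b1 y = 0 by apply: b1near; lra.
  have : \forall y \near sigma s, b2 y = 1.
    by apply: b2_1; exists s => //=; rewrite in_itv/=; apply/andP; split; lra.
  apply: filterS2 b10 => y b1y b2y.
  by rewrite /chi b1y b2y subr0 !mul1r add0r.
have dh y j : 'D_(delta_mx 0 j) h y = dstep (u y) * (de^-1 * (dot b b)^-1) * b 0 j.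
  have d1 := is_derive_funM (is_derive_dotl a b y j)
    (is_derive_funC (dot b b)^-1 y (delta_mx 0 j)).
  have d2 := is_derive_funM (is_derive_funB d1
    (is_derive_funC (al + 2 * de) y (delta_mx 0 j)))
    (is_derive_funC de^-1 y (delta_mx 0 j)).
  have [_ ->] := is_derive_comp1 d2 (is_derive_smooth_step (u y)).
  by rewrite !mulr0 add0r subr0 add0r; ring.
exists chi, a, b; split => //.
- exists (K1 `|` K2); split; first exact: compactU.
    by move=> y [/K1O|/K2O] [].
  move=> y nK; rewrite /chi b1_0 ?b2_0 ?mul0r ?mulr0 ?addr0// => Ky; apply: nK.
    by right.
  by left.
- by apply: chi1; lra.
move=> t tI.
have near_dh : al + de <= t <= al + 4 * de -> \forall y \near sigma t,
    B y /\ exists c, forall j, 'D_(delta_mx 0 j) chi y = c * b 0 j.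
  move=> tI2.
  have Bt : nbhs (sigma t) B.
    by apply: open_nbhs_nbhs; split => //; apply: (lin t _).2; lra.
  (* Equal derivatives at [y] require [chi = h] around [y], not only at [y]. *)
  have := @nbhs_interior _ (sigma t) _ (chih _ tI2); apply: filterS2 Bt => y By hy.
  split => //; exists (dstep (u y) * (de^-1 * (dot b b)^-1)) => j.
  by rewrite -dh; exact: near_eq_derive.
have lt t' : t' = t -> al <= t <= be -> sigma t = a + t *: b by move=> _ /lin[].
case: (leP t (al + de)) => t1.
  have hh := near_cst_derive0 (chi0 t _); split.
    by apply: filterS (hh _) => [y hy|]; [left|lra].
  by case=> v /eqP[]; apply: nbhs_singleton (hh _) v; lra.
case: (leP t (al + 4 * de)) => t2.
  split; last by move=> _; apply: lt => //; lra.
  by apply: filterS (near_dh _) => [y hy|]; [right|lra].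
have hh := near_cst_derive0 (chi1 t _); split.
  by apply: filterS (hh _) => [y hy|]; [left|lra].
by case=> v /eqP[]; apply: nbhs_singleton (hh _) v; lra.
Qed.

End cutoff.

(** * The flux through the singularity *)

Section supports.
Variables (R : realType) (m : nat).
Implicit Types (f e : 'rV[R]_m -> R) (K : set 'rV[R]_m).

Definition supported K f := forall y, ~ K y -> f y = 0.

Lemma compact_box_supported K : compact K -> exists M, forall f,
  supported K f -> box_supported M f.
Proof.
move=> /compact_bounded[M [_ hM]]; exists (M + 1) => f fK y [i yi].
apply: fK => Ky; have := hM (M + 1); rewrite ltrDl => /(_ ltr01 _ Ky) /=.
by have := coord_le_norm y i; lra.
Qed.

Lemma supported_derive K f v : compact K -> supported K f ->
  supported K (fun y => 'D_v f y).
Proof.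
move=> cK fK y nKy.
have : \forall y' \near y, f y' = 0.
  have : nbhs y (~` K).
    apply: open_nbhs_nbhs; split => //; apply: closed_openC.
    by apply: compact_closed => //; exact: norm_hausdorff.
  by apply: filterS => y'; exact: fK.
by move=> /near_cst_derive0/nbhs_singleton; exact.
Qed.

Lemma supportedMr K f e : supported K e -> supported K (fun y => f y * e y).
Proof. by move=> eK y /eK ->; rewrite mulr0. Qed.

Lemma supported_sum K (I : Type) (s : seq I) (F : I -> 'rV[R]_m -> R) :
  (forall i, supported K (F i)) -> supported K (fun y => \sum_(i <- s) F i y).
Proof. by move=> FK y Ky; rewrite big1// => i _; exact: FK. Qed.

(** [f] may be singular at [x]: the other factor vanishes on a neighbourhood, so the product is 0
    there whatever value [f] takes at [x]. *)
Lemma continuous_cutM f e x : (forall y, y != x -> {for y, continuous f}) ->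
  continuous e -> (\forall y \near x, e y = 0) ->
  continuous (fun y => f y * e y).
Proof.
move=> cf ce e0 y; have [->|yx] := eqVneq y x; last first.
  exact: (cvgM (cf _ yx) (ce y)).
rewrite /continuous_at (nbhs_singleton e0) mulr0.
have h : \forall z \near x, f z * e z = 0 by apply: filterS e0 => z ->; rewrite mulr0.
exact: cvg_near_cst h.
Qed.

Lemma near_continuous_at f e y : (\forall z \near y, f z = e z) ->
  {for y, continuous f} -> {for y, continuous e}.
Proof.
move=> fe cf A; rewrite -(nbhs_singleton fe) => /cf fA.
have : nbhs y (f @^-1` A) by [].
by apply: filterS2 fe => z; rewrite /preimage /= => ->.
Qed.

Lemma continuous_sumf (I : Type) (s : seq I) (F : I -> 'rV[R]_m -> R) :
  (forall i, continuous (F i)) -> continuous (fun y => \sum_(i <- s) F i y).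
Proof.
move=> cF; elim: s => [|i s IH].
  rewrite (_ : (fun _ => _) = fun=> 0); first exact: cst_continuous.
  by apply/funext => y; rewrite big_nil.
rewrite (_ : (fun _ => _) = fun y => F i y + \sum_(i <- s) F i y).
  by move=> y; exact: (cvgD (cF i y) (IH y)).
by apply/funext => y; rewrite big_cons.
Qed.

Lemma supported_integrable K f : compact K -> continuous f -> supported K f ->
  (lebesgue_rV R m).-integrable setT (EFin \o f).
Proof.
move=> /compact_box_supported[M hM] cf fK.
by apply: box_supported_integrable cf _; exact: hM.
Qed.

End supports.

Section flux.
Variables (R : realType) (m : nat) (k : R) (F F1 F2 : R -> R).
Hypothesis FF : radial_solution m k F F1 F2.
Variables (x f : 'rV[R]_m).
Hypothesis f1 : dot f f = 1.

Local Notation leb := (lebesgue_rV R m).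
Local Notation ej j := (delta_mx 0 j : 'rV[R]_m).

Let q (y : 'rV[R]_m) := dot (y - x) (y - x).

(** For a unit vector [f] this solves the Helmholtz equation. The phase makes it 1 at [x], so it
    exceeds 1/2 where the sign of the flux is decided. *)
Definition pwave (y : 'rV[R]_m) : R := cos (k * dot (y - x) f).
Definition dpwave (j : 'I_m) (y : 'rV[R]_m) : R :=
  - (k * f 0 j) * sin (k * dot (y - x) f).
Definition rad (y : 'rV[R]_m) : R := F (q y).
Definition drad (j : 'I_m) (y : 'rV[R]_m) : R := 2 * (y 0 j - x 0 j) * F1 (q y).

Definition flux (j : 'I_m) y := pwave y * drad j y - rad y * dpwave j y.

Lemma el_pwave : elementary pwave.
Proof. by apply/el_cos/el_mul; [exact: el_cst|exact: el_dotl]. Qed.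

Lemma el_dpwave j : elementary (dpwave j).
Proof.
by apply: el_mul; [exact: el_cst|apply/el_sin/el_mul; [exact: el_cst|exact: el_dotl]].
Qed.

Lemma is_derive_pwave j y : is_derive y (ej j) pwave (dpwave j y).
Proof.
have h := is_derive_funM (is_derive_funC k y (ej j)) (is_derive_dotl x f y j).
have := is_derive_comp1 h (is_derive_cos _).
by move=> h'; apply: is_derive_eq h' _; rewrite /dpwave; ring.
Qed.

Lemma is_derive_dpwave j y :
  is_derive y (ej j) (dpwave j) (- (k * f 0 j) ^+ 2 * pwave y).
Proof.
have h := is_derive_funM (is_derive_funC k y (ej j)) (is_derive_dotl x f y j).
have := is_derive_funM (is_derive_funC (- (k * f 0 j)) y (ej j))
  (is_derive_comp1 h (is_derive_sin _)).
by move=> h'; apply: is_derive_eq h' _; rewrite /pwave; ring.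
Qed.

Lemma q_gt0 y : y != x -> 0 < q y.
Proof. by move=> yx; apply: dot_gt0; rewrite subr_eq0. Qed.

Lemma is_derive_coordB j y : is_derive y (ej j) (fun y => y 0 j - x 0 j) 1.
Proof.
have h : elementary (fun y : 'rV[R]_m => y 0 j - x 0 j).
  by apply: el_sub; [exact: el_coord|exact: el_cst].
have -> : 1 = 'D_(ej j) (fun y : 'rV[R]_m => y 0 j - x 0 j) y; last exact: el_is_derive.
have := is_derive_dotl x (ej j) y j; rewrite mxE !eqxx /= => -[_ E].
transitivity ('D_(ej j) (fun y => dot (y - x) (ej j)) y); first by rewrite E.
congr (derive _ _ _); apply/funext => z; rewrite /dot (bigD1 j)//= big1 ?addr0.
  by rewrite !mxE !eqxx mulr1.
by move=> i ij; rewrite !mxE (negbTE ij) mulr0.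
Qed.

Lemma is_derive_q j y : is_derive y (ej j) q (2 * (y 0 j - x 0 j)).
Proof.
have e : elementary q by exact: el_dot.
have -> : 2 * (y 0 j - x 0 j) = 'D_(ej j) q y; last exact: el_is_derive.
rewrite derive_line derive1E.
pose c := y 0 j - x 0 j; pose r := \sum_(i | i != j) (y 0 i - x 0 i) ^+ 2.
rewrite (_ : (fun t : R => _) = fun t => (t + c) * (t + c) + r).
  have h := is_derive_funD (is_derive_id (0 : R) (1 : R)) (is_derive_funC c (0 : R) (1 : R)).
  have [_ ->] := is_derive_funD (is_derive_funM h h) (is_derive_funC r (0 : R) (1 : R)).
  by rewrite /c; ring.
apply/funext => t; rewrite /q /dot (bigD1 j)//= !mxE !eqxx /=.
congr (_ + _); first by rewrite /c; ring.
by apply: eq_bigr => i ij; rewrite !mxE (negbTE ij) andbF /=; ring.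
Qed.

Lemma is_derive_rad j y : y != x -> is_derive y (ej j) rad (drad j y).
Proof.
move=> yx; have [h1 _ _ _] := FF.
have := is_derive_comp1 (is_derive_q j y) (h1 _ (q_gt0 yx)).
by move=> h; apply: is_derive_eq h _; rewrite /drad; ring.
Qed.

Lemma is_derive_drad j y : y != x -> is_derive y (ej j) (drad j)
  (2 * F1 (q y) + 4 * (y 0 j - x 0 j) ^+ 2 * F2 (q y)).
Proof.
move=> yx; have [_ h2 _ _] := FF.
have h := is_derive_comp1 (is_derive_q j y) (h2 _ (q_gt0 yx)).
have := is_derive_funM (is_derive_funM (is_derive_funC 2 y (ej j))
  (is_derive_coordB j y)) h.
by move=> h'; apply: is_derive_eq h' _; rewrite /=; ring.
Qed.

Let cq y : {for y, continuous q}. Proof. exact/el_continuous/el_dot. Qed.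

Let cont_radial (H dH : R -> R) y : (forall t : R, 0 < t -> is_derive t (1 : R) H (dH t)) ->
  y != x -> {for y, continuous (fun y => H (q y))}.
Proof.
move=> dh yx; apply: (@continuous_comp _ _ _ q H); first exact: cq.
apply/differentiable_continuous/derivable1_diffP.
by have [] := dh _ (q_gt0 yx).
Qed.

Lemma rad_continuous y : y != x -> {for y, continuous rad}.
Proof. by have [h _ _ _] := FF; exact: cont_radial h. Qed.

Lemma coordB_continuous j : continuous (fun y : 'rV[R]_m => y 0 j - x 0 j).
Proof. by apply/el_continuous/el_sub; [exact: el_coord|exact: el_cst]. Qed.

Lemma drad_continuous j y : y != x -> {for y, continuous (drad j)}.
Proof.
move=> yx; have [_ h _ _] := FF.
exact: (cvgM (cvgM (cvg_cst (2 : R)) (@coordB_continuous j y)) (cont_radial h yx)).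
Qed.

(** Continuity of [F2] is not among the clauses of [radial_solution]; it follows by solving the
    differential equation for [F2] in terms of [F] and [F1]. *)
Let F2_continuous y : y != x -> {for y, continuous (fun y => F2 (q y))}.
Proof.
move=> yx; have [h1 h2 ode _] := FF.
have q0 := q_gt0 yx.
have E : \forall z \near y,
    - (2 * m%:R * F1 (q z) + k ^+ 2 * F (q z)) / (4 * q z) = F2 (q z).
  have : \forall z \near y, 0 < q z by apply: (cvgr_gt _ (@cq y)).
  apply: filterS => z qz; have := ode _ qz; move/eqP; rewrite -addrA addr_eq0 => /eqP e.
  apply: (@mulIf _ (4 * q z)); first by rewrite mulf_neq0// gt_eqF.
  by rewrite divfK ?mulf_neq0 ?gt_eqF// -e; ring.
have c : {for y, continuous
    (fun z => - (2 * m%:R * F1 (q z) + k ^+ 2 * F (q z)) / (4 * q z))}.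
  have c1 := cont_radial h1 yx; have c2 := cont_radial h2 yx.
  have nz : 4 * q y != 0 by rewrite mulf_neq0// gt_eqF.
  exact: (cvgM (cvgN (cvgD (cvgM (cvg_cst (2 * m%:R : R)) c2)
    (cvgM (cvg_cst (k ^+ 2)) c1))) (cvgV nz (cvgM (cvg_cst (4 : R)) (@cq y)))).
exact: near_continuous_at E c.
Qed.

Lemma flux_continuous j y : y != x -> {for y, continuous (flux j)}.
Proof.
move=> yx.
have cp : {for y, continuous pwave} by exact: el_continuous el_pwave _.
have cd : {for y, continuous (dpwave j)} by exact: el_continuous (el_dpwave j) _.
rewrite (_ : flux j = fun y => pwave y * drad j y - rad y * dpwave j y)//.
exact: (cvgB (cvgM cp (drad_continuous (j := j) yx)) (cvgM (rad_continuous yx) cd)).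
Qed.

Let dflux j y := pwave y * (2 * F1 (q y) + 4 * (y 0 j - x 0 j) ^+ 2 * F2 (q y))
  + rad y * ((k * f 0 j) ^+ 2 * pwave y).

Let is_derive_flux j y : y != x -> is_derive y (ej j) (flux j) (dflux j y).
Proof.
move=> yx.
have := is_derive_funB
  (is_derive_funM (is_derive_pwave j y) (is_derive_drad j yx))
  (is_derive_funM (is_derive_rad j yx) (is_derive_dpwave j y)).
by move=> h; apply: is_derive_eq h _; rewrite /dflux; ring.
Qed.

(** Since [sum (y_j - x_j) ^ 2 = q] and [|f| = 1], the sum collapses to [pwave] times the radial
    equation. *)
Let flux_divergence y : y != x -> \sum_j dflux j y = 0.
Proof.
move=> yx; have [_ _ ode _] := FF.
rewrite big_split/= -mulr_sumr big_split/= sumr_const card_ord.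
rewrite -mulr_suml -mulr_sumr -[X in _ + X]mulr_sumr -mulr_suml.
have -> : \sum_i (y 0 i - x 0 i) ^+ 2 = q y.
  by apply: eq_bigr => i _; rewrite !mxE expr2.
have -> : \sum_i (k * f 0 i) ^+ 2 = k ^+ 2.
  rewrite -[RHS]mulr1 -f1 /dot mulr_sumr; apply: eq_bigr => i _; ring.
rewrite -mulr_natr /rad.
rewrite [LHS](_ : _ = pwave y * (4 * q y * F2 (q y) + 2 * m%:R * F1 (q y)
   + k ^+ 2 * F (q y))); last by ring.
by rewrite ode ?mulr0// q_gt0.
Qed.

Let dflux_continuous j y : y != x -> {for y, continuous (dflux j)}.
Proof.
move=> yx; have [_ h2 _ _] := FF.
have cp : {for y, continuous pwave} by exact: el_continuous el_pwave _.
have cd : {for y, continuous (fun y : 'rV[R]_m => y 0 j - x 0 j)} by exact: coordB_continuous.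
have c1 := cont_radial h2 yx; have c2 := F2_continuous yx.
have cr := rad_continuous yx.
exact: (cvgD (cvgM cp (cvgD (cvgM (cvg_cst (2 : R)) c1)
    (cvgM (cvgM (cvg_cst (4 : R)) (cvgM cd cd)) c2)))
  (cvgM cr (cvgM (cvg_cst ((k * f 0 j) ^+ 2)) cp))).
Qed.

Lemma flux_term_continuous psi c : elementary psi ->
  (\forall y \near x, psi y = c) ->
  continuous (fun y => \sum_j flux j y * 'D_(ej j) psi y).
Proof.
move=> epsi psi0; apply: continuous_sumf => j.
apply: (@continuous_cutM _ _ _ _ x); first by move=> y; exact: flux_continuous.
  exact/el_continuous/el_derive.
by have := near_cst_derive0 psi0; apply: filterS => y; exact.
Qed.

(* The divergence of [flux] vanishes off [x]. *)
Lemma integral_flux0 psi K : elementary psi -> compact K -> supported K psi ->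
  (\forall y \near x, psi y = 0) ->
  (\int[leb]_y (\sum_j flux j y * 'D_(ej j) psi y)%:E = 0)%E.
Proof.
move=> epsi cK psiK psi0.
(* [P j] is the derivative of [flux j * psi] along the [j]-th axis. Summed over [j], its second term
   drops out with the divergence. *)
pose P j y := flux j y * 'D_(ej j) psi y + dflux j y * psi y.
have near_dpsi j : \forall y \near x, 'D_(ej j) psi y = 0.
  by have := near_cst_derive0 psi0; apply: filterS => y; exact.
have cP j : continuous (P j).
  have c1 : continuous (fun y => flux j y * 'D_(ej j) psi y).
    apply: (@continuous_cutM _ _ _ _ x); first by move=> z; exact: flux_continuous.
      exact/el_continuous/el_derive.
    exact: near_dpsi.
  have c2 : continuous (fun y => dflux j y * psi y).
    apply: (@continuous_cutM _ _ _ _ x) => //; first by move=> z; exact: dflux_continuous.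
    exact: el_continuous.
  by move=> y; exact: (cvgD (c1 y) (c2 y)).
have PK j : supported K (P j).
  move=> y nKy; rewrite /P psiK// (supported_derive _ cK psiK)//.
  by rewrite !mulr0 addr0.
have dP j y : is_derive y (ej j) (fun y => flux j y * psi y) (P j y).
  (* At [x] itself the flux has no derivative to speak of, but the product is 0 nearby. *)
  have [->|yx] := eqVneq y x.
    have -> : P j x = 0.
      by rewrite /P (nbhs_singleton psi0) (nbhs_singleton (near_dpsi j)) !mulr0 addr0.
    apply: (@near_eq_is_derive R 'rV[R]_m R (cst (0 : R))).
    by apply: filterS psi0 => z ->; rewrite mulr0.
  have := is_derive_funM (is_derive_flux j yx) (el_is_derive y (ej j) epsi).
  by move=> h; apply: is_derive_eq h _; rewrite /P; ring.
have [M hM] := compact_box_supported cK.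
have IP j : (\int[leb]_y (P j y)%:E = 0)%E.
  apply: integral_partial_supported (cP j) (dP j) (hM _ _).
  exact: supportedMr.
transitivity (\int[leb]_y (\sum_j (P j y)%:E))%E.
  apply: eq_integral => y _; rewrite sumEFin; congr EFin.
  have [->|yx] := eqVneq y x.
    rewrite !big1// => j _; first by rewrite /P (nbhs_singleton psi0)
      (nbhs_singleton (near_dpsi j)) !mulr0 addr0.
    by rewrite (nbhs_singleton (near_dpsi j)) mulr0.
  by rewrite /P big_split/= -mulr_suml flux_divergence// mul0r addr0.
rewrite integral_sum//; first by rewrite big1.
by move=> j; exact: supported_integrable cK (cP j) (PK j).
Qed.

End flux.

(** * The sign of the flux near the singularity *)

Section flux_positive.
Variables (R : realType) (m : nat) (k : R) (F F1 F2 : R -> R).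
Hypothesis FF : radial_solution m k F F1 F2.
Variables (x f : 'rV[R]_m).
Hypothesis f1 : dot f f = 1.

Local Notation leb := (lebesgue_rV R m).
Local Notation ej j := (delta_mx 0 j : 'rV[R]_m).
Local Notation q y := (dot (y - x) (y - x)).
Local Notation flx := (flux k F F1 x f).

(** Cauchy-Schwarz for a unit vector, by expanding the square of [d - (d . f) f]. *)
Lemma dot_sqr_le (d : 'rV[R]_m) : dot d f ^+ 2 <= dot d d.
Proof.
have : 0 <= \sum_j (d 0 j - dot d f * f 0 j) ^+ 2.
  by apply: sumr_ge0 => j _; exact: sqr_ge0.
rewrite (eq_bigr (fun j => d 0 j * d 0 j - 2 * dot d f * (d 0 j * f 0 j)
   + dot d f ^+ 2 * (f 0 j * f 0 j))); last by move=> j _; ring.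
rewrite big_split/= sumrB -!mulr_sumr -/(dot d d) -/(dot d f) -/(dot f f) f1.
by rewrite -mulrA mulr1; lra.
Qed.

Lemma flux_radialE y : \sum_j flx j y * (y 0 j - x 0 j) =
  pwave k x f y * (2 * q y * F1 (q y))
  + F (q y) * (k * sin (k * dot (y - x) f) * dot (y - x) f).
Proof.
rewrite (eq_bigr (fun j => pwave k x f y * 2 * F1 (q y) * ((y 0 j - x 0 j) * (y 0 j - x 0 j))
   + F (q y) * k * sin (k * dot (y - x) f) * ((y 0 j - x 0 j) * f 0 j))); last first.
  by move=> j _; rewrite /flux /drad /dpwave /rad; ring.
rewrite big_split/= -!mulr_sumr.
have -> : \sum_i (y 0 i - x 0 i) * (y 0 i - x 0 i) = q y.
  by apply: eq_bigr => i _; rewrite !mxE.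
have -> : \sum_i (y 0 i - x 0 i) * f 0 i = dot (y - x) f.
  by apply: eq_bigr => i _; rewrite !mxE.
by ring.
Qed.

Lemma sin_le_abs (t : R) : `|sin t| <= `|t|.
Proof.
have H (s : R) : 0 < s -> `|sin s| <= s.
  move=> sp; have [c _ E] : exists2 c, c \in `]0, s[ & sin s - sin 0 = cos c * (s - 0).
    apply: (MVT sp (fun c _ => is_derive_sin c)).
    by apply: continuous_subspaceT; exact: continuous_sin.
  rewrite sin0 !subr0 in E; rewrite E normrM (gtr0_norm sp) ler_piMl ?(ltW sp)//.
  by rewrite ler_norml cos_geN1 cos_le1.
have [t0|t0|->] := ltgtP t 0; last by rewrite sin0.
  by rewrite -normrN -sinN (ltr0_norm t0) H ?oppr_gt0.
by rewrite (gtr0_norm t0) H.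
Qed.

(** Where [w > 1/2], the radial part is below [q * F1], as [F1 < 0]; the part from [grad w] is at
    most [k ^ 2 * q * |F|]. The domination clause with constant [k ^ 2] makes the sum negative. *)
Lemma flux_inward : exists2 q0, 0 < q0 &
  forall y, 0 < q y < q0 -> \sum_j flx j y * (y 0 j - x 0 j) < 0.
Proof.
have [_ _ _ dom] := FF; have [q1 q10 hq1] := dom (k ^+ 2).
have near_w : \forall y \near x, 2^-1 < pwave k x f y.
  have cw : {for x, continuous (pwave k x f)} by exact: el_continuous (el_pwave _ _ _) _.
  apply: (cvgr_gt _ cw).
  rewrite /pwave subrr (_ : dot 0 f = 0) ?mulr0 ?cos0; first lra.
  by rewrite /dot big1// => i _; rewrite mxE mul0r.
have [q2 q20 hq2] := nbhs_dotP near_w.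
exists (Num.min q1 q2); first by rewrite lt_min q10.
move=> y /andP[qy]; rewrite lt_min => /andP[qy1 qy2].
rewrite flux_radialE.
have := hq1 (q y); rewrite qy qy1 => /(_ isT) h1.
have := hq2 y qy2 => h2.
set s := dot (y - x) f.
have h3 : F (q y) * (k * sin (k * s) * s) <= `|F (q y)| * (k ^+ 2 * q y).
  apply: le_trans (ler_norm _) _; rewrite normrM ler_wpM2l//.
  rewrite !normrM; apply: le_trans (_ : `|k| * `|k * s| * `|s| <= _).
    by rewrite ler_wpM2r// ler_wpM2l// sin_le_abs.
  rewrite normrM (_ : _ * _ = `|k| ^+ 2 * `|s| ^+ 2); last by ring.
  by rewrite !real_normK ?num_real// ler_wpM2l ?sqr_ge0// dot_sqr_le.
have F1n : F1 (q y) < 0.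
  by have := sqr_ge0 k; have := normr_ge0 (F (q y)) => a b; have := mulr_ge0 b a; lra.
apply: le_lt_trans (lerD (lexx _) h3) _.
apply: le_lt_trans (_ : q y * F1 (q y) + `|F (q y)| * (k ^+ 2 * q y) < 0).
  rewrite lerD2r (_ : _ * _ = (2 * pwave k x f y) * (q y * F1 (q y))); last by ring.
  rewrite -[leRHS]mul1r ler_wnM2r//; first by rewrite mulr_ge0_le0// ltW.
  lra.
rewrite [ltLHS](_ : _ = q y * (F1 (q y) + k ^+ 2 * `|F (q y)|)); last by ring.
by rewrite pmulr_rlt0//; lra.
Qed.

Lemma dstep_out (t : R) : t <= 0 \/ 1 <= t -> dstep t = 0.
Proof.
rewrite /dstep => -[t0|t1].
  by rewrite !(flat_le0 _ t0) !mul0r addr0 mul0r.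
have t1' : 1 - t <= 0 by rewrite subr_le0.
by rewrite !(flat_le0 _ t1') !mulr0 addr0 mul0r.
Qed.

(** The gradient of a decreasing function of [q] is a nonpositive multiple of [y - x], so by
    [flux_inward] the integrand is nonnegative, and positive in the shell where the cutoff
    decreases. *)
Lemma radial_cutoff_flux : exists (chi : 'rV[R]_m -> R) K, [/\ elementary chi,
  compact K, supported K chi, \forall y \near x, chi y = 1 &
  (0 < \int[leb]_y (\sum_j flx j y * 'D_(ej j) chi y)%:E)%E].
Proof.
have [q0 q00 hq0] := flux_inward.
(* The shell is [a < q < 2 * a], which a third of [q0] keeps inside the region of [flux_inward]. *)
pose a := q0 / 3; have a0 : 0 < a by rewrite divr_gt0.
pose u (y : 'rV[R]_m) := (q y - a) / a.
have eq_ : elementary (fun y : 'rV[R]_m => q y) by exact: el_dot.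
have eu : elementary u.
  by apply: el_mul; [apply: el_sub => //; exact: el_cst|exact: el_cst].
pose chi y := 1 - smooth_step (u y).
have echi : elementary chi by apply: el_sub; [exact: el_cst|exact: el_step].
have dchi j y : 'D_(ej j) chi y = - (dstep (u y) * (2 / a)) * (y 0 j - x 0 j).
  have d1 := is_derive_funM (is_derive_funB (is_derive_q x j y)
    (is_derive_funC a y (ej j))) (is_derive_funC a^-1 y (ej j)).
  have [_ ->] := is_derive_funB (is_derive_funC 1 y (ej j))
    (is_derive_comp1 d1 (is_derive_smooth_step (u y))).
  by rewrite /u; ring.
have chi1 : \forall y \near x, chi y = 1.
  have : \forall y \near x, q y < a.
    have cq : {for x, continuous (fun y : 'rV[R]_m => q y)} by exact: el_continuous eq_ _.
    apply: (cvgr_lt _ cq); by rewrite subrr (eqP (_ : dot 0 0 == 0)) ?dot_eq0.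
  apply: filterS => y qa; rewrite /chi smooth_step0 ?subr0//.
  by rewrite /u ler_pdivrMr// mul0r subr_le0 ltW.
pose K := [set y : 'rV[R]_m | q y <= 2 * a].
have cK : compact K by exact: compact_dot_le.
have chiK : supported K chi.
  move=> y /= /negP; rewrite -ltNge => qy; rewrite /chi smooth_step1 ?subrr//.
  by rewrite /u ler_pdivlMr// mul1r; lra.
exists chi, K; split => //.
pose I y := \sum_j flx j y * 'D_(ej j) chi y.
have IE y : I y = - (dstep (u y) * (2 / a)) * \sum_j flx j y * (y 0 j - x 0 j).
  by rewrite /I mulr_sumr; apply: eq_bigr => j _; rewrite dchi; ring.
have Ipos y : a < q y < 2 * a -> 0 < I y.
  move=> /andP[qy1 qy2]; rewrite IE nmulr_rgt0.
    by apply: hq0; apply/andP; split; rewrite /a in qy1 qy2 *; lra.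
  rewrite oppr_lt0; apply: mulr_gt0; last by rewrite divr_gt0.
  apply: dstep_gt0; rewrite /u.
  by rewrite ltr_pdivlMr// ltr_pdivrMr// mul0r mul1r; apply/andP; split; lra.
have I0 y : 0 <= I y.
  have [h|h] := boolP (a < q y < 2 * a); first exact/ltW/Ipos.
  rewrite IE dstep_out ?mul0r ?oppr0 ?mul0r//.
  move: h; rewrite negb_and -!leNgt => /orP[h|h]; [left|right].
    by rewrite /u ler_pdivrMr// mul0r; lra.
  by rewrite /u ler_pdivlMr// mul1r; lra.
have cI : continuous I by exact: (flux_term_continuous FF echi chi1).
have IK : supported K I.
  apply: supported_sum => j; apply: supportedMr.
  exact: supported_derive.
(* A point in the middle of the shell, where [q = 3 / 2 * a]. *)
pose y0 := x + Num.sqrt (3 / 2 * a) *: f.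
have qy0 : q y0 = 3 / 2 * a.
  rewrite /y0 addrC addKr [RHS](_ : _ = 3 / 2 * a * dot f f); last by rewrite f1 mulr1.
  rewrite /dot mulr_sumr.
  have c0 : 0 <= 3 / 2 * a by rewrite mulr_ge0 ?(ltW a0).
  have ss : 3 / 2 * a = Num.sqrt (3 / 2 * a) * Num.sqrt (3 / 2 * a) by rewrite -expr2 sqr_sqrtr.
  by apply: eq_bigr => i _; rewrite !mxE [in RHS]ss; ring.
have Iy0 : 0 < I y0 by apply: Ipos; rewrite qy0; apply/andP; split; lra.
(* Continuity makes [V] a nonempty open set, so the integral is at least [I y0 / 2] times a positive
   measure. *)
pose V := [set y | I y0 / 2 < I y].
have oV : open V.
  by apply: (@open_comp _ _ I [set t | I y0 / 2 < t]); [move=> y _; exact: cI|exact: open_gt].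
have V0 : V !=set0 by exists y0; rewrite /V /= ltr_pdivrMr// ltr_pMr// ltr1n.
have mV : measurable V by exact: open_measurable_rV.
apply: (@lt_le_trans _ _ (\int[leb]_y ((I y0 / 2)%:E * (\1_V y)%:E))%E).
  rewrite ge0_integralZl//; last 2 first.
  - by apply/measurable_EFinP; exact: measurable_indic.
  - by rewrite lee_fin divr_ge0// ltW.
  rewrite integral_indic// setIT mule_gt0 ?lte_fin ?divr_gt0//.
  exact: open_lebesgue_gt0.
apply: ge0_integral_mono => y _.
  by rewrite -EFinM lee_fin mulr_ge0// divr_ge0// ltW.
rewrite -EFinM lee_fin indicE; have [yV|_] := boolP (y \in V).
  by rewrite mulr1; apply/ltW; move: yV; rewrite inE.
by rewrite mulr0 I0.
Qed.

(** The difference of two such cutoffs vanishes near [x], so by [integral_flux0] the value is that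
    of the radial cutoff. *)
Lemma flux_gt0 (chi : 'rV[R]_m -> R) K : elementary chi -> compact K ->
  supported K chi -> (\forall y \near x, chi y = 1) ->
  (0 < \int[leb]_y (\sum_j flx j y * 'D_(ej j) chi y)%:E)%E.
Proof.
move=> echi cK chiK chi1.
have [chi2 [K2 [e2 cK2 chi2K chi21 pos]]] := radial_cutoff_flux.
pose psi y := chi y - chi2 y.
have epsi : elementary psi by exact: el_sub.
have psiK : supported (K `|` K2) psi.
  by move=> y nK; rewrite /psi chiK ?chi2K ?subrr// => Ky; apply: nK; [right|left].
have psi0 : \forall y \near x, psi y = 0.
  by apply: filterS2 chi1 chi21 => y; rewrite /psi => -> ->; rewrite subrr.
have psi_int := integral_flux0 FF f1 epsi (compactU cK cK2) psiK psi0.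
pose I g y : \bar R := (\sum_j flx j y * 'D_(ej j) g y)%:E.
have int g Kg : elementary g -> compact Kg -> supported Kg g ->
    (exists c, \forall y \near x, g y = c) -> leb.-integrable setT (I g).
  move=> eg cKg gK [c gc]; apply: (supported_integrable cKg).
    exact: (flux_term_continuous FF eg gc).
  by apply: supported_sum => j; apply: supportedMr; exact: supported_derive.
have i1 := int _ _ echi cK chiK (ex_intro _ 1 chi1).
have i2 := int _ _ e2 cK2 chi2K (ex_intro _ 1 chi21).
have IB y : I psi y = (I chi y - I chi2 y)%E.
  rewrite /I -EFinB -sumrB; congr EFin; apply: eq_bigr => j _.
  have [_ ->] := is_derive_funB (el_is_derive y (ej j) echi) (el_is_derive y (ej j) e2).
  by rewrite mulrBr.
have : (\int[leb]_y I chi y - \int[leb]_y I chi2 y = 0)%E.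
  rewrite -psi_int -integralB//.
  by apply: eq_integral => y _; rewrite -IB.
have := integrable_fin_num measurableT i1; have := integrable_fin_num measurableT i2.
move: pos; rewrite -/(I chi2) -/(I chi).
move: (\int[leb]_y I chi y)%E (\int[leb]_y I chi2 y)%E => [a| |] [b| |]// pos _ _.
by move=> [/eqP]; rewrite subr_eq0 => /eqP ->.
Qed.

End flux_positive.

(** * The weak equations *)

Section l2.
Variables (R : realType) (m : nat).
Local Notation leb := (lebesgue_rV R m).
Implicit Types (A : set 'rV[R]_m) (h : 'rV[R]_m -> R) (u : 'rV[R]_m -> R[i]).

Lemma integral_sqr_L2norm A h :
  (\int[leb]_(y in A) (h y ^+ 2)%:E = L2norm A h `^ 2)%E.
Proof.
rewrite /L2norm poweR_Lnorm ?pnatr_eq0// [LHS]integral_mkcond; apply: eq_integral => y _.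
rewrite /patch /=; case: ifPn => _; last first.
  by rewrite normr0 powR0 ?pnatr_eq0.
by rewrite powR_mulrn// real_normK// num_real.
Qed.

Lemma sqr_Re_le_cabs u y : complex.Re (u y) ^+ 2 <= cabs u y ^+ 2.
Proof.
rewrite /cabs; case: (u y) => a b /=.
by rewrite sqr_sqrtr ?addr_ge0 ?sqr_ge0// lerDl sqr_ge0.
Qed.

Lemma sum_sqr_Re_le_gabs (g : 'I_m -> 'rV[R]_m -> R[i]) y :
  \sum_j complex.Re (g j y) ^+ 2 <= gabs g y ^+ 2.
Proof.
rewrite /gabs sqr_sqrtr; last by apply: sumr_ge0 => j _; exact: sqr_ge0.
by apply: ler_sum => j _; exact: sqr_Re_le_cabs.
Qed.

(** From [|a| <= 1 + a ^ 2] and the finite measure of [A]. *)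
Lemma L2_Re_integrable A u : measurable A -> (leb A < +oo)%E -> L2 A u ->
  leb.-integrable A (EFin \o (fun y => complex.Re (u y))).
Proof.
move=> mA Afin [mu _ ufin]; apply/integrableP; split; first exact/measurable_EFinP.
have m2 : measurable_fun A (fun y => complex.Re (u y) ^+ 2).
  exact: (measurable_funX 2 mu).
apply: (@le_lt_trans _ _ (\int[leb]_(y in A) (1 + (complex.Re (u y) ^+ 2)%:E))%E).
  apply: ge0_integral_mono => y _ //=; rewrite -EFinD lee_fin.
  have := sqr_ge0 (`|complex.Re (u y)| - 1).
  have := real_normK (num_real (complex.Re (u y))) => E.
  by rewrite sqrrB E; have := normr_ge0 (complex.Re (u y)); have := sqr_ge0 (complex.Re (u y)); lra.
rewrite ge0_integralD//; last 2 first.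
- by move=> y _; rewrite lee_fin sqr_ge0.
- exact/measurable_EFinP.
rewrite lte_add_pinfty//; first by rewrite integral_cst// mul1e.
apply: (@le_lt_trans _ _ (\int[leb]_(y in A) (cabs u y ^+ 2)%:E)%E).
  by apply: ge0_integral_mono => y _; rewrite lee_fin ?sqr_ge0// sqr_Re_le_cabs.
by rewrite integral_sqr_L2norm; apply: poweR_lty.
Qed.

Lemma supported_bounded K (phi : 'rV[R]_m -> R) : compact K -> continuous phi ->
  supported K phi -> exists2 C, 0 <= C & forall y, `|phi y| <= C.
Proof.
move=> cK cphi phiK.
have : compact (phi @` K).
  by apply: continuous_compact => //; exact: continuous_subspaceT.
move=> /compact_bounded[M [_ hM]]; exists (`|M| + 1); first by rewrite addr_ge0.
move=> y; have [Ky|nKy] := pselect (K y); last by rewrite phiK// normr0 addr_ge0.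
by apply: hM; [have := ler_norm M; lra|exists y].
Qed.

Lemma integrable_mul_supported A K (u phi : 'rV[R]_m -> R) : measurable A ->
  leb.-integrable A (EFin \o u) -> compact K -> continuous phi -> supported K phi ->
  leb.-integrable A (EFin \o (fun y => u y * phi y)).
Proof.
move=> mA iu cK cphi phiK.
have [C C0 hC] := supported_bounded cK cphi phiK.
have mphi : measurable_fun A phi.
  by apply: measurable_funTS; exact: continuous_measurable_rV.
have bphi : [bounded phi y | y in A].
  exists C; split; first exact: num_real.
  by move=> c Cc y _; apply: le_trans (hC y) _; exact: ltW.
apply: eq_integrable (integrableMr mA mphi bphi iu) => //.
by move=> y _; rewrite /= EFinM muleC.
Qed.

End l2.

Section weak.
Variables (R : realType) (m : nat) (Omega : set 'rV[R]_m) (k : R).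
Local Notation leb := (lebesgue_rV R m).
Local Notation ej j := (delta_mx 0 j : 'rV[R]_m).

Lemma el_test_function (phi : 'rV[R]_m -> R) K : elementary phi ->
  compact K -> K `<=` Omega -> supported K phi ->
  test_function Omega (fun y => (phi y)%:C%C).
Proof.
move=> ephi cK KO phiK; split; first exact: el_smooth.
by exists K; split => // y nKy; rewrite phiK.
Qed.

(** A gradient in L^2 exists for [u], so the choice in [grad] does not fall back on its default
    0. *)
Lemma grad_L2_gradient u : H1 Omega u -> L2_gradient Omega u (grad Omega u).
Proof. by move=> [_ [g gP]]; rewrite /grad; apply: xgetPex; exists g. Qed.

Variables (u : 'rV[R]_m -> R[i]) (usol : H1_solution Omega k u).
Hypotheses (mO : measurable Omega) (Ofin : (leb Omega < +oo)%E).

Let U y := complex.Re (u y).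
Let p j y := complex.Re (grad Omega u j y).

Let iU : leb.-integrable Omega (EFin \o U).
Proof. by have [[u2 _] _] := usol; exact: L2_Re_integrable. Qed.

Let ip j : leb.-integrable Omega (EFin \o p j).
Proof.
have [h1 _] := usol; have [h2 _] := grad_L2_gradient h1.
exact: L2_Re_integrable.
Qed.

Let Re_mul_real (z : R[i]) (r : R) : complex.Re (z * r%:C%C) = complex.Re z * r.
Proof. by case: z => a b /=; rewrite mulr0 subr0. Qed.

Let Re_cintegral (h : 'rV[R]_m -> R[i]) : complex.Re (cintegral Omega h) =
  (\int[leb]_(y in Omega) complex.Re (h y))%R.
Proof. by []. Qed.

Let ReN (z : R[i]) : complex.Re (- z) = - complex.Re z.
Proof. by case: z. Qed.

Let Re_real_mul (z : R[i]) (r : R) : complex.Re (r%:C%C * z) = r * complex.Re z.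
Proof. by case: z => a b /=; rewrite mul0r subr0. Qed.

Lemma weak_gradient_Re j (phi : 'rV[R]_m -> R) K : elementary phi ->
  compact K -> K `<=` Omega -> supported K phi ->
  (\int[leb]_(y in Omega) (U y * 'D_(ej j) phi y) =
   - \int[leb]_(y in Omega) (p j y * phi y))%R.
Proof.
move=> ephi cK KO phiK; have [h1 _] := usol.
have [_ wg] := grad_L2_gradient h1.
have := wg j _ (el_test_function ephi cK KO phiK).
move=> /(congr1 (@complex.Re R)).
rewrite partial_real ReN !Re_cintegral.
under eq_Rintegral do rewrite Re_mul_real.
by move=> ->; congr (- _); apply: eq_Rintegral => y _; exact: Re_mul_real.
Qed.

Lemma weak_helmholtz_Re (phi : 'rV[R]_m -> R) K : elementary phi ->
  compact K -> K `<=` Omega -> supported K phi ->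
  (\int[leb]_(y in Omega) (\sum_j p j y * 'D_(ej j) phi y) =
   k ^+ 2 * \int[leb]_(y in Omega) (U y * phi y))%R.
Proof.
move=> ephi cK KO phiK; have [_ wh] := usol.
have := wh _ (el_test_function ephi cK KO phiK).
move=> /(congr1 (@complex.Re R)).
rewrite Re_real_mul !Re_cintegral.
under [in X in _ = X]eq_Rintegral do rewrite Re_mul_real.
move=> <-; apply: eq_Rintegral => y _; rewrite raddf_sum.
by apply: eq_bigr => j _; rewrite partial_real; exact/esym/Re_mul_real.
Qed.

Variables (x f : 'rV[R]_m).
Hypothesis f1 : dot f f = 1.

Local Notation w := (pwave k x f).
Local Notation dw := (dpwave k x f).

(** Green's second identity for a function that is only in H^1. The weak equation is tested with
    [chi w]; the integration by parts that moves derivatives onto [grad w] is the definition of the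
    weak gradient, tested with [chi d_j w]. The terms without a derivative of [chi] cancel because
    [w] solves the same equation. *)
Lemma solution_flux0 (chi : 'rV[R]_m -> R) K : elementary chi ->
  compact K -> K `<=` Omega -> supported K chi ->
  let h y := \sum_j p j y * (w y * 'D_(ej j) chi y)
     - U y * (\sum_j dw j y * 'D_(ej j) chi y) in
  leb.-integrable Omega (EFin \o h) /\ (\int[leb]_(y in Omega) h y = 0)%R.
Proof.
move=> echi cK KO chiK h.
have ew := el_pwave k x f; have edw j := el_dpwave k x f j.
have dK j : supported K (fun y => 'D_(ej j) chi y) by exact: supported_derive.
have ed j : elementary (fun y => 'D_(ej j) chi y) by exact: el_derive.
have int_p j phi : elementary phi -> supported K phi ->
    leb.-integrable Omega (EFin \o (fun y => p j y * phi y)).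
  by move=> ephi phiK; apply: (integrable_mul_supported mO (ip j) cK) => //; exact: el_continuous.
have int_U phi : elementary phi -> supported K phi ->
    leb.-integrable Omega (EFin \o (fun y => U y * phi y)).
  by move=> ephi phiK; apply: (integrable_mul_supported mO iU cK) => //; exact: el_continuous.
have eD j y : 'D_(ej j) (fun y => chi y * w y) y =
    chi y * dw j y + w y * 'D_(ej j) chi y.
  have [_ ->] := is_derive_funM (el_is_derive y (ej j) echi) (is_derive_pwave k x f j y).
  by [].
have eDD j y : 'D_(ej j) (fun y => chi y * dw j y) y =
    - (k * f 0 j) ^+ 2 * (chi y * w y) + dw j y * 'D_(ej j) chi y.
  have [_ ->] := is_derive_funM (el_is_derive y (ej j) echi) (is_derive_dpwave k x f j y).
  by ring.
have chidw j : supported K (fun y => chi y * dw j y) by move=> y /chiK ->; rewrite mul0r.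
have chiw : supported K (fun y => chi y * w y) by move=> y /chiK ->; rewrite mul0r.
have wd j : supported K (fun y => w y * 'D_(ej j) chi y) by exact: supportedMr.
have dwd j : supported K (fun y => dw j y * 'D_(ej j) chi y) by exact: supportedMr.
have e1 j : elementary (fun y => chi y * dw j y) by exact: el_mul.
have e2 : elementary (fun y => chi y * w y) by exact: el_mul.
have e3 j : elementary (fun y => w y * 'D_(ej j) chi y) by exact: el_mul.
have e4 j : elementary (fun y => dw j y * 'D_(ej j) chi y) by exact: el_mul.
have W2 := weak_helmholtz_Re e2 cK KO chiw.
have W1 j := weak_gradient_Re j (e1 j) cK KO (chidw j).
(* [E2] below is the weak equation, [sum P1 + sum P2 = k ^ 2 U1], and [E3] the summed gradient
   identities, [sum U2 = k ^ 2 U1 - sum P1], which uses [|f| = 1]. Hence [sum P2 = sum U2]. *)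
pose P1 j := (\int[leb]_(y in Omega) (p j y * (chi y * dw j y)))%R.
pose P2 j := (\int[leb]_(y in Omega) (p j y * (w y * 'D_(ej j) chi y)))%R.
pose U1 := (\int[leb]_(y in Omega) (U y * (chi y * w y)))%R.
pose U2 j := (\int[leb]_(y in Omega) (U y * (dw j y * 'D_(ej j) chi y)))%R.
have Rsum (s : seq 'I_m) (F : 'I_m -> 'rV[R]_m -> R) :
    (forall j, leb.-integrable Omega (EFin \o F j)) ->
    leb.-integrable Omega (EFin \o (fun y => \sum_(j <- s) F j y)) /\
    (\int[leb]_(y in Omega) (\sum_(j <- s) F j y) =
     \sum_(j <- s) \int[leb]_(y in Omega) F j y)%R.
  move=> iF; elim: s => [|j s [IHi IH]].
    rewrite big_nil (_ : (fun _ => _) = fun=> 0); last by apply/funext => y; rewrite big_nil.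
    split; first exact: integrable0.
    by rewrite Rintegral_cst// mul0r.
  rewrite big_cons (_ : (fun _ => _) = fun y => F j y + \sum_(j <- s) F j y); last first.
    by apply/funext => y; rewrite big_cons.
  split; first exact: (integrableD mO (iF j) IHi).
  by rewrite RintegralD// IH.
have E1 j : U2 j = (k * f 0 j) ^+ 2 * U1 - P1 j.
  have := W1 j; rewrite -/(P1 j).
  under eq_Rintegral do rewrite eDD mulrDr mulrCA.
  rewrite RintegralD//; last 2 first.
  - have hz := integrableZl mO (- (k * f 0 j) ^+ 2) (int_U _ e2 chiw).
    by apply: eq_integrable hz => // y _; rewrite /= -EFinM.
  - exact: int_U.
  rewrite RintegralZl//; last exact: int_U.
  by rewrite -/U1 -/(U2 j); lra.
have E2 : \sum_j P1 j + \sum_j P2 j = k ^+ 2 * U1.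
  rewrite -W2 -big_split/=.
  under [RHS]eq_Rintegral.
    move=> y _; under eq_bigr do rewrite eD mulrDr.
    over.
  have [_ ->] := Rsum (index_enum _) (fun j y => p j y * (chi y * dw j y) +
     p j y * (w y * 'D_(ej j) chi y))
     (fun j => integrableD mO (int_p j _ (e1 j) (chidw j)) (int_p j _ (e3 j) (wd j))).
  apply: eq_bigr => j _; rewrite RintegralD//; exact: int_p.
have E3 : \sum_j U2 j = k ^+ 2 * U1 - \sum_j P1 j.
  rewrite (eq_bigr _ (fun j _ => E1 j)) sumrB -mulr_suml; congr (_ * _ - _).
  rewrite -[RHS]mulr1 -f1 /dot mulr_sumr; apply: eq_bigr => i _; ring.
have [ip2 Ep2] := Rsum (index_enum _) _ (fun j => int_p j _ (e3 j) (wd j)).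
have [iu2 Eu2] := Rsum (index_enum _) _ (fun j => int_U _ (e4 j) (dwd j)).
have hE : h = fun y => \sum_j p j y * (w y * 'D_(ej j) chi y)
     - \sum_j U y * (dw j y * 'D_(ej j) chi y).
  by apply/funext => y; rewrite /h mulr_sumr.
split; first by rewrite hE; exact: (integrableB mO ip2 iu2).
rewrite hE RintegralB// Ep2 Eu2 -/(\sum_j P2 j) -/(\sum_j U2 j).
by rewrite E3; lra.
Qed.

End weak.

(** * Blow-up of the energy *)

Lemma cvge0_lt (R : realType) (u : nat -> \bar R) (e : R) : 0 < e ->
  u @ \oo --> 0%E -> \forall n \near \oo, (u n < e%:E)%E.
Proof.
move=> e0 /fine_cvgP[fu u0].
have : \forall n \near \oo, fine (u n) < e by apply: (cvgr_lt _ u0).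
by apply: filterS2 fu => n fun_ ue; rewrite -(fineK fun_) lte_fin.
Qed.

(** * Thin neighbourhoods of the needle *)

Section thin_neighbourhoods.
Variables (R : realType) (m : nat).
Local Notation leb := (lebesgue_rV R m).

Definition tube (S : set 'rV[R]_m) (i : nat) : set 'rV[R]_m :=
  \bigcup_(p in S) [set y | dot (y - p) (y - p) < i.+1%:R^-1].

Lemma open_tube S i : open (tube S i).
Proof.
by apply: bigcup_open => p _; exact/open_elementary_lt/el_dot.
Qed.

Lemma sub_tube S i : S `<=` tube S i.
Proof.
move=> p Sp; exists p => //=.
by rewrite subrr (eqP (_ : dot 0 0 == 0)) ?dot_eq0// invr_gt0.
Qed.

Lemma tubeS S i j : (i <= j)%N -> tube S j `<=` tube S i.
Proof.
move=> ij y [p Sp /= h]; exists p => //=; apply: lt_le_trans h _.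
by rewrite lef_pV2 ?posrE// ler_nat.
Qed.

Lemma dotBC (y z : 'rV[R]_m) : dot (y - z) (y - z) = dot (z - y) (z - y).
Proof. by apply: eq_bigr => i _; rewrite !mxE; ring. Qed.

Lemma bigcap_tube S : closed S -> \bigcap_i tube S i `<=` S.
Proof.
move=> cS y hy; apply: contrapT => nSy.
have /nbhs_dotP[e e0 he] : nbhs y (~` S).
  by apply: open_nbhs_nbhs; split => //; exact: closed_openC.
have [p Sp /= yp] := hy (Num.truncn e^-1) I.
apply: (he p) => //; rewrite dotBC; apply: lt_trans yp _.
by rewrite -[ltRHS]invrK ltf_pV2 ?posrE ?invr_gt0// truncnS_gt.
Qed.

(** Continuity of the measure from above: the tubes decrease to the closed set [S], and [Q] has
    finite measure because it lies in a compact set. *)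
Lemma tube_measure_small S (Q : set 'rV[R]_m) K (e : R) : 0 < e -> closed S ->
  open Q -> compact K -> Q `<=` K -> leb (Q `&` S) = 0%E ->
  exists i, (leb (Q `&` tube S i) < e%:E)%E.
Proof.
move=> e0 cS oQ cK QK QS0.
have oF i : open (Q `&` tube S i) by apply: openI => //; exact: open_tube.
have mF i : measurable (Q `&` tube S i) by exact: open_measurable_rV.
have E : \bigcap_i (Q `&` tube S i) = Q `&` S.
  apply/seteqP; split=> [y hy|y [Qy Sy] i _]; last by split => //; exact: sub_tube.
  split; first by have [] := hy 0%N I.
  by apply: bigcap_tube => // i _; have [] := hy i I.
have c : leb \o (fun i => Q `&` tube S i) @ \oo --> 0%E.
  rewrite -QS0 -E; apply: nonincreasing_cvg_mu => //.
  - apply: (@le_lt_trans _ _ (leb K)); last exact: compact_lebesgue_lty.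
    apply: le_measure; rewrite ?inE//; first exact: compact_measurable_rV.
    by move=> y [/QK].
  - by rewrite E; apply: measurableI; [exact: open_measurable_rV|exact: closed_measurable_rV].
  - move=> i j ij; apply/subsetPset => y [Qy Ty]; split => //.
    exact: tubeS ij _ Ty.
have [i _ hi] := cvge0_lt e0 c.
by exists i; apply: (hi i) => /=.
Qed.

End thin_neighbourhoods.

Section estimates.
Variables (R : realType) (m : nat).
Local Notation leb := (lebesgue_rV R m).

(** Young's inequality, from the square of [2 s |a| - C]. The weight [s] will be at least 1 away
    from the needle, where [a] is small in L^2, and small near it, where only the energy bounds
    [a]. *)
Lemma abs_mul_le_sqr (s C a b : R) : 0 < s -> `|b| <= C ->
  `|a * b| <= s * a ^+ 2 + C ^+ 2 / (4 * s).
Proof.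
move=> s0 bC; rewrite normrM; apply: le_trans (ler_wpM2l _ bC) _ => //.
rewrite -(real_normK (num_real a)).
have : 0 <= (2 * s * `|a| - C) ^+ 2 / (4 * s) by rewrite divr_ge0 ?sqr_ge0// mulr_ge0// ltW.
rewrite [X in 0 <= X](_ : _ = s * `|a| ^+ 2 + C ^+ 2 / (4 * s) - `|a| * C); first lra.
by field; rewrite gt_eqF.
Qed.

Lemma integral_affine_bound (A : set 'rV[R]_m) (h phi : 'rV[R]_m -> R) (s c a l : R) :
  measurable A -> measurable_fun A phi -> (forall y, A y -> 0 <= phi y) ->
  0 <= s -> 0 <= c -> (forall y, A y -> `|h y| <= s * phi y + c) ->
  (\int[leb]_(y in A) (phi y)%:E <= a%:E)%E -> (leb A <= l%:E)%E ->
  (\int[leb]_(y in A) `|(h y)%:E| <= (s * a + c * l)%:E)%E.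
Proof.
move=> mA mphi phi0 s0 c0 hb ia il.
apply: (@le_trans _ _ (\int[leb]_(y in A) (s%:E * (phi y)%:E + c%:E))%E).
  apply: ge0_integral_mono => y Ay; first exact: abse_ge0.
  by rewrite -EFinM -EFinD lee_fin; exact: hb.
rewrite ge0_integralD//; last 2 first.
- by move=> y Ay; rewrite -EFinM lee_fin mulr_ge0// phi0.
- by apply/measurable_EFinP; apply: measurable_funM.
rewrite ge0_integralZl//; last first.
  exact/measurable_EFinP.
by rewrite integral_cst// EFinD !EFinM leeD// lee_wpmul2l//.
Qed.

Lemma exists_unit_orthogonal (b : 'rV[R]_m.+2) :
  exists f : 'rV[R]_m.+2, dot f f = 1 /\ dot f b = 0.
Proof.
suff [f [f0 fb]] : exists f : 'rV[R]_m.+2, f != 0 /\ dot f b = 0.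
  have ff := dot_gt0 f0.
  have dotZ (c : R) (g h : 'rV[R]_m.+2) : dot (c *: g) h = c * dot g h.
    by rewrite /dot mulr_sumr; apply: eq_bigr => i _; rewrite !mxE mulrA.
  have dotC (g h : 'rV[R]_m.+2) : dot g h = dot h g.
    by apply: eq_bigr => i _; rewrite mulrC.
  exists ((Num.sqrt (dot f f))^-1 *: f); split; last by rewrite dotZ fb mulr0.
  rewrite dotZ dotC dotZ mulrA -invfM -expr2 sqr_sqrtr ?mulVf ?gt_eqF//.
  exact: ltW.
pose i1 : 'I_m.+2 := lift ord0 ord0.
(* A quarter turn of the first two coordinates of [b]; if both of them vanish, the first basis
   vector is orthogonal to [b] instead. *)
pose f : 'rV[R]_m.+2 := b 0 i1 *: delta_mx 0 ord0 - b 0 ord0 *: delta_mx 0 i1.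
have [f0|f0] := eqVneq f 0; last first.
  exists f; split => //; rewrite /dot !big_ord_recl big1 => [|i _].
    by rewrite !mxE !eqxx /=; ring.
  by rewrite !mxE /= !mulr0 subrr mul0r.
exists (delta_mx 0 ord0); split.
  apply/eqP => /rowP/(_ ord0); rewrite !mxE !eqxx /= => /eqP.
  by rewrite oner_eq0.
have := congr1 (fun g : 'rV[R]_m.+2 => g 0 i1) f0; rewrite !mxE !eqxx /=.
rewrite mulr0 sub0r mulr1 => /eqP; rewrite oppr_eq0 => /eqP b0.
rewrite /dot !big_ord_recl big1 => [|i _].
  by rewrite !mxE !eqxx b0 /=; ring.
by rewrite !mxE /= mul0r.
Qed.

End estimates.

Section needle.
Variables (R : realType) (m : nat) (k : R) (F F1 F2 : R -> R).
Hypothesis FF : radial_solution m k F F1 F2.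
Local Notation leb := (lebesgue_rV R m).
Local Notation ej j := (delta_mx 0 j : 'rV[R]_m).
Variables (Omega : set 'rV[R]_m) (x : 'rV[R]_m) (sigma : R -> 'rV[R]_m).
Hypotheses (oO : open Omega) (bO : bounded_set Omega).
Hypothesis GF : forall y : 'rV[R]_m, y != 0 -> complex.Re (helmholtz_G k y) = F (dot y y).

Let mO : measurable Omega. Proof. exact: open_measurable_rV. Qed.
Let Ofin : (leb Omega < +oo)%E. Proof. exact: bounded_lebesgue_lty. Qed.

Local Notation g := (rad F x).
Local Notation dg := (drad F1 x).

Lemma Re_helmholtz_shift y : y != x -> complex.Re (helmholtz_G k (y - x)) = g y.
Proof. by move=> yx; rewrite GF ?subr_eq0. Qed.

Lemma Re_partial_helmholtz_shift j y : y != x ->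
  complex.Re (partial j (fun w => helmholtz_G k (w - x)) y) = dg j y.
Proof.
move=> yx; rewrite /partial /=.
have [_ <-] := is_derive_rad FF j yx.
apply: near_eq_derive.
have : \forall z \near y, z != x.
  have : nbhs y (~` [set x]).
    apply: open_nbhs_nbhs; split; last by move=> /= E; rewrite E eqxx in yx.
    apply: closed_openC; apply: compact_closed; first exact: norm_hausdorff.
    exact: compact_set1.
  by apply: filterS => z /eqP.
by apply: filterS => z zx; exact: Re_helmholtz_shift.
Qed.

Let ReB (z w : R[i]) : complex.Re (z - w) = complex.Re z - complex.Re w.
Proof. by case: z; case: w. Qed.

Definition defect (u : 'rV[R]_m -> R[i]) y : R :=
  \sum_j (complex.Re (grad Omega u j y) - dg j y) ^+ 2
  + (complex.Re (u y) - g y) ^+ 2.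

Lemma defect_ge0 u y : 0 <= defect u y.
Proof.
rewrite addr_ge0 ?sqr_ge0//; apply: sumr_ge0 => j _; exact: sqr_ge0.
Qed.

Lemma measurable_defect u K : H1 Omega u -> compact K -> K `<=` Omega ->
  ~ K x -> measurable_fun K (fun y => \sum_j (complex.Re (grad Omega u j y) - dg j y) ^+ 2)
    /\ measurable_fun K (fun y => (complex.Re (u y) - g y) ^+ 2).
Proof.
move=> h1 cK KO nKx; have [h2 _] := grad_L2_gradient h1; have [[mu _ _] _] := h1.
have mK : measurable K by exact: compact_measurable_rV.
have oX : open (~` [set x]).
  apply: closed_openC; apply: compact_closed; first exact: norm_hausdorff.
  exact: compact_set1.
have off (h : 'rV[R]_m -> R) : (forall y, y != x -> {for y, continuous h}) ->
    measurable_fun K h.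
  move=> ch; apply: (@measurable_funS _ _ _ _ (~` [set x])).
  - exact: open_measurable_rV.
  - by move=> y Ky /= yx; apply: nKx; rewrite -yx.
  - by apply: continuous_in_measurable_rV => // y /eqP; exact: ch.
split.
  apply: measurable_sum => j; apply: measurable_funX; apply: measurable_funB.
    by have [mp _ _] := h2 j; exact: measurable_funS mp.
  by apply: off => y yx; exact: (drad_continuous FF yx).
apply: measurable_funX; apply: measurable_funB.
  exact: measurable_funS mu.
by apply: off => y yx; exact: (rad_continuous FF yx).
Qed.

Lemma poweR2_le (a : \bar R) (d : R) : (0 <= a)%E -> (a <= d%:E)%E ->
  (a `^ 2 <= (d ^+ 2)%:E)%E.
Proof.
case: a => [a| |]//; rewrite !lee_fin => a0 ad.
by rewrite powR_mulrn// lerXn2r// nnegrE// (le_trans a0).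
Qed.

Lemma integral_defect_le u K d : H1 Omega u -> compact K -> K `<=` Omega -> ~ K x ->
  (L2norm K (cabs (fun y => u y - helmholtz_G k (y - x))%R) +
   L2norm K (gabs (fun j y => grad Omega u j y -
     partial j (fun w => helmholtz_G k (w - x)) y)%R) <= d%:E)%E ->
  (\int[leb]_(y in K) (defect u y)%:E <= (2 * d ^+ 2)%:E)%E.
Proof.
move=> h1 cK KO nKx; set a := L2norm _ _; set b := L2norm _ _ => abd.
have a0 : (0 <= a)%E by exact: Lnorm_ge0.
have b0 : (0 <= b)%E by exact: Lnorm_ge0.
have ad : (a <= d%:E)%E by apply: le_trans abd; exact: leeDl.
have bd : (b <= d%:E)%E by apply: le_trans abd; exact: leeDr.
have mK : measurable K by exact: compact_measurable_rV.
have [m1 m2] := measurable_defect h1 cK KO nKx.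
have nx y : K y -> y != x by move=> Ky; apply/eqP => yx; apply: nKx; rewrite -yx.
under eq_integral do rewrite /defect EFinD.
rewrite ge0_integralD//; last 4 first.
- by move=> y _; rewrite lee_fin; apply: sumr_ge0 => j _; exact: sqr_ge0.
- exact/measurable_EFinP.
- by move=> y _; rewrite lee_fin sqr_ge0.
- exact/measurable_EFinP.
(* One [d ^+ 2] for each of the two norms, each being at most their sum. *)
rewrite (_ : 2 * d ^+ 2 = d ^+ 2 + d ^+ 2); last by ring.
rewrite EFinD; apply: leeD.
  apply: le_trans (poweR2_le b0 bd).
  rewrite -integral_sqr_L2norm; apply: ge0_integral_mono => y Ky.
    by rewrite lee_fin; apply: sumr_ge0 => j _; exact: sqr_ge0.
  rewrite lee_fin; apply: le_trans (sum_sqr_Re_le_gabs _ y).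
  by apply: ler_sum => j _; rewrite ReB Re_partial_helmholtz_shift// nx.
apply: le_trans (poweR2_le a0 ad).
rewrite -integral_sqr_L2norm; apply: ge0_integral_mono => y Ky.
  by rewrite lee_fin sqr_ge0.
rewrite lee_fin; apply: le_trans (sqr_Re_le_cabs _ y).
by rewrite ReB Re_helmholtz_shift// nx.
Qed.

End needle.

Section blowup.
Variables (R : realType) (n : nat) (k : R) (F F1 F2 : R -> R).
Local Notation m := n.+2.
Hypothesis FF : radial_solution m k F F1 F2.
Local Notation leb := (lebesgue_rV R m).
Local Notation ej j := (delta_mx 0 j : 'rV[R]_m).
Variables (Omega : set 'rV[R]_m) (x : 'rV[R]_m) (sigma : R -> 'rV[R]_m).
Hypotheses (oO : open Omega) (bO : bounded_set Omega).
Hypothesis GF : forall y : 'rV[R]_m, y != 0 -> complex.Re (helmholtz_G k y) = F (dot y y).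
Hypotheses (Ox : Omega x) (nsigma : needle Omega x sigma).

Let mO : measurable Omega. Proof. exact: open_measurable_rV. Qed.
Let Ofin : (leb Omega < +oo)%E. Proof. exact: bounded_lebesgue_lty. Qed.

(** The order of choices matters: [chi], the bound [C] and the value [J] come from the needle and
    [B]; the weights and the tube then depend on [M]; the index comes last, once the compact set and
    the tolerance [d] are fixed. *)
Lemma needle_blowup v B t0 : needle_sequence Omega k x sigma v ->
  open B -> t0 \in `]0, 1[ -> B (sigma t0) -> forall M : R,
  \forall i \near \oo,
    (M%:E <= \int[leb]_(y in B `&` Omega) (gabs (grad Omega (v i)) y ^+ 2)%:E)%E.
Proof.
move=> [vsol vcvg] oB t0I Bt0 M.
have [cs pl inj [bd0 s1 _ sO]] := nsigma.
have nO0 : ~ Omega (sigma 0) by exact: open_boundary.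
have sO1 t : 0 < t <= 1 -> Omega (sigma t).
  move=> /andP[t0' ]; rewrite le_eqVlt => /predU1P[->|t1]; first by rewrite s1.
  by apply: sO; rewrite in_itv/= t0'.
have [chi [a [b [bn0 echi [K [cK KO chiK]] chi1 chis]]]] :=
  needle_cutoff oO oB cs pl inj nO0 sO1 t0I Bt0.
rewrite s1 in chi1.
have [f [f1 fb]] := exists_unit_orthogonal b.
pose S := sigma @` `[0, 1].
have cS : compact S by apply: continuous_compact => //; exact: segment_compact.
have clS : closed S by apply: compact_closed => //; exact: norm_hausdorff.
have Sx : S x by exists 1 => //; rewrite /= in_itv/= ler01 lexx.
have mK : measurable K by exact: compact_measurable_rV.
pose q j y := pwave k x f y * 'D_(ej j) chi y.
pose r y := \sum_j dpwave k x f j y * 'D_(ej j) chi y.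
pose g := rad F x; pose dg := drad F1 x.
have dK j : supported K (fun y => 'D_(ej j) chi y) by exact: supported_derive.
have eq_ j : elementary (q j) by apply: el_mul; [exact: el_pwave|exact: el_derive].
have er : elementary r.
  by apply: el_sum => j; apply: el_mul; [exact: el_dpwave|exact: el_derive].
have qK j : supported K (q j) by exact: supportedMr.
have rK : supported K r by apply: supported_sum => j; exact: supportedMr.
have near_d j : \forall y \near x, 'D_(ej j) chi y = 0.
  by have := near_cst_derive0 chi1; apply: filterS => y; exact.
have cdgq j : continuous (fun y => dg j y * q j y).
  apply: (@continuous_cutM _ _ _ _ x); first by move=> y yx; exact: (drad_continuous FF yx).
    exact: el_continuous.
  by apply: filterS (near_d j) => y; rewrite /q => ->; rewrite mulr0.
have dgqK j : supported K (fun y => dg j y * q j y) by exact: supportedMr.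
(* [dg j] may blow up at [x], but [q j] vanishes near [x], so the product is continuous with compact
   support. *)
have [C C0 [Cq Cr Cg]] : exists2 C, 0 <= C & [/\ forall j y, `|q j y| <= C,
    forall y, `|r y| <= C & forall j y, `|dg j y * q j y| <= C].
  have /choice[c1 hc1] : forall j, exists c, 0 <= c /\ forall y, `|q j y| <= c.
    move=> j; have [c c0 hc] := supported_bounded cK (el_continuous (eq_ j)) (qK j).
    by exists c.
  have /choice[c2 hc2] : forall j, exists c, 0 <= c /\ forall y, `|dg j y * q j y| <= c.
    move=> j; have [c c0 hc] := supported_bounded cK (cdgq j) (dgqK j).
    by exists c.
  have [c3 c30 hc3] := supported_bounded cK (el_continuous er) rK.
  have s1_0 : 0 <= \sum_j c1 j by apply: sumr_ge0 => j _; have [] := hc1 j.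
  have s2_0 : 0 <= \sum_j c2 j by apply: sumr_ge0 => j _; have [] := hc2 j.
  have c1le j : c1 j <= \sum_j c1 j.
    by rewrite (bigD1 j)//= lerDl; apply: sumr_ge0 => i _; have [] := hc1 i.
  have c2le j : c2 j <= \sum_j c2 j.
    by rewrite (bigD1 j)//= lerDl; apply: sumr_ge0 => i _; have [] := hc2 i.
  exists (\sum_j c1 j + \sum_j c2 j + c3); first by rewrite !addr_ge0.
  split=> [j y|y|j y].
  - have [_ h] := hc1 j; have := h y; have := c1le j; lra.
  - have := hc3 y; lra.
  - have [_ h] := hc2 j; have := h y; have := c2le j; lra.
pose W := interior [set y | (forall v, 'D_v chi y = 0) \/
  (B y /\ exists c, forall j, 'D_(ej j) chi y = c * b 0 j)].
have oW : open W by exact: open_interior.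
have SW : S `<=` W.
  move=> _ [t /= tI <-]; rewrite in_itv/= in tI.
  by have [h _] := chis t tI; exact: h.
pose Q := [set y | exists j, 'D_(ej j) chi y != 0].
have oQ : open Q.
  rewrite (_ : Q = \bigcup_(j in [set: 'I_m]) [set y | 'D_(ej j) chi y != 0]).
    apply: bigcup_open => j _.
    apply: (@open_comp _ _ (fun y => 'D_(ej j) chi y) [set c | c != 0]).
      by move=> y _; exact/el_continuous/el_derive.
    exact: open_neq.
  by apply/seteqP; split => [y [j hj]|y [j _ hj]]; exists j.
have QK : Q `<=` K.
  by move=> y [j /eqP hj]; apply: contrapT => nK; apply: hj; exact: dK.
(* On [W] the gradient of [chi] is 0 or parallel to [b], and that of the wave is parallel to [f]:
   the coefficient of the values of the solution vanishes. *)
have rW y : W y -> r y = 0.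
  move=> /interior_subset[h|[_ [c hc]]].
    by rewrite /r big1// => j _; rewrite h mulr0.
  rewrite /r (eq_bigr (fun j => - k * sin (k * dot (y - x) f) * c * (f 0 j * b 0 j))).
    by rewrite -mulr_sumr -/(dot f b) fb mulr0.
  by move=> j _; rewrite hc /dpwave; ring.
have WQB y : W y -> Q y -> B y.
  by move=> /interior_subset[h [j]|[]//]; rewrite h eqxx.
have hQ0 y : ~ Q y -> (forall j, q j y = 0) /\ r y = 0.
  move=> nQ; have D0 j : 'D_(ej j) chi y = 0.
    by apply/eqP; apply: contrapT => /negP h; apply: nQ; exists j.
  split=> [j|]; first by rewrite /q D0 mulr0.
  by rewrite /r big1// => j _; rewrite D0 mulr0.
have oQW : open (Q `&` W) by exact: openI.
(* A point of the needle where [grad chi] is nonzero lies on the segment [a + t *: b]. *)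
have QS0 : leb ((Q `&` W) `&` S) = 0%E.
  apply: (lebesgue_segment0 (a := a) (b := b)).
    by apply: measurableI; [exact: open_measurable_rV|exact: closed_measurable_rV].
  move=> y [[[j hj] _] [t /= tI ty]]; rewrite in_itv/= in tI.
  by exists t => //; rewrite -ty in hj *; have [_] := chis t tI; apply; exists (ej j).
pose fluxG y := \sum_j flux k F F1 x f j y * 'D_(ej j) chi y.
have fluxGE y : fluxG y = \sum_j dg j y * q j y - g y * r y.
  rewrite /fluxG /r mulr_sumr -sumrB; apply: eq_bigr => j _.
  by rewrite /flux /q /g /dg; ring.
have ifluxG : leb.-integrable setT (EFin \o fluxG).
  apply: (supported_integrable cK); first exact: (flux_term_continuous FF echi chi1).
  by apply: supported_sum => j; exact: supportedMr.
have [J J0 JE] : exists2 J, 0 < J & (\int[leb]_(y in Omega) (fluxG y)%:E = J%:E)%E.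
  have := flux_gt0 FF f1 echi cK chiK chi1; have := integrable_fin_num measurableT ifluxG.
  rewrite (_ : \int[leb]_(y in [set: _]) (EFin \o fluxG) y = \int[leb]_(y in Omega) (fluxG y)%:E)%E.
    by case: (\int[leb]_(y in Omega) (fluxG y)%:E)%E => // J _ J0; exists J.
  rewrite [RHS]integral_mkcond; apply: eq_integral => y _.
  rewrite /patch; case: ifPn => // /negP yO; rewrite /= /fluxG big1// => j _.
  by rewrite (dK j)// ?mulr0// => /KO Oy; apply: yO; rewrite inE.
have ifluxGO : leb.-integrable Omega (EFin \o fluxG).
  exact: integrableS (measurableT) mO (@subsetT _ _) ifluxG.
have [kap kap0 kapE] : exists2 kap, 0 <= kap & leb K = kap%:E.
  have h1 := compact_lebesgue_lty cK.
  have h2 : (0 <= leb K)%E by exact: measure_ge0.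
  move: h1 h2; case: (leb K) => [c _ h|h _|_ h]; first by exists c.
    by rewrite ltxx in h.
  by [].
(* Each of the four error terms will be at most [J / 8]. *)
pose N := m%:R + 1 : R.
have N0 : 0 < N by rewrite ltr_wpDl.
(* Large enough for [N * C ^+ 2 * kap / (4 * s) <= J / 8]; the [+ 1] keeps it positive if [C] or
   [kap] is 0. [N] counts the [m] gradient components and the value of the function. *)
pose s := 2 * N * C ^+ 2 * kap / J + 1.
have sge0 : 0 <= 2 * N * C ^+ 2 * kap / J.
  by rewrite divr_ge0 ?(ltW J0)// !mulr_ge0// ?(ltW N0)// exprn_ge0.
have sp : 0 < s by rewrite ltr_wpDl.
pose c1 := N * (C ^+ 2 / (4 * s)).
have c10 : 0 <= c1 by rewrite mulr_ge0 ?(ltW N0)// divr_ge0 ?sqr_ge0// mulr_ge0// ltW.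
have c1k : c1 * kap <= J / 8.
  rewrite (_ : c1 * kap = N * C ^+ 2 * kap / (4 * s)); last by rewrite /c1; ring.
  rewrite ler_pdivrMr ?mulr_gt0// (_ : J / 8 * (4 * s) = N * C ^+ 2 * kap + J / 2); first lra.
  by rewrite /s; field; rewrite gt_eqF.
(* Makes [s] times [2 * d ^+ 2], the bound of [integral_defect_le], equal to [J / 8]. *)
pose d := Num.sqrt (J / (16 * s)).
have d0 : 0 < d by rewrite sqrtr_gt0 divr_gt0// mulr_gt0.
have d2 : s * (2 * d ^+ 2) = J / 8.
  by rewrite sqr_sqrtr ?divr_ge0 ?(ltW J0) ?mulr_ge0 ?(ltW sp)//; field; rewrite gt_eqF.
(* [|M| + 1] stands for the energy bound because [M] may be 0 or negative. *)
pose eps := J / (8 * (`|M| + 1)).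
have M1 : 0 < `|M| + 1 by rewrite ltr_wpDl.
have eps0 : 0 < eps by rewrite divr_gt0// mulr_gt0.
have epsM : eps * (`|M| + 1) = J / 8 by rewrite /eps; field; rewrite gt_eqF.
(* On the tube each component costs [C] for [dg j * q j], and [C ^+ 2 / (4 * eps)] as the remainder
   of Young's inequality for [p j * q j]. *)
pose c2 := m%:R * (C + C ^+ 2 / (4 * eps)).
have c20 : 0 <= c2.
  by rewrite mulr_ge0// addr_ge0// divr_ge0 ?sqr_ge0// mulr_ge0// ltW.
pose eta := J / (8 * (c2 + 1)).
have c21 : 0 < c2 + 1 by rewrite ltr_wpDl.
have eta0 : 0 < eta by rewrite divr_gt0// mulr_gt0.
have etaE : c2 * eta <= J / 8.
  rewrite -[leRHS](_ : (c2 + 1) * eta = _); last by rewrite /eta; field; rewrite gt_eqF.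
  by rewrite ler_wpM2r ?(ltW eta0)// lerDl.
have QWK : Q `&` W `<=` K by move=> y [/QK].
have [i hi] := tube_measure_small eta0 clS oQW cK QWK QS0.
(* [E] is the part of [Q] near the needle and [Ki] a compact set that avoids the needle. A point of
   [Omega] outside both lies outside [Q], where the integrand is 0. *)
pose E := Q `&` W `&` tube S i.
pose Ki := K `\` (W `&` tube S i).
have oE : open E by apply: openI => //; exact: open_tube.
have mE : measurable E by exact: open_measurable_rV.
have cKi : compact Ki.
  rewrite /Ki setDE; apply: compact_closedI => //; apply: open_closedC.
  by apply: openI => //; exact: open_tube.
have mKi : measurable Ki by exact: compact_measurable_rV.
have KiO : Ki `<=` Omega by move=> y [/KO].
have KiS : Ki `<=` Omega `\` S.
  move=> y [/KO Oy nWt]; split => // Sy; apply: nWt; split; [exact: SW|exact: sub_tube].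
have nKix : ~ Ki x by move=> /KiS[].
have EB : E `<=` B `&` Omega.
  by move=> y [[Qy Wy] _]; split; [exact: WQB|exact/KO/QK].
have nE y : Omega y -> ~ Ki y -> ~ E y -> ~ Q y.
  move=> Oy nKi nE Qy; apply: nKi; split; first exact: QK.
  by move=> [Wy Ty]; apply: nE.
have cv := cvge0_lt d0 (vcvg _ cKi KiS).
apply: filterS cv => l hl; rewrite leNgt; apply/negP => small.
have [h1 _] := vsol l.
have [h2 _] := grad_L2_gradient h1; have [[mu _ _] _] := h1.
pose p j y := complex.Re (grad Omega (v l) j y).
pose U y := complex.Re (v l y).
have [ifluxV fluxVE] := solution_flux0 (vsol l) mO Ofin x f1 echi cK KO chiK.
set fluxV := (fun y => _) in ifluxV fluxVE.
(* The flux of the fundamental solution integrates to [J] and that of [v l] to 0, so [h] integrates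
   to [J]. *)
pose h y := fluxG y - fluxV y.
have hE y : h y = \sum_j (dg j y - p j y) * q j y - (g y - U y) * r y.
  have -> : \sum_j (dg j y - p j y) * q j y =
      \sum_j dg j y * q j y - \sum_j p j y * q j y.
    by rewrite -sumrB; apply: eq_bigr => j _; rewrite mulrBl.
  by rewrite /h fluxGE /fluxV /= -/(r y) -/(U y) -/(\sum_j p j y * q j y); ring.
have ih : leb.-integrable Omega (EFin \o h) by exact: (integrableB mO ifluxGO ifluxV).
have Jle : (J%:E <= \int[leb]_(y in Omega) `|(h y)%:E|)%E.
  apply: (@le_trans _ _ `|\int[leb]_(y in Omega) (h y)%:E|%E); last first.
    by apply: le_abse_integral => //; exact: measurable_int ih.
  have -> : (\int[leb]_(y in Omega) (h y)%:E = J%:E)%E.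
    rewrite -[RHS]sube0 -JE.
    have <- : (\int[leb]_(y in Omega) (fluxV y)%:E = 0)%E.
      by rewrite -[LHS]fineK; [congr EFin|exact: integrable_fin_num].
    by rewrite -integralB.
  by rewrite lee_fin ler_norm.
have dis : [disjoint Ki & E] by apply/disj_setPS => y [[_ nWt] [[_ Wy] Ty]]; apply: nWt.
have mh : measurable_fun Omega (fun y => `|(h y)%:E|%E).
  apply: (@measurableT_comp _ _ _ _ _ _ abse _ (EFin \o h)); last exact: measurable_int ih.
  exact: abse_measurable.
have UO : Ki `|` E `<=` Omega by move=> y [/KiO|/EB[]].
have split_int : (\int[leb]_(y in Omega) `|(h y)%:E| =
    \int[leb]_(y in Ki) `|(h y)%:E| + \int[leb]_(y in E) `|(h y)%:E|)%E.
  rewrite -ge0_integral_setU//; last first.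
    exact: measurable_funS mO UO mh.
  rewrite [LHS]integral_mkcond [RHS]integral_mkcond; apply: eq_integral => y _.
  rewrite /patch; case: ifPn => yO; case: ifPn => yU//.
    have [q0 r0] : (forall j, q j y = 0) /\ r y = 0.
      apply: hQ0; apply: nE; first by move: yO; rewrite inE.
        by move=> Ky; move/negP: yU; apply; rewrite inE; left.
      by move=> Ey; move/negP: yU; apply; rewrite inE; right.
    by rewrite hE r0 mulr0 subr0 big1 ?abse0// => j _; rewrite q0 mulr0.
  by move/negP: yO; case; rewrite inE; apply: UO; move: yU; rewrite inE.
have boundK : (\int[leb]_(y in Ki) `|(h y)%:E| <= (s * (2 * d ^+ 2) + c1 * kap)%:E)%E.
  have [m1 m2] := measurable_defect FF oO h1 cKi KiO nKix.
  apply: (@integral_affine_bound _ _ _ _ (defect F F1 Omega x (v l))) => //.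
  - exact: measurable_funD m1 m2.
  - by move=> y _; exact: defect_ge0.
  - exact: ltW.
  - move=> y Ky; rewrite hE; apply: le_trans (ler_normB _ _) _.
    apply: le_trans (lerD (ler_norm_sum _ _ _) (abs_mul_le_sqr _ sp (Cr y))) _.
    apply: (@le_trans _ _ (\sum_j (s * (dg j y - p j y) ^+ 2 + C ^+ 2 / (4 * s))
        + (s * (g y - U y) ^+ 2 + C ^+ 2 / (4 * s)))).
      by rewrite lerD2r; apply: ler_sum => j _; exact: abs_mul_le_sqr.
    have -> : defect F F1 Omega x (v l) y =
        \sum_j (dg j y - p j y) ^+ 2 + (g y - U y) ^+ 2.
      rewrite /defect -[in RHS](sqrrN (g y - U y)) opprB; congr (_ + _).
      by apply: eq_bigr => j _; rewrite -[RHS]sqrrN opprB.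
    rewrite big_split/= -mulr_sumr sumr_const card_ord -(mulr_natl (C ^+ 2 / (4 * s)) m).
    rewrite /c1 /N; set S1 := \sum_j _; set c := C ^+ 2 / (4 * s).
    by rewrite le_eqVlt; apply/orP; left; apply/eqP; ring.
  - by apply: (integral_defect_le FF oO GF h1 cKi KiO nKix); exact: ltW.
  - rewrite -kapE; apply: le_measure; rewrite ?inE//.
    by move=> y [].
have boundE : (\int[leb]_(y in E) `|(h y)%:E| <= (eps * (`|M| + 1) + c2 * eta)%:E)%E.
  have EO : E `<=` Omega by move=> y /EB[].
  apply: (@integral_affine_bound _ _ _ _ (fun y => \sum_j p j y ^+ 2)) => //.
  - apply: measurable_sum => j; apply: measurable_funX.
    by have [mp _ _] := h2 j; exact: measurable_funS mp.
  - by move=> y _; apply: sumr_ge0 => j _; exact: sqr_ge0.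
  - exact: ltW.
  - move=> y [[Qy Wy] _]; rewrite hE (rW _ Wy) mulr0 subr0.
    apply: le_trans (ler_norm_sum _ _ _) _.
    apply: (@le_trans _ _ (\sum_j (C + (eps * p j y ^+ 2 + C ^+ 2 / (4 * eps))))).
      apply: ler_sum => j _; rewrite mulrBl; apply: le_trans (ler_normB _ _) _.
      by apply: lerD; [exact: Cg|exact: abs_mul_le_sqr].
    rewrite big_split/= big_split/= -mulr_sumr !sumr_const card_ord
      -(mulr_natl C m) -(mulr_natl (C ^+ 2 / (4 * eps)) m).
    rewrite /c2; set S1 := \sum_j _; set c := C ^+ 2 / (4 * eps).
    by rewrite le_eqVlt; apply/orP; left; apply/eqP; ring.
  - apply: (@le_trans _ _ M%:E); last first.
      by rewrite lee_fin (le_trans (ler_norm M))// lerDl.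
    apply: le_trans (ltW small).
    apply: (@le_trans _ _ (\int[leb]_(y in E) (gabs (grad Omega (v l)) y ^+ 2)%:E)%E).
      apply: ge0_integral_mono => y _; first rewrite lee_fin.
        by apply: sumr_ge0 => j _; exact: sqr_ge0.
      by rewrite lee_fin; exact: sum_sqr_Re_le_gabs.
    rewrite [leLHS]integral_mkcond [leRHS]integral_mkcond.
    apply: ge0_integral_mono => y _; rewrite /patch.
      by case: ifPn => // _; rewrite lee_fin sqr_ge0.
    case: ifPn => yE; case: ifPn => yB//; last by rewrite lee_fin sqr_ge0.
    by move/negP: yB; case; rewrite inE; apply: EB; move: yE; rewrite inE.
  - exact: ltW.
(* The four bounds add up to at most [J / 2], against [J > 0]. *)
have := le_trans Jle _; rewrite split_int => /(_ _ (leeD boundK boundE)).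
rewrite -EFinD lee_fin d2 epsM => Jsmall.
clear -Jsmall J0 c1k etaE; lra.
Qed.

End blowup.

Theorem lemma2p2 (R : realType) (m : nat) (hm : m = 2%N \/ m = 3%N)
    (Omega : set 'rV[R]_m) (hOmega : bounded_lipschitz_domain Omega)
    (k : R) (hk : 0 <= k) (hD : ~ zero_dirichlet_eigenvalue Omega k)
    (x : 'rV[R]_m) (hx : Omega x)
    (sigma : R -> 'rV[R]_m) (hsigma : needle Omega x sigma)
    (v : nat -> 'rV[R]_m -> R[i]) (hv : needle_sequence Omega k x sigma v)
    (z : 'rV[R]_m) (hz : (sigma @` `]0, 1[) z) (r : R) (hr : 0 < r) :
  (\int[lebesgue_rV R m]_(y in eball z r `&` Omega)
     (gabs (grad Omega (v n)) y ^+ 2)%R%:E)%E @[n --> \oo] --> +oo%E.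
Proof.
have [oO _ bO _] := hOmega.
have [F [F1 [F2 [FF GF]]]] := radial_helmholtz_G hm hk.
(* The null segment and the orthogonal direction both call for two coordinates, whence the form
   [n.+2]. *)
have [n mE] : exists n, m = n.+2 by case: hm => ->; [exists 0%N|exists 1%N].
subst m; case: hz => t tI tz.
have oB : open (eball z r).
  rewrite (_ : eball z r = [set y | dot (y - z) (y - z) < r ^+ 2]).
    exact/open_elementary_lt/el_dot.
  apply/seteqP; split=> y; rewrite /eball /= -sqr_enorm.
    by rewrite ltr_pXn2r// nnegrE ?enorm_ge0// ltW.
  by rewrite ltr_pXn2r// nnegrE ?enorm_ge0// ltW.
apply/cvgeyPge => M.
apply: (needle_blowup FF oO bO GF hx hsigma hv oB tI).
rewrite tz /eball /= subrr /enorm (eqP (_ : dot 0 0 == 0)) ?dot_eq0//.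
by rewrite sqrtr0.
Qed.
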